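(* Let $U\subset\mathbb{R}^d$ be a bounded open set with locally Lipschitz boundary, $u:\bar U\to[0,\infty)$ bounded and smooth with $\Delta u<0$ in $U$, $f:\mathbb{R}^d\to(0,\infty)$ bounded measurable, and $\mu$ a measure with bounded density supported in $\bar U$ with $\mu(U)\le\int_Uf\,dx$. Define $$P(\mu,f,u)=\inf\Big\{\int u\,d\nu:\ \tau\le\tau^U,\ W_\tau\sim\nu\le f\chi_U,\ W_0\sim\mu\Big\}$$ and $$D(\mu,f,u)=\sup_{(\phi,\psi)\in\mathcal D}\Big[\int\phi(y)f(y)\,dy-\int\psi\,d\mu\Big],$$ where $\mathcal D$ is the set of pairs $(\phi,\psi)$ of functions in $L^1(U)$ with $\phi\le0$, $\psi\ge\phi-u$ in $U$, and $\psi$ superharmonic in $U$. Then $D(\mu,f,u)\le P(\mu,f,u)$.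
   Context: The infimum in $P$ is over (randomized) stopping times $\tau$ (maps from $\Omega$ to probability measures on $\mathbb{R}_+$ with $\omega\mapsto\tau(\omega)([0,t])$ $\mathcal F_t$-measurable) with $\tau\le\tau^U:=\inf\{t>0:W_t\notin U\}$, Brownian motion started with law $\mu$, and terminal law $\nu$ (i.e. $\mathbb E[\int g(W_t)\tau(dt)]=\int g\,d\nu$) having density $\le f\chi_U$. Superharmonic: lower semicontinuous with the super-mean value property on balls. *)

(* Defs.v *)
(* Points of R^d are row vectors 'rV[R]_d with d = n.+1. *)
From HB Require Import structures.
From mathcomp Require Import all_boot all_order all_algebra.
From mathcomp Require Import all_classical all_reals all_analysis.
From mathcomp Require Import measurable_realfun.

Set Implicit Arguments.
Unset Strict Implicit.
Unset Printing Implicit Defensive.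

Import Order.TTheory GRing.Theory Num.Theory.
Import numFieldNormedType.Exports.

Local Open Scope classical_set_scope.
Local Open Scope ring_scope.

Notation Rd R n := (g_sigma_algebraType (@open 'rV[R]_(n.+1))).

Section Defs.
Variables (R : realType) (n : nat).
Local Notation V := 'rV[R]_(n.+1).

Definition Rplus : set R := `[0, +oo[%classic.

Definition sqnorm {m} (x : 'rV[R]_m) : R := \sum_(i < m) (x ord0 i) ^+ 2.
Definition cball_e (x : V) (r : R) : set V := [set y | sqnorm (y - x) <= r ^+ 2].

(* Lebesgue measure on R^d: the (unique) Borel measure giving closed boxes
   their volume. *)
Definition is_lebesgue_d (lam : {measure set (Rd R n) -> \bar R}) : Prop :=
  forall a b : V, (forall i, a ord0 i <= b ord0 i) ->
    lam [set x : V | forall i, a ord0 i <= x ord0 i <= b ord0 i]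
    = (\prod_(i < n.+1) (b ord0 i - a ord0 i))%:E.

(* locally Lipschitz boundary: near each boundary point, after a rigid motion
   (orthogonal change of coordinates), U is the region strictly above the graph
   of a Lipschitz function of the first d-1 coordinates. *)
Definition lipschitz_fun {m} (g : 'rV[R]_m -> R) : Prop :=
  exists L : R, forall a b, (g a - g b) ^+ 2 <= L ^+ 2 * sqnorm (a - b).

Definition locally_lipschitz_boundary (U : set V) : Prop :=
  forall x : V, closure U x -> ~ U x ->
  exists r : R, exists Q : 'M[R]_(n.+1), exists g : 'rV[R]_n -> R,
    [/\ 0 < r, Q *m Q^T = 1%:M, lipschitz_fun g &
      forall y : V, sqnorm (y - x) < r ^+ 2 ->
        (U y <-> let z := (y - x) *m Q in
                 g (\row_(j < n) z ord0 (widen_ord (leqnSn n) j)) < z ord0 ord_max)].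

Fixpoint dirderiv (vs : seq V) (f : V -> R) : V -> R :=
  match vs with
  | [::] => f
  | v :: vs' => 'D_v (dirderiv vs' f)
  end.

Definition smooth_on (A : set V) (f : V -> R) : Prop :=
  forall (vs : seq V) (x : V), A x ->
    (forall v : V, derivable (dirderiv vs f) x v) /\
    {for x, continuous (dirderiv vs f)}.

Definition smooth_on_closure (U : set V) (f : V -> R) : Prop :=
  exists O : set V, [/\ open O, closure U `<=` O & smooth_on O f].

Definition unit_vec (i : 'I_n.+1) : V := delta_mx ord0 i.

Definition laplacian (f : V -> R) (x : V) : R :=
  \sum_(i < n.+1) dirderiv [:: unit_vec i; unit_vec i] f x.

Definition superharmonic_in (lam : {measure set (Rd R n) -> \bar R})
    (U : set V) (psi : V -> \bar R) : Prop :=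
  [/\ (forall x, U x -> (-oo < psi x)%E),
      (forall x, U x -> forall a : R, (a%:E < psi x)%E ->
          exists2 W, nbhs x W & forall y, W y -> (a%:E < psi y)%E) &
      (forall x r, U x -> 0 < r -> cball_e x r `<=` U ->
          ((fine (lam (cball_e x r)))^-1%:E *
             \int[lam]_(y in (cball_e x r : set (Rd R n))) psi y <= psi x)%E)].

Definition gauss_density (t : R) (x : V) : R :=
  ((Num.sqrt (2 * pi * t)) ^+ n.+1)^-1 * expR (- sqnorm x / (2 * t)).

Definition gauss (lam : {measure set (Rd R n) -> \bar R}) (t : R)
  (B : set (Rd R n)) : \bar R :=
  \int[lam]_(x in B) (gauss_density t x)%:E.

Section Process.
Context {dO : measure_display} {Omega : measurableType dO}.

Definition filtration (F : R -> set (set Omega)) : Prop :=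
  [/\ forall t, sigma_algebra setT (F t),
      forall s t, s <= t -> F s `<=` F t &
      forall t, F t `<=` measurable].

(* F-Brownian motion in R^d (under a finite measure P, not necessarily of
   mass one): continuous paths, adapted, and for 0 <= s < t the increment
   W_t - W_s is independent of F_s with law N(0, (t-s) I). *)
Definition brownian_motion (lam : {measure set (Rd R n) -> \bar R})
    (P : {measure set Omega -> \bar R}) (F : R -> set (set Omega))
    (W : R -> Omega -> V) : Prop :=
  [/\ forall w, {within Rplus, continuous (fun t => W t w)},
      forall t, 0 <= t ->
        @measurable_fun _ _ (g_sigma_algebraType (F t)) (Rd R n) setT (W t) &
      forall s t (A : set Omega) (B : set (Rd R n)), 0 <= s -> s < t ->
        F s A -> measurable B ->
        P (A `&` [set w | B (W t w - W s w)]) = (P A * gauss lam (t - s) B)%E].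

Definition exit_time (U : set V) (W : R -> Omega -> V) (w : Omega) : \bar R :=
  ereal_inf [set t%:E | t in [set t : R | 0 < t /\ ~ U (W t w)]].

Definition randomized_stopping_time (F : R -> set (set Omega))
    (tau : Omega -> probability R R) : Prop :=
  (forall w, tau w Rplus = 1%E) /\
  (forall t, 0 <= t ->
     @measurable_fun _ _ (g_sigma_algebraType (F t)) (\bar R) setT
       (fun w => tau w `[0, t]%classic)).

Definition before_exit (U : set V) (W : R -> Omega -> V)
    (tau : Omega -> probability R R) : Prop :=
  forall w, tau w [set t : R | (exit_time U W w < t%:E)%E] = 0%E.

Definition terminal_law (P : {measure set Omega -> \bar R})
    (W : R -> Omega -> V) (tau : Omega -> probability R R)
    (nu : {measure set (Rd R n) -> \bar R}) : Prop :=
  forall g : Rd R n -> R, measurable_fun setT g -> (forall x, 0 <= g x) ->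
    (\int[P]_w \int[tau w]_(t in Rplus) (g (W t w))%:E
     = \int[nu]_x (g x)%:E)%E.

Definition density_below (lam : {measure set (Rd R n) -> \bar R})
    (nu : {measure set (Rd R n) -> \bar R}) (f : V -> R) (U : set V) : Prop :=
  exists h : Rd R n -> R, [/\ measurable_fun setT h,
    forall x, 0 <= h x /\ h x <= (if asbool (U x) then f x else 0) &
    forall A : set (Rd R n), measurable A -> nu A = (\int[lam]_(x in A) (h x)%:E)%E].

Definition primal_value (lam : {measure set (Rd R n) -> \bar R})
    (P : {measure set Omega -> \bar R}) (F : R -> set (set Omega))
    (W : R -> Omega -> V) (f u : V -> R) (U : set V) : \bar R :=
  ereal_inf [set (\int[nu]_(x in (U : set (Rd R n))) (u x)%:E)%E
    | nu in [set nu : {measure set (Rd R n) -> \bar R} |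
        exists tau : Omega -> probability R R,
          [/\ randomized_stopping_time F tau, before_exit U W tau,
              density_below lam nu f U & terminal_law P W tau nu]]].

End Process.

Definition dual_feasible (lam : {measure set (Rd R n) -> \bar R})
    (u : V -> R) (U : set V) (phi : V -> R) (psi : V -> \bar R) : Prop :=
  [/\ lam.-integrable (U : set (Rd R n)) (fun x => (phi x)%:E),
      lam.-integrable (U : set (Rd R n)) psi,
      forall x, U x -> phi x <= 0,
      forall x, U x -> ((phi x - u x)%:E <= psi x)%E &
      superharmonic_in lam U psi].

Definition dual_value (lam : {measure set (Rd R n) -> \bar R})
    (mu : {measure set (Rd R n) -> \bar R}) (f u : V -> R) (U : set V) : \bar R :=
  ereal_sup [set (\int[lam]_(y in (U : set (Rd R n))) (p.1 y * f y)%:E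
                  - \int[mu]_(x in (U : set (Rd R n))) p.2 x)%E
    | p in [set p : (V -> R) * (V -> \bar R) | dual_feasible lam u U p.1 p.2]].

End Defs.

(* Main.v *)
Require Import Defs.
From HB Require Import structures.
From mathcomp Require Import all_boot all_order all_algebra.
From mathcomp Require Import all_classical all_reals all_analysis.
From mathcomp Require Import measurable_realfun.
From mathcomp Require Import ring lra.
Import Order.TTheory GRing.Theory Num.Theory.
Import numFieldNormedType.Exports.
Local Open Scope classical_set_scope.
Local Open Scope ring_scope.
Set Implicit Arguments.
Unset Strict Implicit.
Unset Printing Implicit Defensive.

(* Write [nu = h dx] and [mu = m dx].  Since [phi <= 0] and [h <= f], we have
   [phi f <= phi h <= (psi + u) h], so everything reduces to the inequality
   [int psi h <= int psi m] for [psi] superharmonic and integrable on U.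

   Let P_t be the heat semigroup and [v = d (P_d + P_2d + ... + P_S) (m - h)] the
   discretised potential of [m - h], so that [P_d v - v = d P_d w] with w close to
   [h - m] for S large.  The Markov property and the rounding of tau to the grid
   identify [P_theta v], up to o(1), with the occupation density of Brownian
   motion before tau smoothed at scale theta.  Hence v is bounded, [v >= -o(1)],
   and [v <= o(1)] off U; the Lipschitz boundary is used only for the last bound,
   to approximate points off U by exterior points.

   It remains to see that [int psi (P_d v - v) <= o(d)] for such a v.  One replaces
   v by [H(v)], where H is convex, vanishes for small arguments, and has as
   derivative a logarithmic ramp from 0 at [b^2] to 1 at [b].  As [H(v)] is
   supported well inside U, the super mean value property, applied to the balls
   that are the superlevel sets of the Gaussian, gives
   [int psi (P_d H(v) - H(v)) <= o(d)].  The remainder [v - H(v)] is at most b;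
   averaging over times up to a fixed theta, by continuity of P_t in L^1, its
   contribution is O(b), while the Bregman error of H is O(d) uniformly in b
   thanks to the log-Lipschitz bound
   [|v(x+z) - v(x)|^2 <= C |z|^2 v(x) ln (1/v(x))]. *)

(** * Integrals of real functions *)

Section RealIntegrals.
Context (d : measure_display) (T : measurableType d) (R : realType).
Variable mu : {measure set T -> \bar R}.
Implicit Types (f g h : T -> R) (M N c : R).

Definition bounded_measurable f M :=
  measurable_fun setT f /\ forall x, `|f x| <= M.

Lemma bounded_measurable_ge0 f M : bounded_measurable f M -> T -> 0 <= M.
Proof. by move=> [_ fM] x; exact: le_trans (normr_ge0 _) (fM x). Qed.

Lemma bounded_measurableB f g M N : bounded_measurable f M ->
  bounded_measurable g N -> bounded_measurable (fun x => f x - g x) (M + N).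
Proof.
move=> [mf fM] [mg gN]; split; first exact: measurable_funB.
by move=> x; rewrite (le_trans (ler_normB _ _))// lerD.
Qed.

Lemma bounded_measurableZ c f M : bounded_measurable f M ->
  bounded_measurable (fun x => c * f x) (`|c| * M).
Proof.
move=> [mf fM]; split; first exact: measurable_funM.
by move=> x; rewrite normrM ler_wpM2l.
Qed.

Lemma bounded_measurable_cst c : bounded_measurable (fun=> c) `|c|.
Proof. by split => //; exact: measurable_cst. Qed.

Lemma bounded_measurable1 : bounded_measurable (fun=> 1) 1.
Proof. by rewrite -[X in bounded_measurable _ X](@normr1 R); exact: bounded_measurable_cst. Qed.

Lemma bounded_measurable_indic (A : set T) : measurable A -> bounded_measurable \1_A 1.
Proof.
move=> mA; split; first exact: measurable_indic.
by move=> x; rewrite indicE; case: (_ \in _); rewrite ?normr1 ?normr0.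
Qed.

Lemma bounded_measurable_sum (I : Type) (s : seq I) (F : I -> T -> R) M :
  (forall i, bounded_measurable (F i) M) ->
  bounded_measurable (fun x => \sum_(i <- s) F i x) ((size s)%:R * M).
Proof.
move=> FM; split; first by apply: measurable_sum => i; exact: (FM i).1.
elim: s => [|i s ih] x; first by rewrite big_nil normr0 mul0r.
rewrite big_cons /= (le_trans (ler_normD _ _))// -natr1 mulrDl mul1r addrC.
by rewrite lerD//; exact: (FM i).2.
Qed.

Definition Rintegrable f := mu.-integrable setT (EFin \o f).

Lemma Rintegrable_measurable f : Rintegrable f -> measurable_fun setT f.
Proof. by move=> /integrableP[/measurable_EFinP]. Qed.

Lemma RintegrableD f g : Rintegrable f -> Rintegrable g ->
  Rintegrable (fun x => f x + g x).
Proof. by move=> fi gi; have := integrableD measurableT fi gi. Qed.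

Lemma RintegrableB f g : Rintegrable f -> Rintegrable g ->
  Rintegrable (fun x => f x - g x).
Proof. by move=> fi gi; have := integrableB measurableT fi gi. Qed.

Lemma RintegrableZ c f : Rintegrable f -> Rintegrable (fun x => c * f x).
Proof. by move=> fi; have := integrableZl measurableT c fi. Qed.

Lemma Rintegrable_sum (I : Type) (s : seq I) (F : I -> T -> R) :
  (forall i, Rintegrable (F i)) -> Rintegrable (fun x => \sum_(i <- s) F i x).
Proof.
move=> Fi; rewrite /Rintegrable.
under [_ \o _]eq_fun do rewrite /= -sumEFin.
by apply: integrable_sum => // i _; exact: Fi.
Qed.

Lemma Rintegrable_norm f : Rintegrable f -> Rintegrable (fun x => `|f x|).
Proof. exact: integrable_norm. Qed.

Lemma le_Rintegrable f g : measurable_fun setT f -> (forall x, `|f x| <= g x) ->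
  Rintegrable g -> Rintegrable f.
Proof.
move=> mf fg gi; apply: (le_integrable measurableT _ _ gi).
  exact/measurable_EFinP.
by move=> x _ /=; rewrite lee_fin (le_trans (fg x))// ler_norm.
Qed.

Lemma RintegrableM f h M : Rintegrable f -> bounded_measurable h M ->
  Rintegrable (fun x => f x * h x).
Proof.
move=> fi [mh hM]; apply: (@le_Rintegrable _ (fun x => M * `|f x|)).
- by apply: measurable_funM => //; exact: Rintegrable_measurable.
- by move=> x; rewrite normrM mulrC ler_wpM2r.
- exact/RintegrableZ/Rintegrable_norm.
Qed.

Lemma Rintegrable_cst c : (mu setT < +oo)%E -> Rintegrable (fun=> c).
Proof.
move=> fin; apply: measurable_bounded_integrable => //.
exact: bounded_cst.
Qed.

Lemma bounded_Rintegrable f M : (mu setT < +oo)%E -> bounded_measurable f M ->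
  Rintegrable f.
Proof.
by move=> fin [mf fM]; apply: (@le_Rintegrable _ (fun=> M)) => //; exact: Rintegrable_cst.
Qed.

Lemma Rintegrable_indic (A : set T) : measurable A -> (mu A < +oo)%E -> Rintegrable \1_A.
Proof.
move=> mA Aoo; apply/integrableP; split; first exact/measurable_EFinP.
under eq_integral do rewrite /= ger0_norm//.
by rewrite integral_indic// setIT.
Qed.

Lemma EFin_Rintegral f : Rintegrable f -> (\int[mu]_x f x)%:E = (\int[mu]_x (f x)%:E)%E.
Proof. by move=> fi; rewrite fineK//; exact: integrable_fin_num. Qed.

Lemma Rintegral_sum (I : Type) (s : seq I) (F : I -> T -> R) :
  (forall i, Rintegrable (F i)) ->
  \int[mu]_x (\sum_(i <- s) F i x) = \sum_(i <- s) \int[mu]_x F i x.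
Proof.
move=> Fi; elim: s => [|i s ih].
  under eq_Rintegral do rewrite big_nil.
  by rewrite big_nil Rintegral_cst// mul0r.
under eq_Rintegral do rewrite big_cons.
by rewrite big_cons -ih RintegralD//; [exact: Fi|exact: Rintegrable_sum].
Qed.

Lemma Rintegral_indic (A : set T) : measurable A -> \int[mu]_x \1_A x = fine (mu A).
Proof. by move=> mA; rewrite /Rintegral integral_indic// setIT. Qed.

Lemma integral_EFin_indic (A : set T) f : measurable A -> Rintegrable f ->
  (\int[mu]_(x in A) (f x)%:E)%E = (\int[mu]_x (f x * \1_A x))%:E.
Proof.
move=> mA fi; have fA_i := RintegrableM fi (bounded_measurable_indic mA).
rewrite (EFin_Rintegral fA_i) integral_mkcond; apply: eq_integral => x _.
by rewrite patchE indicE; case: (_ \in _); rewrite ?mulr1 ?mulr0.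
Qed.

Lemma normr_Rintegral_le f g : Rintegrable f -> Rintegrable g ->
  (forall x, `|f x| <= g x) -> `|\int[mu]_x f x| <= \int[mu]_x g x.
Proof.
move=> fi gi fg; apply: (le_trans (le_normr_Rintegral measurableT fi)).
exact: (le_Rintegral measurableT (Rintegrable_norm fi) gi).
Qed.

Lemma normr_RintegralM_le f h M : Rintegrable f -> bounded_measurable h M ->
  `|\int[mu]_x (f x * h x)| <= M * \int[mu]_x `|f x|.
Proof.
move=> fi hM; have nfi := Rintegrable_norm fi.
rewrite -(RintegralZl M measurableT nfi); apply: normr_Rintegral_le.
- exact: RintegrableM hM.
- exact: RintegrableZ.
- by move=> x; rewrite normrM mulrC ler_wpM2r//; exact: hM.2.
Qed.

Lemma ae_sub (P Q : T -> Prop) : {ae mu, forall x, P x} -> (forall x, P x -> Q x) ->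
  {ae mu, forall x, Q x}.
Proof. by move=> aeP PQ; apply: filterS aeP. Qed.

Lemma ae_eq_Rintegral f g : Rintegrable f -> measurable_fun setT g ->
  {ae mu, forall x, f x = g x} -> \int[mu]_x f x = \int[mu]_x g x.
Proof.
move=> fi mg fg; congr fine; apply: ae_eq_integral => //.
- exact: measurable_int fi.
- exact/measurable_EFinP.
- by apply: filterS fg => x + _ => ->.
Qed.

Lemma ae_le_Rintegral f g : Rintegrable f -> Rintegrable g ->
  {ae mu, forall x, f x <= g x} -> \int[mu]_x f x <= \int[mu]_x g x.
Proof.
move=> fi gi fg; have gfi := RintegrableB gi fi.
rewrite -subr_ge0 -RintegralB//.
rewrite (@ae_eq_Rintegral _ (fun x => `|g x - f x|) gfi); first exact: Rintegral_ge0.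
  exact/Rintegrable_measurable/Rintegrable_norm.
by apply: filterS fg => x fgx; rewrite ger0_norm// subr_ge0.
Qed.

Lemma ae_dominated_Rintegral (f_ : nat -> T -> R) f g :
  (forall k, measurable_fun setT (f_ k)) -> measurable_fun setT f ->
  Rintegrable g -> {ae mu, forall x k, `|f_ k x| <= g x} ->
  {ae mu, forall x, f_ ^~ x @ \oo --> f x} ->
  (fun k => \int[mu]_x f_ k x) @ \oo --> \int[mu]_x f x.
Proof.
move=> mf_ mf gi fg cf.
have [fi _ cvg_int] : [/\ mu.-integrable setT (EFin \o f),
    [sequence (\int[mu]_x `|(f_ k x)%:E - (f x)%:E|)%E]_k @ \oo --> 0%E &
    [sequence (\int[mu]_x (f_ k x)%:E)%E]_k @ \oo --> (\int[mu]_x (f x)%:E)%E].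
  apply: (@dominated_convergence _ _ _ mu setT measurableT
    (fun k x => (f_ k x)%:E) (EFin \o f) (EFin \o g)) => //.
  - by move=> k; exact/measurable_EFinP.
  - exact/measurable_EFinP.
  - apply: filterS cf => x cf _; apply/fine_cvgP; split; [exact: nearW|exact: cf].
  - by apply: filterS fg => x fg k _; rewrite lee_fin.
have : (\int[mu]_x (f x)%:E)%E \is a fin_num by exact: integrable_fin_num.
by move=> int_fin; apply: fine_cvg; rewrite fineK.
Qed.

Lemma dominated_Rintegral (f_ : nat -> T -> R) f g :
  (forall k, measurable_fun setT (f_ k)) -> measurable_fun setT f ->
  Rintegrable g -> (forall k x, `|f_ k x| <= g x) ->
  (forall x, f_ ^~ x @ \oo --> f x) ->
  (fun k => \int[mu]_x f_ k x) @ \oo --> \int[mu]_x f x.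
Proof.
by move=> mf_ mf gi fg cf; apply: (ae_dominated_Rintegral mf_ mf gi); exact: aeW.
Qed.

Lemma bounded_cvg_Rintegral (f_ : nat -> T -> R) f M : (mu setT < +oo)%E ->
  (forall k, bounded_measurable (f_ k) M) ->
  (forall x, f_ ^~ x @ \oo --> f x) ->
  (fun k => \int[mu]_x f_ k x) @ \oo --> \int[mu]_x f x.
Proof.
move=> fin f_M cf; have mf_ k := (f_M k).1.
apply: (@dominated_Rintegral _ _ (fun=> M)) => //.
- exact: (@measurable_fun_cvg _ _ _ _ f_ f mf_ (fun x _ => cf x)).
- exact: Rintegrable_cst.
- by move=> k; exact: (f_M k).2.
Qed.

Lemma Rintegral_probability_cst c : mu setT = 1%E -> \int[mu]_x c = c.
Proof. by move=> mu1; rewrite Rintegral_cst// mu1 mulr1. Qed.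

End RealIntegrals.

Section DensityAndImage.
Context (d : measure_display) (T : measurableType d) (R : realType).

Definition has_density (mu nu : {measure set T -> \bar R}) (h : T -> R) :=
  forall A, measurable A -> nu A = (\int[mu]_(x in A) (h x)%:E)%E.

Lemma finite_measure_pack (nu : {measure set T -> \bar R}) : (nu setT < +oo)%E ->
  exists nu' : {finite_measure set T -> \bar R}, forall A, nu' A = nu A.
Proof.
move=> fin; exists (mfrestr measurableT fin) => A.
by rewrite -[in RHS](setIT A).
Qed.

Lemma ge0_integral_density (nu : {measure set T -> \bar R})
    (mu : {sigma_finite_measure set T -> \bar R}) (h : T -> R) :
  (nu setT < +oo)%E -> measurable_fun setT h -> (forall x, 0 <= h x) ->
  has_density mu nu h ->
  forall g : T -> \bar R, measurable_fun setT g -> (forall x, 0 <= g x)%E ->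
  (\int[nu]_x g x = \int[mu]_x (g x * (h x)%:E))%E.
Proof.
move=> fin mh h0 nuE g mg g0.
have [nu' nu'E] := finite_measure_pack fin.
have -> : (\int[nu]_x g x = \int[nu']_x g x)%E.
  by apply: eq_measure_integral => A mA _; exact/esym/nu'E.
have nu_mu : nu' `<< mu.
  apply/null_content_dominatesP => A mA muA.
  by rewrite nu'E nuE// null_set_integral//; apply/measurable_EFinP/measurable_funTS.
rewrite -(Radon_Nikodym_SigmaFinite.change_of_variables nu_mu)//.
apply: ae_eq_integral => //.
- apply: emeasurable_funM => //.
  exact: measurable_int (Radon_Nikodym_SigmaFinite.f_integrable nu_mu).
- by apply: emeasurable_funM => //; exact/measurable_EFinP.
have : ae_eq mu setT (Radon_Nikodym_SigmaFinite.f nu' mu) (EFin \o h).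
  apply: integral_ae_eq => //.
  - exact: Radon_Nikodym_SigmaFinite.f_integrable.
  - exact/measurable_EFinP.
  - by move=> A _ mA; rewrite -Radon_Nikodym_SigmaFinite.f_integral// nu'E nuE.
by apply: filterS => x /(_ Logic.I) + _ => ->.
Qed.

Lemma ge0_Rintegral_density (nu : {measure set T -> \bar R})
    (mu : {sigma_finite_measure set T -> \bar R}) (h g : T -> R) :
  (nu setT < +oo)%E -> measurable_fun setT h -> (forall x, 0 <= h x) ->
  has_density mu nu h -> measurable_fun setT g -> (forall x, 0 <= g x) ->
  (\int[nu]_x (g x)%:E = \int[mu]_x (g x * h x)%:E)%E.
Proof.
move=> fin mh h0 nuE mg g0.
by rewrite (ge0_integral_density fin mh h0 nuE)//; exact/measurable_EFinP.
Qed.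

Lemma image_measure (d1 : measure_display) (T1 : measurableType d1)
    (P : {measure set T1 -> \bar R}) (f : T1 -> T) : measurable_fun setT f ->
  exists2 m : {measure set T -> \bar R}, forall A, m A = P (f @^-1` A) &
    forall g : T -> \bar R, measurable_fun setT g -> (forall x, 0 <= g x)%E ->
    (\int[m]_x g x = \int[P]_w g (f w))%E.
Proof.
move=> mf; unshelve eexists (pushforward P f : {measure set T -> \bar R}) => //.
by move=> g mg g0; rewrite ge0_integral_pushforward// preimage_setT.
Qed.

End DensityAndImage.

Lemma ge0_integral_indep (R : realType) (d d1 d2 : measure_display)
    (T : measurableType d) (T1 : measurableType d1) (T2 : measurableType d2)
    (P : {measure set T -> \bar R}) (X : T -> T1) (Y : T -> T2) (f : T1 * T2 -> \bar R) :
  (P setT < +oo)%E -> measurable_fun setT X -> measurable_fun setT Y ->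
  (forall A B, measurable A -> measurable B ->
    P setT * P (X @^-1` A `&` Y @^-1` B) = P (X @^-1` A) * P (Y @^-1` B))%E ->
  measurable_fun setT f -> (forall p, 0 <= f p)%E ->
  (P setT * \int[P]_w f (X w, Y w) = \int[P]_w \int[P]_w' f (X w, Y w'))%E.
Proof.
move=> Pfin mX mY indep mf f0.
have mXY : measurable_fun setT (fun w => (X w, Y w)) by exact: measurable_fun_pair.
have [pX pXE pX_int] := image_measure P mX; have [pY pYE pY_int] := image_measure P mY.
have [pXY pXYE pXY_int] := image_measure P mXY.
have [m1 m1E] : exists m1 : {finite_measure set T1 -> \bar R}, forall A, m1 A = pX A.
  by apply: finite_measure_pack; rewrite pXE.
have [m2 m2E] : exists m2 : {finite_measure set T2 -> \bar R}, forall A, m2 A = pY A.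
  by apply: finite_measure_pack; rewrite pYE.
pose c := fine (P setT); have c0 : 0 <= c by exact: fine_ge0.
have cE : P setT = c%:E by rewrite fineK// ge0_fin_numE.
have prodE A : measurable A -> (m1 \x m2)%E A = mscale (NngNum c0) pXY A.
  apply: product_measure_unique => B C mB mC /=.
  by rewrite m1E m2E pXE pYE -indep// cE /mscale pXYE.
transitivity (\int[m1 \x m2]_p f p)%E.
  rewrite cE -(pXY_int _ mf f0) -(ge0_integral_mscale pXY measurableT (NngNum c0))//.
  by apply: eq_measure_integral => A mA _; exact/esym/prodE.
rewrite (fubini_tonelli1 (m1 := m1) (m2 := m2) f mf f0).
have m_inner : measurable_fun setT (fubini_F m2 f).
  exact: measurable_fun_fubini_tonelli_F.
transitivity (\int[pX]_x fubini_F m2 f x)%E.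
  by apply: eq_measure_integral => A mA _; exact: m1E.
rewrite (pX_int _ m_inner) => [|x]; last exact: integral_ge0.
apply: eq_integral => w _; rewrite /fubini_F.
transitivity (\int[pY]_y f (X w, y))%E.
  by apply: eq_measure_integral => A mA _; exact: m2E.
by rewrite pY_int//; exact: (measurableT_comp mf (pair1_measurable (X w))).
Qed.

Lemma mule_fin_injl (R : realType) (c : R) (x y : \bar R) :
  0 < c -> (c%:E * x = c%:E * y)%E -> x = y.
Proof. by move=> c0; apply: (inc_inj (lee_pmul2l _ _)). Qed.

(** * Euclidean space and Lebesgue measure *)

Section Euclidean.
Variables (R : realType) (n : nat).
Local Notation V := 'rV[R]_(n.+1).
Implicit Types (x y : V) (c r s : R).

Definition dot x y : R := \sum_i x ord0 i * y ord0 i.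
Definition enorm x : R := Num.sqrt (sqnorm x).

Lemma sqnorm_ge0 x : 0 <= sqnorm x.
Proof. by apply: sumr_ge0 => i _; rewrite sqr_ge0. Qed.

Lemma enorm_ge0 x : 0 <= enorm x. Proof. exact: sqrtr_ge0. Qed.

Lemma sqr_enorm x : enorm x ^+ 2 = sqnorm x.
Proof. by rewrite sqr_sqrtr// sqnorm_ge0. Qed.

Lemma sqnorm_le_sqr x r : 0 <= r -> (sqnorm x <= r ^+ 2) = (enorm x <= r).
Proof. by move=> r0; rewrite -sqr_enorm ler_sqr ?nnegrE ?enorm_ge0. Qed.

Lemma sqnorm0 : sqnorm (0 : V) = 0.
Proof. by rewrite /sqnorm big1// => i _; rewrite mxE expr0n. Qed.

Lemma enorm0 : enorm 0 = 0.
Proof. by rewrite /enorm sqnorm0 sqrtr0. Qed.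

Lemma sqnormN x : sqnorm (- x) = sqnorm x.
Proof. by apply: eq_bigr => i _; rewrite mxE sqrrN. Qed.

Lemma sqnormBC x y : sqnorm (x - y) = sqnorm (y - x).
Proof. by rewrite -sqnormN opprB. Qed.

Lemma enormBC x y : enorm (x - y) = enorm (y - x).
Proof. by rewrite /enorm sqnormBC. Qed.

Lemma sqnormZ c x : sqnorm (c *: x) = c ^+ 2 * sqnorm x.
Proof. by rewrite /sqnorm mulr_sumr; apply: eq_bigr => i _; rewrite mxE exprMn. Qed.

Lemma sqnormD x y : sqnorm (x + y) = sqnorm x + 2 * dot x y + sqnorm y.
Proof.
rewrite /sqnorm /dot mulr_sumr -!big_split /=.
by apply: eq_bigr => i _; rewrite !mxE; ring.
Qed.

Lemma dotC x y : dot x y = dot y x.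
Proof. by apply: eq_bigr => i _; rewrite mulrC. Qed.

Lemma dotZr c x y : dot x (c *: y) = c * dot x y.
Proof. by rewrite /dot mulr_sumr; apply: eq_bigr => i _; rewrite mxE; ring. Qed.

Lemma dotNr x y : dot x (- y) = - dot x y.
Proof. by rewrite -scaleN1r dotZr mulN1r. Qed.

Lemma sqnormB x y : sqnorm (x - y) = sqnorm x - 2 * dot x y + sqnorm y.
Proof. by rewrite sqnormD sqnormN dotNr mulrN. Qed.

Lemma normr_dot_le x y : `|dot x y| <= enorm x * enorm y.
Proof.
suff sqr_dot_le : dot x y ^+ 2 <= sqnorm x * sqnorm y.
  rewrite -(ger0_norm (mulr_ge0 (enorm_ge0 x) (enorm_ge0 y))) -ler_sqr ?nnegrE//.
  by rewrite !real_normK ?num_real// exprMn !sqr_enorm.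
have [x0|x0] := eqVneq (sqnorm x) 0.
  suff -> : dot x y = 0 by rewrite expr0n x0 mul0r.
  rewrite /dot big1// => i _; suff -> : x ord0 i = 0 by rewrite mul0r.
  apply/eqP; rewrite -sqrf_eq0; apply/eqP.
  have /eqP := x0; rewrite psumr_eq0 => [|j _]; last exact: sqr_ge0.
  by move=> /allP /(_ i (mem_index_enum i)) /implyP /(_ isT) /eqP.
have x_gt0 : 0 < sqnorm x by rewrite lt_neqAle eq_sym x0 sqnorm_ge0.
have : 0 <= sqnorm (y - (dot x y / sqnorm x) *: x) by exact: sqnorm_ge0.
rewrite sqnormB sqnormZ dotZr (dotC y).
have -> : sqnorm y - 2 * (dot x y / sqnorm x * dot x y) +
  (dot x y / sqnorm x) ^+ 2 * sqnorm x = (sqnorm x * sqnorm y - dot x y ^+ 2) / sqnorm x.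
  by field.
by rewrite pmulr_lge0 ?invr_gt0// subr_ge0.
Qed.

Lemma enorm_triangle x y : enorm (x + y) <= enorm x + enorm y.
Proof.
rewrite -sqnorm_le_sqr ?addr_ge0 ?enorm_ge0// sqnormD -!sqr_enorm.
by have := le_trans (ler_norm _) (normr_dot_le x y); lra.
Qed.

Lemma coord_le_enorm x (i : 'I_n.+1) : `|x ord0 i| <= enorm x.
Proof.
rewrite -ler_sqr ?nnegrE ?enorm_ge0// sqr_enorm real_normK ?num_real//.
by rewrite /sqnorm (bigD1 i)//= lerDl; apply: sumr_ge0 => j _; exact: sqr_ge0.
Qed.

Lemma sqnorm_le_coord x r : (forall i, `|x ord0 i| <= r) -> sqnorm x <= n.+1%:R * r ^+ 2.
Proof.
move=> xr; rewrite mulr_natl -[leRHS](_ : \sum_(i < n.+1) r ^+ 2 = _); last first.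
  by rewrite sumr_const card_ord.
apply: ler_sum => i _; rewrite -[leLHS]real_normK ?num_real// lerXn2r ?nnegrE//.
exact: le_trans (xr i).
Qed.

Lemma enorm_le_coord x r : 0 <= r -> (forall i, `|x ord0 i| <= r) -> enorm x <= n.+1%:R * r.
Proof.
move=> r0 /sqnorm_le_coord xr; rewrite -sqnorm_le_sqr ?mulr_ge0 ?ler0n//.
apply: (le_trans xr); rewrite exprMn ler_wpM2r ?sqr_ge0//.
by rewrite expr2 ler_peMl ?ler0n ?ler1n.
Qed.

Lemma norm_coord_le x (i : 'I_n.+1) : `|x ord0 i| <= `|x|.
Proof.
by rewrite [leRHS]/Num.Def.normr /= mx_normrE; apply: (Order.TotalTheory.le_bigmax _ _ (ord0, i)).
Qed.

Lemma enorm_le_norm x : enorm x <= n.+1%:R * `|x|.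
Proof. by apply: enorm_le_coord => // i; exact: norm_coord_le. Qed.

Lemma cball_eE x r y : 0 <= r -> cball_e x r y = (enorm (y - x) <= r) :> Prop.
Proof. by move=> r0; rewrite /cball_e /= sqnorm_le_sqr. Qed.

Lemma cball_e_center x r : cball_e x r x.
Proof. by rewrite /cball_e /= subrr sqnorm0 sqr_ge0. Qed.

Lemma sub_cball x r s : 0 <= r <= s -> cball_e x r `<=` cball_e x s.
Proof.
move=> /andP[r0 rs] y; rewrite !cball_eE ?(le_trans r0)// => yr.
exact: le_trans yr rs.
Qed.

Lemma cball_e_nbhs x r : 0 < r -> nbhs x (cball_e x r).
Proof.
move=> r0; have rn0 : 0 < r / n.+1%:R by rewrite divr_gt0// ltr0n.
apply/nbhs_ballP; exists (r / n.+1%:R) => // y [_ xy].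
rewrite cball_eE ?(ltW r0)// enormBC.
have -> : r = n.+1%:R * (r / n.+1%:R) by rewrite mulrC divfK.
apply: enorm_le_coord => [|i]; first exact: ltW.
by have := xy ord0 i; rewrite /ball /= !mxE => /ltW.
Qed.

Lemma open_cball (O : set V) x : open O -> O x ->
  exists2 r, 0 < r & cball_e x r `<=` O.
Proof.
move=> oO Ox; have /nbhs_ballP[e /= e0 eO] := oO x Ox.
have e20 : 0 < e / 2 by rewrite divr_gt0.
exists (e / 2) => // y; rewrite cball_eE ?(ltW e20)// => xy.
apply: eO; split => // i j; rewrite ord1 /ball /= distrC.
apply: (@le_lt_trans _ _ (e / 2)); last by lra.
by apply: le_trans xy; have := coord_le_enorm (y - x) j; rewrite !mxE.
Qed.

End Euclidean.

Section Lebesgue.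
Variables (R : realType) (n : nat).
Local Notation V := 'rV[R]_(n.+1).
Local Notation E := (Rd R n).

Lemma measurable_open (O : set V) : open O -> measurable (O : set E).
Proof. exact: sub_sigma_algebra. Qed.

Lemma measurable_continuous_in (U : set V) (u : V -> R) : open U ->
  (forall x, U x -> {for x, continuous u}) -> measurable_fun (U : set E) (u : E -> R).
Proof.
move=> oU u_cont; apply: (measurability _ (RGenOInfty.measurableE R)).
move=> _ [_ [a ->] <-]; apply: measurable_open; rewrite openE => x [Ux ux].
apply: filterI; first exact: oU.
by apply: u_cont => //; apply: open_nbhs_nbhs; split => //; exact: interval_open.
Qed.

Lemma measurable_continuous (f : V -> R) :
  continuous f -> measurable_fun setT (f : E -> R).
Proof.
by move=> cf; apply: measurable_continuous_in => [|x _]; [exact: openT|exact: cf].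
Qed.

Lemma measurable_coord (i : 'I_n.+1) : measurable_fun setT (fun x : E => x ord0 i).
Proof. by apply: measurable_continuous; exact: coord_continuous. Qed.

Lemma measurable_continuous_map (g : V -> V) :
  continuous g -> measurable_fun setT (g : E -> E).
Proof.
move=> cg; refine (@measurability _ _ E E setT g (@open V) erefl _).
move=> _ [A oA <-]; rewrite setTI; apply: measurable_open.
by apply: open_comp.
Qed.

Definition box (a b : V) : set V :=
  [set x : V | forall i, a ord0 i <= x ord0 i <= b ord0 i].

Lemma preimage_box (T : Type) (X : T -> V) a b :
  X @^-1` box a b = \bigcap_(i in [set: 'I_n.+1])
    (fun w => X w ord0 i) @^-1` `[a ord0 i, b ord0 i].
Proof.
apply/seteqP; split=> [w wab i _|w wab i] /=.
  by rewrite in_itv; exact: wab.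
by have := wab i Logic.I; rewrite /= in_itv.
Qed.

Lemma measurable_preimage_box (d : measure_display) (T : measurableType d) (X : T -> E) a b :
  (forall i, measurable_fun setT (fun w => (X w : V) ord0 i)) -> measurable (X @^-1` box a b).
Proof.
move=> mX; rewrite preimage_box; apply: fin_bigcap_measurable => // i _.
rewrite -[X in measurable X]setTI.
by have mXi := mX i; apply: mXi => //; exact: measurable_itv.
Qed.

Lemma measurable_box a b : measurable (box a b : set E).
Proof. by apply: (@measurable_preimage_box _ E id) => i; exact: measurable_coord. Qed.

Lemma rat_box_between (x : V) (e : R) : 0 < e ->
  exists (q : 'rV[rat]_(n.+1)) (k : nat), 2 * k.+1%:R^-1 < e /\
    forall i, `|ratr (q ord0 i) - x ord0 i| <= k.+1%:R^-1.
Proof.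
move=> e0; have e20 : 0 < e / 2 by rewrite divr_gt0.
have [k _ /(_ k (leqnn k)) /= ke] := near_infty_natSinv_lt (PosNum e20).
have k_gt0 : 0 < k.+1%:R^-1 :> R by rewrite invr_gt0 ltr0n.
have /choice[q qP] : forall i : 'I_n.+1, exists q : rat,
    ratr q \in `]x ord0 i - k.+1%:R^-1, x ord0 i + k.+1%:R^-1[.
  by move=> i; apply: rat_in_itvoo; rewrite ltrD2l gtrN.
exists (\row_i q i), k; split => [|i]; first by rewrite mulrC -ltr_pdivlMr.
by have := qP i; rewrite mxE in_itv /= ler_distl => /andP[/ltW -> /ltW ->].
Qed.

Definition rat_cube (p : 'rV[rat]_(n.+1) * nat) : set V :=
  box (\row_i (ratr (p.1 ord0 i) - p.2.+1%:R^-1)) (\row_i (ratr (p.1 ord0 i) + p.2.+1%:R^-1)).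

Lemma open_bigcup_rat_cube (O : set V) : open O ->
  O = \bigcup_p [set x | rat_cube p x /\ rat_cube p `<=` O].
Proof.
move=> oO; apply/seteqP; split=> [x Ox|x [p _ [px pO]]]; last exact: pO.
have /nbhs_ballP[e /= e0 eO] := oO x Ox.
have [q [k [ke qx]]] := rat_box_between x e0.
exists (q, k) => //; split => [i|y yq].
  by rewrite !mxE -ler_distl distrC.
apply: eO; split => // i j; rewrite ord1 /ball /=.
apply: le_lt_trans ke; rewrite mulrDl mul1r -(subrKA (ratr (q ord0 j))).
rewrite (le_trans (ler_normD _ _))// lerD//; first by rewrite distrC.
by have := yq j; rewrite !mxE -ler_distl distrC.
Qed.

Definition boxes : set (set V) := [set A | exists a b, A = box a b].

Lemma measurable_boxesE : @measurable _ E = <<s boxes >>.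
Proof.
apply/seteqP; split; last first.
  apply: smallest_sub; first exact: sigma_algebra_measurable.
  by move=> _ [a [b ->]]; exact: measurable_box.
apply: smallest_sub; first exact: smallest_sigma_algebra.
move=> O oO; rewrite (open_bigcup_rat_cube oO).
apply: (@countable_bigcupT_measurable _ (g_sigma_algebraType boxes)) => //.
move=> p; have [pO|pO] := pselect (rat_cube p `<=` O).
  rewrite (_ : [set x | _] = rat_cube p); first by apply: sub_sigma_algebra; do 2 eexists.
  by apply/seteqP; split => [x []|x].
rewrite (_ : [set x | _] = set0); first exact: measurable0.
by apply/seteqP; split => [x []|x].
Qed.

Lemma boxesI : setI_closed boxes.
Proof.
move=> _ _ [a [b ->]] [a' [b' ->]].
exists (\row_i Num.max (a ord0 i) (a' ord0 i)), (\row_i Num.min (b ord0 i) (b' ord0 i)).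
apply/seteqP; split=> [x [h h'] i|x h].
  by rewrite !mxE ge_max le_min; have /andP[-> ->] := h i; have /andP[-> ->] := h' i.
split=> i; have := h i; rewrite !mxE ge_max le_min.
  by move=> /andP[/andP[-> _] /andP[-> _]].
by move=> /andP[/andP[_ ->] /andP[_ ->]].
Qed.

Definition cube (k : R) : set V := box (const_mx (- k)) (const_mx k).

Lemma bigcup_cube : \bigcup_k cube k%:R = setT.
Proof.
apply/seteqP; split=> // x _; exists (Num.truncn `|x|).+1 => // i.
rewrite !mxE -ler_norml; apply: (@le_trans _ _ `|x|).
  exact: norm_coord_le.
exact/ltW/truncnS_gt.
Qed.

Lemma measurable_row_sub (d : measure_display) (T : measurableType d) (X Y : T -> E) :
  measurable_fun setT X -> measurable_fun setT Y ->
  measurable_fun setT ((fun w => (X w : V) - (Y w : V)) : T -> E).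
Proof.
move=> mX mY; apply: (measurability _ measurable_boxesE).
move=> _ [_ [a [b ->] <-]]; rewrite setTI; apply: measurable_preimage_box => i.
under eq_fun do rewrite !mxE; apply: measurable_funB.
- exact: (measurableT_comp (measurable_coord i) mX).
- exact: (measurableT_comp (measurable_coord i) mY).
Qed.

Lemma measurable_sqnorm_sub (d : measure_display) (T : measurableType d) (X Y : T -> E) :
  measurable_fun setT X -> measurable_fun setT Y ->
  measurable_fun setT (fun w => sqnorm ((Y w : V) - (X w : V))).
Proof.
move=> mX mY; apply: measurable_sum => i; apply: measurable_funX.
exact: (measurableT_comp (measurable_coord i) (measurable_row_sub mY mX)).
Qed.

Lemma measurable_sqnorm (x : V) : measurable_fun setT ((fun y => sqnorm (y - x)) : E -> R).
Proof. by apply: measurable_sqnorm_sub; [exact: measurable_cst|exact: measurable_id]. Qed.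

Lemma measurable_cball (x : V) (r : R) : measurable (cball_e x r : set E).
Proof.
have -> : cball_e x r = setT `&` (fun y : V => sqnorm (y - x)) @^-1` `]-oo, r ^+ 2].
  by rewrite setTI; apply/seteqP; split => y; rewrite /= in_itv.
by apply: measurable_sqnorm => //; exact: measurable_itv.
Qed.

Variable lam : {measure set E -> \bar R}.
Hypothesis lamE : is_lebesgue_d lam.

Lemma box_empty (a b : V) : ~ (forall i, a ord0 i <= b ord0 i) -> box a b = set0.
Proof.
move=> ab; apply/seteqP; split => // x xab; apply: ab => i.
by have /andP[/le_trans h /h] := xab i.
Qed.

Lemma lebesgue_box_lty a b : (lam (box a b) < +oo)%E.
Proof.
have [ab|ab] := pselect (forall i, a ord0 i <= b ord0 i).
  by rewrite lamE// ltry.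
by rewrite box_empty// measure0.
Qed.

Lemma lebesgue_sigma_finite : sigma_finite setT lam.
Proof.
exists (fun k => cube k%:R); first by rewrite bigcup_cube.
by move=> k; split; [exact: measurable_box|exact: lebesgue_box_lty].
Qed.

Lemma lebesgue_translation (c : V) (A : set E) : measurable A ->
  lam ((fun x : V => x - c) @^-1` A) = lam A.
Proof.
have mt : measurable_fun setT ((fun x : V => x - c) : E -> E).
  by apply: measurable_continuous_map => x; apply: continuousB; [by []|exact: cst_continuous].
pose T : {mfun E >-> E} := HB.pack ((fun x : V => x - c) : E -> E)
  (isMeasurableFun.Build _ _ _ _ _ mt).
move=> mA; apply/esym.
apply: (@measure_unique _ R E boxes (fun k => cube k%:R) _ _ _ _ lam
  (pushforward lam T)) => //.
- exact: measurable_boxesE.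
- exact: boxesI.
- by move=> k; do 2 eexists.
- exact: bigcup_cube.
- move=> _ [a [b ->]] /=; rewrite /pushforward.
  have -> : (fun x => x - c) @^-1` box a b = box (a + c) (b + c).
    by apply/seteqP; split=> x xab i; have := xab i;
       rewrite !mxE /= lerBrDr lerBlDr.
  have [ab|ab] := pselect (forall i, a ord0 i <= b ord0 i).
    rewrite !lamE// => [|i]; last by rewrite !mxE lerD2r.
    by congr (_%:E); apply: eq_bigr => i _; rewrite !mxE; ring.
  rewrite !box_empty ?measure0// => h; apply: ab => i.
  by have := h i; rewrite !mxE lerD2r.
- by move=> k; exact: lebesgue_box_lty.
Qed.

Lemma lebesgue_cball_gt0 (x : V) (r : R) : 0 < r -> (0 < lam (cball_e x r))%E.
Proof.
move=> r0; pose h := r / n.+1%:R.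
have N0 : 0 < n.+1%:R :> R by rewrite ltr0n.
have h0 : 0 < h by rewrite divr_gt0.
apply: (@lt_le_trans _ _ (lam (box (x - const_mx h) (x + const_mx h)))).
  rewrite lamE => [|i]; last by rewrite !mxE lerD2l; lra.
  rewrite lte_fin prodr_gt0// => i _; rewrite !mxE; lra.
apply: le_measure; rewrite ?inE.
- exact: measurable_box.
- exact: measurable_cball.
move=> y yb; rewrite cball_eE ?(ltW r0)// (_ : r = n.+1%:R * h).
  apply: enorm_le_coord => [|i]; first exact: ltW.
  by have := yb i; rewrite !mxE ler_norml => /andP[lo up]; apply/andP; split; lra.
by rewrite mulrC divfK// gt_eqF.
Qed.

End Lebesgue.

(** * Gaussian kernel and heat semigroup *)

Section ExponentialBounds.
Variable R : realType.
Implicit Types (a A X u y : R).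

Lemma normr_expR_sub1_le u : `|expR u - 1| <= `|u| * expR `|u|.
Proof.
have inv : expR u * expR (- u) = 1 by rewrite -expRD subrr expR0.
have expu_gt0 := expR_gt0 u.
have expR_norm_ge1 : 1 <= expR `|u| by rewrite -expR0 ler_expR.
have u_le := ler_norm u; have opp_u_le : - u <= `|u| by rewrite -normrN ler_norm.
rewrite ler_norml; apply/andP; split.
  have : `|u| * 1 <= `|u| * expR `|u| by rewrite ler_wpM2l.
  by have := expR_ge1Dx u; lra.
apply: (@le_trans _ _ (u * expR u)); first by have := expR_ge1Dx (- u); nra.
apply: (@le_trans _ _ (`|u| * expR u)); first by rewrite ler_wpM2r// ltW.
by rewrite ler_wpM2l// ler_expR.
Qed.

Lemma powM_expRN_le (k : nat) y : 0 <= y -> y ^+ k * expR (- y) <= k%:R ^+ k.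
Proof.
move=> y0; case: k => [|k]; first by rewrite !expr0 mul1r -expR0 ler_expR oppr_le0.
pose z := y / k.+1%:R; have z0 : 0 <= z by rewrite divr_ge0.
rewrite expRN ler_pdivrMr ?expR_gt0//.
have -> : y = k.+1%:R * z by rewrite mulrC divfK.
rewrite exprMn expRM_natl ler_wpM2l ?exprn_ge0// lerXn2r ?nnegrE ?expR_ge0//.
by apply: le_trans (expR_ge1Dx z); rewrite lerDr.
Qed.

(* Increments of the Gaussian at a point of (normalised) norm [X] along a vector
   of norm [a]: the first bound serves for [X <= A], the second one for [A < X]. *)
Lemma normr_expR_sub1_near a A X u : 0 <= a -> 1 <= A -> A * a <= 1 -> X <= A ->
  `|u| <= a * (X + 2^-1) -> `|expR u - 1| <= expR 6 * (a * A).
Proof.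
move=> a0 A1 Aa XA uX; have aA0 : 0 <= a * A by rewrite mulr_ge0//; lra.
have u_le : `|u| <= 3 / 2 * (a * A).
  by apply: (le_trans uX); rewrite mulrCA ler_wpM2l//; lra.
have u_le32 : `|u| <= 3 / 2 by lra.
apply: (le_trans (normr_expR_sub1_le u)).
apply: (@le_trans _ _ (3 / 2 * (a * A) * expR (3 / 2))).
  by rewrite ler_pM ?expR_ge0// ler_expR.
have -> : expR 6 = expR (9 / 2) * expR (3 / 2) :> R by rewrite -expRD; congr expR; field.
rewrite mulrAC ler_wpM2r// ler_wpM2r ?expR_ge0//.
by have := expR_ge1Dx (9 / 2 : R); lra.
Qed.

Lemma normr_expR_sub1_far a A X u : 0 <= a -> a <= 1 -> 1 <= A -> A < X ->
  `|u| <= a * (X + 2^-1) ->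
  `|expR u - 1| * expR (- (7 / 16 * X ^+ 2)) <= a * (expR 6 * expR (- (A ^+ 2 / 16))).
Proof.
move=> a0 a1 A1 AX uX; have Y0 : 0 <= 3 / 2 * X by lra.
have u_le : `|u| <= a * (3 / 2 * X) by apply: (le_trans uX); rewrite ler_wpM2l//; lra.
have u_le' : `|u| <= 3 / 2 * X by apply: (le_trans u_le); rewrite ler_piMl.
apply: (@le_trans _ _ (a * (3 / 2 * X) * expR (3 / 2 * X) * expR (- (7 / 16 * X ^+ 2)))).
  rewrite ler_wpM2r ?expR_ge0//; apply: (le_trans (normr_expR_sub1_le u)).
  by rewrite ler_pM ?expR_ge0// ler_expR.
rewrite -[leLHS]mulrA -[leLHS]mulrA ler_wpM2l//.
apply: (@le_trans _ _ (expR (3 / 2 * X) * (expR (3 / 2 * X) * expR (- (7 / 16 * X ^+ 2))))).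
  by rewrite ler_wpM2r ?mulr_ge0 ?expR_ge0//; have := expR_ge1Dx (3 / 2 * X); lra.
rewrite -!expRD ler_expR; have : A ^+ 2 <= X ^+ 2 by rewrite lerXn2r ?nnegrE//; lra.
by have := sqr_ge0 (X - 4); lra.
Qed.

End ExponentialBounds.

Section GaussianDensity.
Variables (R : realType) (n : nat).
Local Notation V := 'rV[R]_(n.+1).
Implicit Types (x y z : V) (s t r c A : R) (k : nat).

Definition gauss_cst t : R := ((Num.sqrt (2 * pi * t)) ^+ n.+1)^-1.

Lemma gauss_densityE t x :
  gauss_density t x = gauss_cst t * expR (- sqnorm x / (2 * t)).
Proof. by []. Qed.

Lemma gauss_densityN t x : gauss_density t (- x) = gauss_density t x.
Proof. by rewrite !gauss_densityE sqnormN. Qed.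

Lemma gauss_cst_gt0 t : 0 < t -> 0 < gauss_cst t.
Proof. by move=> t0; rewrite invr_gt0 exprn_gt0// sqrtr_gt0 !mulr_gt0// pi_gt0. Qed.

Lemma gauss_cst_ge0 t : 0 < t -> 0 <= gauss_cst t.
Proof. by move=> t0; exact/ltW/gauss_cst_gt0. Qed.

Lemma gauss_density_gt0 t x : 0 < t -> 0 < gauss_density t x.
Proof. by move=> t0; rewrite mulr_gt0 ?gauss_cst_gt0// expR_gt0. Qed.

Lemma gauss_density_ge0 t x : 0 < t -> 0 <= gauss_density t x.
Proof. by move=> t0; exact/ltW/gauss_density_gt0. Qed.

Lemma gauss_density_le_cst t x : 0 < t -> gauss_density t x <= gauss_cst t.
Proof.
move=> t0; rewrite gauss_densityE ler_piMr ?gauss_cst_ge0// -expR0 ler_expR.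
by rewrite mulNr oppr_le0 divr_ge0 ?sqnorm_ge0// mulr_ge0// ltW.
Qed.

Lemma measurable_gauss_density t : measurable_fun setT (gauss_density t : Rd R n -> R).
Proof.
apply: measurable_funM; first exact: measurable_cst.
apply: measurableT_comp; first exact: measurable_expR.
apply: measurable_funM; last exact: measurable_cst; apply: measurable_funN.
by have := measurable_sqnorm (0 : V); under eq_fun do rewrite subr0.
Qed.

Lemma gauss_cst_le s t : 0 < s -> s <= t -> gauss_cst t <= gauss_cst s.
Proof.
move=> s0 st; have t0 := lt_le_trans s0 st.
rewrite lef_pV2 ?posrE ?exprn_gt0 ?sqrtr_gt0 ?mulr_gt0 ?pi_gt0//.
apply: lerXn2r; rewrite ?nnegrE ?sqrtr_ge0// ler_wsqrtr// ler_pM2l//.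
by rewrite mulr_gt0 ?pi_gt0.
Qed.

Lemma gauss_cst_scale c t : 0 < c -> 0 < t ->
  gauss_cst t = Num.sqrt c ^+ n.+1 * gauss_cst (c * t).
Proof.
move=> c0 t0; rewrite /gauss_cst (_ : 2 * pi * (c * t) = c * (2 * pi * t)); last by ring.
rewrite (sqrtrM (2 * pi * t) (ltW c0)) exprMn invfM mulrA mulfV ?mul1r//.
by rewrite expf_neq0// gt_eqF// sqrtr_gt0.
Qed.

Lemma gauss_cst_le_pow t : 0 < t <= 1 -> gauss_cst t <= (t ^+ n.+1)^-1.
Proof.
move=> /andP[t0 t1]; have pi2 : 2 <= pi :> R by exact: pi_ge2.
rewrite lef_pV2 ?posrE ?exprn_gt0 ?sqrtr_gt0 ?mulr_gt0 ?pi_gt0//.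
apply: lerXn2r; rewrite ?nnegrE ?sqrtr_ge0 ?(ltW t0)//.
rewrite -(@ler_sqr R) ?nnegrE ?sqrtr_ge0 ?(ltW t0)// sqr_sqrtr; last first.
  by rewrite !mulr_ge0 ?pi_ge0// ltW.
by rewrite expr2; nra.
Qed.

Lemma gauss_cst_small e : 0 < e -> exists k, gauss_cst k.+1%:R <= e.
Proof.
move=> e0; have ie0 : 0 < e^-1 by rewrite invr_gt0.
exists (Num.truncn (e^-1 ^+ 2)); set t : R := _.+1%:R.
have t1 : 1 <= t by rewrite ler1n.
have et : e^-1 ^+ 2 <= t by exact/ltW/truncnS_gt.
have t_le : t <= 2 * pi * t by have := pi_ge2 R; nra.
have pit0 : 0 < 2 * pi * t by apply: lt_le_trans t_le; lra.
rewrite /gauss_cst -[leRHS]invrK lef_pV2 ?posrE ?exprn_gt0 ?sqrtr_gt0//.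
apply: (@le_trans _ _ (Num.sqrt t)).
  by rewrite -[leLHS](ger0_norm (ltW ie0)) -sqrtr_sqr ler_wsqrtr.
apply: (le_trans (ler_wsqrtr t_le)).
rewrite exprS ler_peMr ?sqrtr_ge0// exprn_ege1//.
by have := ler_wsqrtr (le_trans t1 t_le); rewrite sqrtr1.
Qed.

Lemma gauss_density_scale c t x : 0 < c -> 0 < t -> gauss_density t x =
  Num.sqrt c ^+ n.+1 * gauss_density (c * t) x * expR (- sqnorm x / (2 * t) * (1 - c^-1)).
Proof.
move=> c0 t0; rewrite !gauss_densityE (gauss_cst_scale c0 t0) -!mulrA -expRD.
congr (_ * (_ * expR _)); field.
by rewrite !gt_eqF.
Qed.

Lemma gauss_convolution s r x y : 0 < s -> 0 < r ->
  gauss_density s (x - y) * gauss_density r y =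
  gauss_density (s + r) x * gauss_density (s * r / (s + r)) (y - (r / (s + r)) *: x).
Proof.
move=> s0 r0; have sr0 : 0 < s + r by rewrite addr_gt0.
rewrite !gauss_densityE mulrACA [RHS]mulrACA; congr (_ * _).
  rewrite /gauss_cst -!invfM -!exprMn -!sqrtrM ?mulr_ge0 ?pi_ge0 ?(ltW s0) ?(ltW sr0)//.
  by congr ((Num.sqrt _ ^+ _)^-1); field; rewrite gt_eqF.
rewrite -!expRD; congr expR; rewrite !sqnormB sqnormZ dotZr (dotC y).
by field; rewrite !gt_eqF.
Qed.

Definition doubling_cst : R := Num.sqrt 2 ^+ n.+1.

Lemma doubling_cst_ge1 : 1 <= doubling_cst.
Proof. by rewrite exprn_ege1// -{1}sqrtr1 ler_wsqrtr// ler1n. Qed.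

Lemma doubling_cst_ge0 : 0 <= doubling_cst.
Proof. exact: le_trans doubling_cst_ge1. Qed.

Lemma gauss_density_double t x : 0 < t -> gauss_density t x =
  doubling_cst * gauss_density (2 * t) x * expR (- (sqnorm x / (4 * t))).
Proof.
move=> t0; rewrite (@gauss_density_scale 2)//; congr (_ * expR _); field.
by rewrite gt_eqF.
Qed.

Definition moment_cst k : R := doubling_cst * (4 * k%:R) ^+ k.

Lemma moment_cst_ge0 k : 0 <= moment_cst k.
Proof. by rewrite mulr_ge0 ?doubling_cst_ge0// exprn_ge0// mulr_ge0. Qed.

Lemma gauss_density_moment k t x : 0 < t ->
  sqnorm x ^+ k * gauss_density t x <= moment_cst k * t ^+ k * gauss_density (2 * t) x.
Proof.
move=> t0; rewrite gauss_density_double//; set y := sqnorm x / (4 * t).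
have y0 : 0 <= y by rewrite divr_ge0 ?sqnorm_ge0// mulr_ge0// ltW.
have -> : sqnorm x = 4 * t * y by rewrite /y; field; rewrite gt_eqF.
have -> : moment_cst k * t ^+ k * gauss_density (2 * t) x =
    (4 * t) ^+ k * (doubling_cst * gauss_density (2 * t) x) * k%:R ^+ k.
  by rewrite /moment_cst !exprMn; move: (4 ^+ k) (t ^+ k) (k%:R ^+ k) => a b c; ring.
rewrite exprMn mulrACA.
apply: ler_wpM2l; last exact: powM_expRN_le.
apply: mulr_ge0; first by rewrite exprn_ge0// mulr_ge0// ltW.
by rewrite mulr_ge0 ?doubling_cst_ge0// gauss_density_ge0// mulr_gt0.
Qed.

Definition gauss_sphere t r : R := gauss_cst t * expR (- (r ^+ 2 / (2 * t))).

Lemma gauss_sphere_gt0 t r : 0 < t -> 0 < gauss_sphere t r.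
Proof. by move=> t0; rewrite mulr_gt0 ?gauss_cst_gt0 ?expR_gt0. Qed.

Lemma gauss_sphere_lt_cst t r : 0 < t -> 0 < r -> gauss_sphere t r < gauss_cst t.
Proof.
move=> t0 r0; rewrite gtr_pMr ?gauss_cst_gt0// -[ltRHS]expR0 ltr_expR oppr_lt0.
by rewrite divr_gt0 ?exprn_gt0 ?mulr_gt0.
Qed.

Lemma gauss_sphere_small r : 0 < r -> exists2 C : R, 0 <= C &
  forall t, 0 < t <= 1 -> gauss_sphere t r <= C * t ^+ 2.
Proof.
move=> r0; pose m := n.+3; exists ((2 * m%:R / r ^+ 2) ^+ m).
  by rewrite exprn_ge0// divr_ge0 ?sqr_ge0.
move=> t /andP[t0 t1]; set y := r ^+ 2 / (2 * t).
have y0 : 0 < y by rewrite divr_gt0 ?exprn_gt0 ?mulr_gt0.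
have expRN_le : expR (- y) <= (m%:R / y) ^+ m.
  rewrite exprMn exprVn ler_pdivlMr ?exprn_gt0// mulrC.
  exact: powM_expRN_le (ltW y0).
apply: (@le_trans _ _ ((t ^+ n.+1)^-1 * (m%:R / y) ^+ m)).
  apply: ler_pM; rewrite ?gauss_cst_ge0 ?expR_ge0//.
  by apply: gauss_cst_le_pow; rewrite t0.
have -> : m%:R / y = 2 * m%:R / r ^+ 2 * t by rewrite /y; field; rewrite !gt_eqF.
have tmE : t ^+ m = t ^+ n.+1 * t ^+ 2 by rewrite -exprD addn2.
by rewrite [X in _ * X]exprMn mulrCA tmE mulKf// gt_eqF// exprn_gt0.
Qed.

Definition gauss_shift_cst : R := expR 6 * Num.sqrt 8 ^+ n.+1.

Lemma gauss_shift_cst_ge1 : 1 <= gauss_shift_cst.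
Proof.
rewrite mulr_ege1//; first by rewrite -expR0 ler_expR.
by rewrite exprn_ege1// -{1}sqrtr1 ler_wsqrtr// ler1n.
Qed.

Lemma gauss_shift_cst_ge0 : 0 <= gauss_shift_cst.
Proof. exact: le_trans gauss_shift_cst_ge1. Qed.

Lemma gauss_density_shift t x z : 0 < t -> gauss_density t (x - z) =
  gauss_density t x * expR (dot x z / t - sqnorm z / (2 * t)).
Proof.
move=> t0; rewrite !gauss_densityE -mulrA -expRD sqnormB; congr (_ * expR _).
by field; rewrite gt_eqF.
Qed.

Lemma gauss_shift_exponent_le t x z : 0 < t -> enorm z <= Num.sqrt t ->
  `|dot x z / t - sqnorm z / (2 * t)| <=
  enorm z / Num.sqrt t * (enorm x / Num.sqrt t + 2^-1).
Proof.
move=> t0; set q := Num.sqrt t => zq.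
have q0 : 0 < q by rewrite sqrtr_gt0.
have tE : t = q ^+ 2 by rewrite sqr_sqrtr// ltW.
rewrite (le_trans (ler_normB _ _))// mulrDr lerD//.
  rewrite normrM (ger0_norm (_ : 0 <= t^-1)) ?invr_ge0 ?(ltW t0)// mulf_div -expr2 -tE.
  by rewrite ler_wpM2r ?invr_ge0 ?(ltW t0)// mulrC normr_dot_le.
rewrite ger0_norm; last by rewrite divr_ge0 ?sqnorm_ge0// mulr_ge0// ltW.
rewrite -sqr_enorm tE (_ : _ / _ = enorm z / q * 2^-1 * (enorm z / q)); last first.
  by field; rewrite gt_eqF.
rewrite ler_piMr ?ler_pdivrMr ?mul1r//.
by rewrite mulr_ge0 ?divr_ge0 ?enorm_ge0 ?(ltW q0).
Qed.

(* For |x| <= A sqrt t the exponent moves by O(A |z| / sqrt t); beyond, the extra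
   factor is absorbed by passing from t to 8 t, at the gain exp (- A^2 / 16). *)
Lemma gauss_density_diff t A x z : 0 < t -> 1 <= A -> A * enorm z <= Num.sqrt t ->
  `|gauss_density t (x - z) - gauss_density t x| <=
  gauss_shift_cst * (enorm z / Num.sqrt t) *
  (A * gauss_density t x + expR (- (A ^+ 2 / 16)) * gauss_density (8 * t) x).
Proof.
move=> t0 A1 Az; set q := Num.sqrt t; have q0 : 0 < q by rewrite sqrtr_gt0.
have tE : t = q ^+ 2 by rewrite sqr_sqrtr// ltW.
have zq : enorm z <= q by apply: le_trans Az; rewrite ler_peMl ?enorm_ge0.
have := gauss_shift_exponent_le x t0 zq; rewrite gauss_density_shift// -/q.
set a := enorm z / q; set X := enorm x / q; set u := _ - _ => uX.
have a0 : 0 <= a by rewrite divr_ge0 ?enorm_ge0// ltW.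
have Aa : A * a <= 1 by rewrite /a mulrA ler_pdivrMr// mul1r.
have a1 : a <= 1 by rewrite /a ler_pdivrMr// mul1r.
have xE : sqnorm x = t * X ^+ 2 by rewrite -sqr_enorm /X tE; field; rewrite gt_eqF.
have p0 := gauss_density_ge0 x t0.
have p80 : 0 <= gauss_density (8 * t) x by rewrite gauss_density_ge0// mulr_gt0.
have s81 : 1 <= Num.sqrt 8 ^+ n.+1 :> R.
  by rewrite exprn_ege1// -{1}sqrtr1 ler_wsqrtr// ler1n.
rewrite -[X in _ - X]mulr1 -mulrBr normrM (ger0_norm p0) mulrDr.
have C0 := gauss_shift_cst_ge0; have Ca0 := mulr_ge0 C0 a0.
have [XA|AX] := leP X A.
  apply: (@le_trans _ _ (gauss_shift_cst * a * (A * gauss_density t x))); last first.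
    by rewrite lerDl mulr_ge0// mulr_ge0// expR_ge0.
  rewrite [leRHS](_ : _ = gauss_density t x * (gauss_shift_cst * (a * A))); last by ring.
  apply: ler_wpM2l => //; apply: (le_trans (normr_expR_sub1_near a0 A1 Aa XA uX)).
  have aA0 : 0 <= a * A by rewrite mulr_ge0// (le_trans ler01).
  by rewrite ler_wpM2r// ler_peMr ?expR_ge0.
apply: (@le_trans _ _ (gauss_shift_cst * a *
    (expR (- (A ^+ 2 / 16)) * gauss_density (8 * t) x))); last first.
  by rewrite lerDr mulr_ge0// mulr_ge0// (le_trans ler01).
rewrite (@gauss_density_scale 8)// xE.
rewrite (_ : - (t * X ^+ 2) / (2 * t) * (1 - 8^-1) = - (7 / 16 * X ^+ 2)); last first.
  by field; rewrite gt_eqF.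
have -> : gauss_shift_cst * a * (expR (- (A ^+ 2 / 16)) * gauss_density (8 * t) x) =
    Num.sqrt 8 ^+ n.+1 * gauss_density (8 * t) x * (a * (expR 6 * expR (- (A ^+ 2 / 16)))).
  by rewrite /gauss_shift_cst; ring.
rewrite mulrAC -mulrA ler_wpM2l ?mulr_ge0 ?(le_trans ler01 s81)//.
exact: normr_expR_sub1_far.
Qed.

Lemma gauss_density_diff_short t x z : 0 < t -> enorm z <= Num.sqrt t ->
  `|gauss_density t (x - z) - gauss_density t x| <=
  gauss_shift_cst * (enorm z / Num.sqrt t) * (gauss_density t x + gauss_density (8 * t) x).
Proof.
move=> t0 zt; have t80 : 0 < 8 * t by rewrite mulr_gt0.
have := @gauss_density_diff t 1 x z t0 (lexx _); rewrite !mul1r => /(_ zt) h.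
apply: (le_trans h); rewrite ler_wpM2l//.
  by rewrite mulr_ge0 ?gauss_shift_cst_ge0 ?divr_ge0 ?enorm_ge0 ?sqrtr_ge0.
by rewrite lerD2l ler_piMl ?gauss_density_ge0// -[leRHS]expR0 ler_expR; lra.
Qed.

Lemma gauss_density_lipschitz t x y : 0 < t -> `|gauss_density t y - gauss_density t x| <=
  2 * gauss_shift_cst * gauss_cst t / Num.sqrt t * enorm (y - x).
Proof.
move=> t0; have q0 : 0 < Num.sqrt t by rewrite sqrtr_gt0.
rewrite -[y in gauss_density _ y](subKr x) enormBC; set z := x - y.
have g0 := gauss_cst_ge0 t0.
have [zq|/ltW qz] := leP (enorm z) (Num.sqrt t).
  apply: (le_trans (gauss_density_diff_short x t0 zq)).
  have -> : 2 * gauss_shift_cst * gauss_cst t / Num.sqrt t * enorm z =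
    gauss_shift_cst * (enorm z / Num.sqrt t) * (gauss_cst t + gauss_cst t) by ring.
  rewrite ler_wpM2l//.
    by rewrite mulr_ge0 ?gauss_shift_cst_ge0 ?divr_ge0 ?enorm_ge0 ?sqrtr_ge0.
  rewrite lerD ?gauss_density_le_cst//.
  apply: (@le_trans _ _ (gauss_cst (8 * t))); first by rewrite gauss_density_le_cst ?mulr_gt0.
  by rewrite gauss_cst_le// ler_peMl ?ler1n// ltW.
apply: (@le_trans _ _ (gauss_cst t)).
  have := gauss_density_le_cst x t0; have := gauss_density_le_cst (x - z) t0.
  have := gauss_density_ge0 x t0; have := gauss_density_ge0 (x - z) t0.
  by rewrite ler_norml => *; apply/andP; split; lra.
have zq1 : 1 <= enorm z / Num.sqrt t by rewrite ler_pdivlMr// mul1r.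
have -> : 2 * gauss_shift_cst * gauss_cst t / Num.sqrt t * enorm z =
  gauss_cst t * (2 * gauss_shift_cst * (enorm z / Num.sqrt t)) by ring.
rewrite ler_peMr// mulr_ege1// mulr_ege1 ?ler1n//; exact: gauss_shift_cst_ge1.
Qed.

End GaussianDensity.

(* The Gaussian mass is not computed: it is read off the law of the Brownian
   increments in [brownian_gauss_mass]. *)
Record lebesgueRd (R : realType) (n : nat) := LebesgueRd {
  lebesgueRd_measure :> {sigma_finite_measure set (Rd R n) -> \bar R};
  lebesgueRdP : is_lebesgue_d lebesgueRd_measure;
  gauss_mass : forall t : R, 0 < t -> gauss lebesgueRd_measure t setT = 1%E }.

Section HeatKernel.
Variables (R : realType) (n : nat).
Local Notation V := 'rV[R]_(n.+1).
Local Notation E := (Rd R n).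
Local Notation bmeas := (@bounded_measurable _ E R).
Variable lam : lebesgueRd R n.
Implicit Types (x y z : V) (t r M c L : R) (f : V -> R) (k : nat).

Definition elipschitz L f := forall x y, `|f y - f x| <= L * enorm (y - x).

Lemma elipschitz_ge0 L f : elipschitz L f -> 0 <= L.
Proof.
move=> fL; pose z : V := const_mx 1.
have z0 : 0 < enorm (z - 0).
  by apply: (@lt_le_trans _ _ `|(z - 0) ord0 ord0|); rewrite ?coord_le_enorm// !mxE subr0 normr1.
by have := le_trans (normr_ge0 _) (fL 0 z); rewrite pmulr_lge0.
Qed.

Definition heat_kernel t x y : R := gauss_density t (y - x).

Lemma heat_kernelC t x y : heat_kernel t x y = heat_kernel t y x.
Proof. by rewrite /heat_kernel -gauss_densityN opprB. Qed.

Lemma heat_kernel_gt0 t x y : 0 < t -> 0 < heat_kernel t x y.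
Proof. exact: gauss_density_gt0. Qed.

Lemma heat_kernel_ge0 t x y : 0 < t -> 0 <= heat_kernel t x y.
Proof. exact: gauss_density_ge0. Qed.

Lemma heat_kernel_le_cst t x y : 0 < t -> heat_kernel t x y <= gauss_cst n t.
Proof. exact: gauss_density_le_cst. Qed.

Lemma heat_kernel_elipschitz t x : 0 < t ->
  elipschitz (2 * gauss_shift_cst R n * gauss_cst n t / Num.sqrt t) (heat_kernel t x).
Proof.
move=> t0 y z; have := gauss_density_lipschitz (y - x) (z - x) t0.
by rewrite opprB addrA subrK.
Qed.

Lemma measurable_heat_kernel_comp (d : measure_display) (T : measurableType d)
    (X Y : T -> E) t : measurable_fun setT X -> measurable_fun setT Y ->
  measurable_fun setT (fun w => heat_kernel t (X w) (Y w)).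
Proof.
move=> mX mY; apply: (measurableT_comp (@measurable_gauss_density R n t)).
exact: measurable_row_sub.
Qed.

Lemma bounded_measurable_heat_kernel t x : 0 < t ->
  bmeas (heat_kernel t x) (gauss_cst n t).
Proof.
move=> t0; split.
  by apply: measurable_heat_kernel_comp; [exact: measurable_cst|exact: measurable_id].
by move=> y; rewrite ger0_norm ?heat_kernel_ge0// heat_kernel_le_cst.
Qed.

Lemma measurable_heat_kernel t x : 0 < t -> measurable_fun setT (heat_kernel t x : E -> R).
Proof. by move=> /(bounded_measurable_heat_kernel x)[]. Qed.

Lemma ge0_integral_translation x (g : E -> \bar R) : measurable_fun setT g ->
  (forall y, 0 <= g y)%E -> (\int[lam]_y g ((y : V) - x)%R = \int[lam]_y g y)%E.
Proof.
move=> mg g0.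
have m_sub : measurable_fun setT ((fun y : V => y - x) : E -> E).
  by apply: measurable_row_sub; [exact: measurable_id|exact: measurable_cst].
have := @ge0_integral_pushforward _ _ E E R _ m_sub lam setT g measurableT mg (fun y _ => g0 y).
rewrite preimage_setT => <-; apply: eq_measure_integral => A mA _.
exact: (lebesgue_translation (lebesgueRdP lam) x mA).
Qed.

Lemma integral_heat_kernel t x : 0 < t -> (\int[lam]_y (heat_kernel t x y)%:E = 1)%E.
Proof.
move=> t0; rewrite -(gauss_mass lam t0) /gauss.
rewrite (@ge0_integral_translation x (fun y : E => (gauss_density t y)%:E))//.
- by apply/measurable_EFinP; exact: measurable_gauss_density.
- by move=> y; rewrite lee_fin gauss_density_ge0.
Qed.

Lemma Rintegrable_heat_kernel t x : 0 < t -> Rintegrable lam (heat_kernel t x).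
Proof.
move=> t0; apply/integrableP; split.
  by apply/measurable_EFinP; exact: measurable_heat_kernel.
under eq_integral do rewrite /= ger0_norm ?heat_kernel_ge0//.
by rewrite integral_heat_kernel// ltry.
Qed.

Lemma Rintegral_heat_kernel t x : 0 < t -> \int[lam]_y heat_kernel t x y = 1.
Proof. by move=> t0; rewrite /Rintegral integral_heat_kernel. Qed.

Lemma RintegrableM_heat_kernel t f M x : 0 < t -> bmeas f M ->
  Rintegrable lam (fun y => f y * heat_kernel t x y).
Proof.
move=> t0 fM; under eq_fun do rewrite mulrC.
exact: RintegrableM (Rintegrable_heat_kernel x t0) fM.
Qed.

Lemma RintegralZ_heat_kernel t c x : 0 < t -> \int[lam]_y (c * heat_kernel t x y) = c.
Proof.
move=> t0; rewrite (RintegralZl c measurableT (Rintegrable_heat_kernel x t0)).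
by rewrite Rintegral_heat_kernel// mulr1.
Qed.

Lemma Rintegrable_moment k t x : 0 < t ->
  Rintegrable lam (fun y => sqnorm (y - x) ^+ k * heat_kernel t x y).
Proof.
move=> t0; have t20 : 0 < 2 * t by rewrite mulr_gt0.
apply: (le_Rintegrable _ _
  (RintegrableZ (moment_cst R n k * t ^+ k) (Rintegrable_heat_kernel x t20))).
- apply: measurable_funM; last exact: measurable_heat_kernel.
  by apply: measurable_funX; exact: measurable_sqnorm.
- move=> y; rewrite ger0_norm ?gauss_density_moment//.
  by rewrite mulr_ge0 ?heat_kernel_ge0// exprn_ge0// sqnorm_ge0.
Qed.

Lemma Rintegral_moment k t x : 0 < t ->
  \int[lam]_y (sqnorm (y - x) ^+ k * heat_kernel t x y) <= moment_cst R n k * t ^+ k.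
Proof.
move=> t0; have t20 : 0 < 2 * t by rewrite mulr_gt0.
rewrite -(RintegralZ_heat_kernel (moment_cst R n k * t ^+ k) x t20).
apply: le_Rintegral => //; first exact: Rintegrable_moment.
- exact/RintegrableZ/Rintegrable_heat_kernel.
- by move=> y _; exact: gauss_density_moment.
Qed.

(* Bounds the mass of the heat kernel off the ball of radius [r]. *)
Definition heat_tail t r : R := moment_cst R n 2 * t ^+ 2 / (r ^+ 2) ^+ 2.

Lemma heat_tail_ge0 t r : 0 <= heat_tail t r.
Proof. by rewrite divr_ge0 ?sqr_ge0// mulr_ge0 ?moment_cst_ge0 ?sqr_ge0. Qed.

Lemma heat_tailZ t r : heat_tail t r = heat_tail 1 r * t ^+ 2.
Proof. by rewrite /heat_tail expr1n mulr1 mulrAC. Qed.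

Definition tail_weight t r x y : R :=
  ((r ^+ 2) ^+ 2)^-1 * (sqnorm (y - x) ^+ 2 * heat_kernel t x y).

Lemma tail_weight_ge0 t r x y : 0 < t -> 0 <= tail_weight t r x y.
Proof.
by move=> t0; rewrite mulr_ge0 ?invr_ge0 ?sqr_ge0// mulr_ge0 ?sqr_ge0 ?heat_kernel_ge0.
Qed.

Lemma heat_kernel_le_tail_weight t r x y : 0 < t -> 0 < r -> ~ cball_e x r y ->
  heat_kernel t x y <= tail_weight t r x y.
Proof.
move=> t0 r0 yr; rewrite /tail_weight mulrA ler_peMl ?heat_kernel_ge0//.
rewrite mulrC ler_pdivlMr ?exprn_gt0// mul1r lerXn2r ?nnegrE ?sqr_ge0 ?sqnorm_ge0//.
by rewrite leNgt; apply/negP => /ltW yx; exact: yr.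
Qed.

Lemma Rintegrable_tail_weight t r x : 0 < t -> Rintegrable lam (tail_weight t r x).
Proof. by move=> t0; exact/RintegrableZ/Rintegrable_moment. Qed.

Lemma Rintegral_tail_weight t r x : 0 < t ->
  \int[lam]_y tail_weight t r x y <= heat_tail t r.
Proof.
move=> t0; rewrite (RintegralZl _ measurableT (Rintegrable_moment 2 x t0)) mulrC.
by rewrite ler_wpM2r ?invr_ge0 ?sqr_ge0// Rintegral_moment.
Qed.

Lemma Rintegral_heat_kernel_diff t x z : 0 < t ->
  \int[lam]_y `|heat_kernel t z y - heat_kernel t x y| <=
  2 * gauss_shift_cst R n * (enorm (z - x) / Num.sqrt t).
Proof.
move=> t0; have t80 : 0 < 8 * t by rewrite mulr_gt0.
have kt u := Rintegrable_heat_kernel u t0; have k8t := Rintegrable_heat_kernel x t80.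
have diff_i := Rintegrable_norm (RintegrableB (kt z) (kt x)).
have [zx|/ltW xz] := leP (enorm (z - x)) (Num.sqrt t).
  have i_sum := RintegrableD (kt x) k8t.
  have -> : 2 * gauss_shift_cst R n * (enorm (z - x) / Num.sqrt t) =
    \int[lam]_y (gauss_shift_cst R n * (enorm (z - x) / Num.sqrt t) *
      (heat_kernel t x y + heat_kernel (8 * t) x y)).
    rewrite (RintegralZl _ measurableT i_sum) (RintegralD measurableT (kt x) k8t).
    by rewrite !Rintegral_heat_kernel//; ring.
  apply: le_Rintegral => //; first exact: RintegrableZ.
  move=> y _; have := gauss_density_diff_short (y - x) t0 zx.
  by rewrite opprB addrA subrK.
apply: (@le_trans _ _ 2).
  have -> : 2 = \int[lam]_y (heat_kernel t z y + heat_kernel t x y).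
    by rewrite (RintegralD measurableT (kt z) (kt x)) !Rintegral_heat_kernel.
  apply: le_Rintegral => //; first exact: RintegrableD.
  move=> y _; rewrite (le_trans (ler_normB _ _))//.
  by rewrite !ger0_norm ?heat_kernel_ge0.
rewrite -mulrA ler_peMr// mulr_ege1 ?gauss_shift_cst_ge1//.
by rewrite ler_pdivlMr ?sqrtr_gt0// mul1r.
Qed.

End HeatKernel.

Section HeatSemigroup.
Variables (R : realType) (n : nat).
Local Notation V := 'rV[R]_(n.+1).
Local Notation E := (Rd R n).
Local Notation bmeas := (@bounded_measurable _ E R).
Variable lam : lebesgueRd R n.
Implicit Types (x y z : V) (s t M N c L : R) (f g psi : V -> R).

Definition heat t f : V -> R := fun x => \int[lam]_y (f y * heat_kernel t x y).

Lemma measurable_heat t f : measurable_fun setT (f : E -> R) ->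
  measurable_fun setT (heat t f : E -> R).
Proof.
move=> mf; pose F (p : E * E) : \bar R := (f p.2 * heat_kernel t p.1 p.2)%:E.
have mF : measurable_fun setT F.
  apply/measurable_EFinP; apply: measurable_funM.
    exact: (measurableT_comp mf measurable_snd).
  by apply: measurable_heat_kernel_comp; [exact: measurable_fst|exact: measurable_snd].
apply: (measurableT_comp (fine_measurable measurableT)).
rewrite (_ : (fun _ => _) = fun x : E =>
  (\int[lam]_y (F^\+ (x, y)) - \int[lam]_y (F^\- (x, y)))%E); last first.
  apply/funext => x; rewrite [LHS]integralE.
  by congr (_ - _)%E; apply: eq_integral => y _; rewrite ?funeposE ?funenegE.
apply: emeasurable_funB.
- by apply: (measurable_fun_fubini_tonelli_F (m2 := lam)) => //; exact: measurable_funepos.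
- by apply: (measurable_fun_fubini_tonelli_F (m2 := lam)) => //; exact: measurable_funeneg.
Qed.

Lemma normr_heat_le t f M x : 0 < t -> bmeas f M -> `|heat t f x| <= M.
Proof.
move=> t0 fM; rewrite -[leRHS](RintegralZ_heat_kernel lam M x t0).
apply: normr_Rintegral_le; first exact: RintegrableM_heat_kernel fM.
  exact/RintegrableZ/Rintegrable_heat_kernel.
move=> y; rewrite normrM (ger0_norm (heat_kernel_ge0 _ _ t0)).
by rewrite ler_wpM2r ?heat_kernel_ge0//; exact: fM.2.
Qed.

Lemma bounded_measurable_heat t f M : 0 < t -> bmeas f M -> bmeas (heat t f) M.
Proof.
by move=> t0 fM; split; [exact: measurable_heat fM.1|move=> x; exact: normr_heat_le].
Qed.

Lemma bounded_measurable_heatB t f M : 0 < t -> bmeas f M ->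
  bmeas (fun x => heat t f x - f x) (M + M).
Proof. by move=> t0 fM; exact: bounded_measurableB (bounded_measurable_heat t0 fM) fM. Qed.

Lemma heatD t f g M N x : 0 < t -> bmeas f M -> bmeas g N ->
  heat t (fun y => f y + g y) x = heat t f x + heat t g x.
Proof.
move=> t0 fM gN; rewrite -RintegralD//; last 2 first.
- exact: RintegrableM_heat_kernel fM.
- exact: RintegrableM_heat_kernel gN.
by rewrite /heat; under eq_Rintegral do rewrite mulrDl.
Qed.

Lemma heatZ t f M c x : 0 < t -> bmeas f M ->
  heat t (fun y => c * f y) x = c * heat t f x.
Proof.
move=> t0 fM; rewrite -RintegralZl//; last exact: RintegrableM_heat_kernel fM.
by rewrite /heat; under eq_Rintegral do rewrite -mulrA.
Qed.

Lemma heatB t f g M N x : 0 < t -> bmeas f M -> bmeas g N ->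
  heat t (fun y => f y - g y) x = heat t f x - heat t g x.
Proof.
move=> t0 fM gN; rewrite -RintegralB//; last 2 first.
- exact: RintegrableM_heat_kernel fM.
- exact: RintegrableM_heat_kernel gN.
by rewrite /heat; under eq_Rintegral do rewrite mulrBl.
Qed.

Lemma heat_cst t c x : 0 < t -> heat t (fun=> c) x = c.
Proof. exact: RintegralZ_heat_kernel. Qed.

Lemma heat_sum t (I : Type) (s : seq I) (F : I -> V -> R) M x : 0 < t ->
  (forall i, bmeas (F i) M) ->
  heat t (fun y => \sum_(i <- s) F i y) x = \sum_(i <- s) heat t (F i) x.
Proof.
move=> t0 FM; rewrite -Rintegral_sum; last by move=> i; exact: RintegrableM_heat_kernel (FM i).
by rewrite /heat; under eq_Rintegral do rewrite mulr_suml.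
Qed.

Lemma heat_ge0 t f x : 0 < t -> (forall y, 0 <= f y) -> 0 <= heat t f x.
Proof. by move=> t0 f0; apply: Rintegral_ge0 => y _; rewrite mulr_ge0 ?heat_kernel_ge0. Qed.

Lemma heat_indic_ge0_le1 t (A : set E) x : 0 < t -> measurable A -> 0 <= heat t \1_A x <= 1.
Proof.
move=> t0 mA; rewrite heat_ge0//= (le_trans (ler_norm _))//.
exact: normr_heat_le (bounded_measurable_indic _ mA).
Qed.

Lemma elipschitz_heat t f M : 0 < t -> bmeas f M ->
  elipschitz (2 * M * gauss_shift_cst R n / Num.sqrt t) (heat t f).
Proof.
move=> t0 fM x y; have kt z := Rintegrable_heat_kernel lam z t0.
have diff_i := Rintegrable_norm (RintegrableB (kt y) (kt x)).
rewrite -RintegralB//; last 2 first.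
- exact: RintegrableM_heat_kernel fM.
- exact: RintegrableM_heat_kernel fM.
apply: (@le_trans _ _ (M * \int[lam]_z `|heat_kernel t y z - heat_kernel t x z|)).
  apply: le_trans (normr_RintegralM_le (RintegrableB (kt y) (kt x)) fM).
  rewrite le_eqVlt; apply/orP; left; apply/eqP; congr `|_|.
  by apply: eq_Rintegral => z _; rewrite mulrBl ![f z * _]mulrC.
have -> : 2 * M * gauss_shift_cst R n / Num.sqrt t * enorm (y - x) =
  M * (2 * gauss_shift_cst R n * (enorm (y - x) / Num.sqrt t)) by ring.
apply: ler_wpM2l; first exact: bounded_measurable_ge0 fM x.
exact: Rintegral_heat_kernel_diff.
Qed.

Lemma heat_prod_integrable t psi f M : 0 < t -> Rintegrable lam psi -> bmeas f M ->
  (lam \x lam)%E.-integrable setT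
    (fun p : E * E => (psi p.1 * (f p.2 * heat_kernel t p.1 p.2))%:E).
Proof.
move=> t0 psi_i fM; set F := (fun p => _).
have mF : measurable_fun setT F.
  apply/measurable_EFinP; apply: measurable_funM.
    exact: (measurableT_comp (Rintegrable_measurable psi_i) measurable_fst).
  apply: measurable_funM; first exact: (measurableT_comp fM.1 measurable_snd).
  by apply: measurable_heat_kernel_comp; [exact: measurable_fst|exact: measurable_snd].
apply: (@integrable12ltyP _ _ E E R lam lam _ mF).2.
apply: (@le_lt_trans _ _ (\int[lam]_x (M * `|psi x|)%:E)%E); last first.
  by rewrite -EFin_Rintegral ?ltry//; exact/RintegrableZ/Rintegrable_norm.
apply: ge0_le_integral => //.
- by move=> x _; apply: integral_ge0.
- apply: (measurable_fun_fubini_tonelli_F (m2 := lam) (abse \o F)).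
    exact: measurableT_comp.
  by move=> p; exact: abse_ge0.
- apply/measurable_EFinP; apply: measurable_funM => //.
  by apply: measurableT_comp => //; exact: Rintegrable_measurable psi_i.
move=> x _; rewrite -[in leRHS](RintegralZ_heat_kernel lam (M * `|psi x|) x t0).
rewrite EFin_Rintegral; last exact/RintegrableZ/Rintegrable_heat_kernel.
apply: ge0_le_integral => //.
- apply/measurable_EFinP; apply: measurableT_comp => //; apply/measurable_EFinP.
  exact: (measurableT_comp mF (pair1_measurable x)).
- by apply/measurable_EFinP; apply: measurable_funM => //; exact: measurable_heat_kernel.
- move=> y _; rewrite lee_fin /= (normrM (psi x)) (normrM (f y)).
  rewrite (ger0_norm (heat_kernel_ge0 _ _ t0)) mulrA ler_wpM2r ?heat_kernel_ge0//.
  by rewrite mulrC ler_wpM2r//; exact: fM.2.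
Qed.

Lemma heat_adjoint t psi f M : 0 < t -> Rintegrable lam psi -> bmeas f M ->
  \int[lam]_x (psi x * heat t f x) = \int[lam]_x (f x * heat t psi x).
Proof.
move=> t0 psi_i fM; congr fine.
transitivity (\int[lam]_x \int[lam]_y (psi x * (f y * heat_kernel t x y))%:E)%E.
  apply: eq_integral => x _; have i_f := RintegrableM_heat_kernel lam x t0 fM.
  by rewrite -(EFin_Rintegral (RintegrableZ (psi x) i_f)) (RintegralZl (psi x) measurableT i_f).
rewrite (@Fubini _ _ E E R lam lam _ (heat_prod_integrable t0 psi_i fM)).
apply: eq_integral => y _.
transitivity (\int[lam]_x (f y * (psi x * heat_kernel t y x))%:E)%E.
  by apply: eq_integral => x _; congr (_%:E); rewrite [heat_kernel t y x]heat_kernelC /=; ring.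
have i_psi := RintegrableM psi_i (bounded_measurable_heat_kernel y t0).
by rewrite -(EFin_Rintegral (RintegrableZ (f y) i_psi)) (RintegralZl (f y) measurableT i_psi).
Qed.

Lemma heat_kernel_semigroup s t x z : 0 < s -> 0 < t ->
  heat t (heat_kernel s x) z = heat_kernel (s + t) x z.
Proof.
move=> s0 t0; have st0 : 0 < t * s / (t + s) by rewrite divr_gt0 ?mulr_gt0 ?addr_gt0.
pose c := x + (s / (t + s)) *: (z - x).
rewrite -[RHS](RintegralZ_heat_kernel lam _ c st0).
apply: eq_Rintegral => y _; rewrite mulrC [heat_kernel t z y]heat_kernelC /heat_kernel.
rewrite -[z - y](_ : (z - x) - (y - x) = _); last by rewrite opprB addrA subrK.
by rewrite (gauss_convolution (z - x) (y - x) t0 s0) (addrC s t) /c opprD addrA.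
Qed.

Lemma heat_semigroup s t f M x : 0 < s -> 0 < t -> bmeas f M ->
  heat s (heat t f) x = heat (s + t) f x.
Proof.
move=> s0 t0 fM; rewrite {1}/heat; under eq_Rintegral do rewrite mulrC.
rewrite (heat_adjoint t0 (Rintegrable_heat_kernel lam x s0) fM).
by apply: eq_Rintegral => y _; rewrite heat_kernel_semigroup.
Qed.

Lemma Rintegrable_heat t psi : 0 < t -> Rintegrable lam psi -> Rintegrable lam (heat t psi).
Proof.
move=> t0 psi_i; have psi_ik x := RintegrableM psi_i (bounded_measurable_heat_kernel x t0).
have prod_i := heat_prod_integrable t0 psi_i (bounded_measurable1 E R).
have mF := measurable_int _ prod_i.
have m_heat := measurable_heat t (Rintegrable_measurable psi_i).
apply/integrableP; split; first exact/measurable_EFinP.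
apply: le_lt_trans ((@integrable21ltyP _ _ E E R lam lam _ mF).1 prod_i).
apply: ge0_le_integral => //.
- by apply/measurable_EFinP; exact: measurableT_comp.
- apply: (measurable_fun_fubini_tonelli_G (m1 := lam)
    (abse \o (fun p : E * E => (psi p.1 * (1 * heat_kernel t p.1 p.2))%:E))).
    exact: measurableT_comp.
  by move=> p; exact: abse_ge0.
move=> y _ /=; under [leRHS]eq_integral do rewrite /= mul1r heat_kernelC.
rewrite -(EFin_Rintegral (Rintegrable_norm (psi_ik y))) lee_fin.
exact: le_normr_Rintegral (psi_ik y).
Qed.

Lemma Rintegral_heat t psi : 0 < t -> Rintegrable lam psi ->
  \int[lam]_x heat t psi x = \int[lam]_x psi x.
Proof.
move=> t0 psi_i; have := heat_adjoint t0 psi_i (bounded_measurable1 E R).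
under eq_Rintegral do rewrite heat_cst// mulr1.
by move=> ->; under [RHS]eq_Rintegral do rewrite mul1r.
Qed.

Lemma heat_defect_adjoint t psi f M : 0 < t -> Rintegrable lam psi -> bmeas f M ->
  \int[lam]_x (psi x * (heat t f x - f x)) = \int[lam]_x (f x * (heat t psi x - psi x)).
Proof.
move=> t0 psi_i fM; have psi_if := RintegrableM psi_i fM.
have heat_if := RintegrableM (Rintegrable_heat t0 psi_i) fM.
under eq_Rintegral do rewrite mulrBr.
under [RHS]eq_Rintegral do rewrite mulrBr ![f _ * _]mulrC.
rewrite !RintegralB//; last exact: RintegrableM (bounded_measurable_heat t0 fM).
by rewrite (heat_adjoint t0 psi_i fM); under eq_Rintegral do rewrite mulrC.
Qed.

(* [E|B_t| <= sqrt t + E|B_t|^2 / sqrt t]. *)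
Lemma heat_sub_le f M L t x : 0 < t -> bmeas f M -> elipschitz L f ->
  `|heat t f x - f x| <= L * ((1 + moment_cst R n 1) * Num.sqrt t).
Proof.
move=> t0 fM fL; set s := Num.sqrt t; have s0 : 0 < s by rewrite sqrtr_gt0.
have tE : t = s ^+ 2 by rewrite sqr_sqrtr// ltW.
have L0 := elipschitz_ge0 fL.
have kt := Rintegrable_heat_kernel lam x t0; have m1 := Rintegrable_moment lam 1 x t0.
have i_bound := RintegrableD (RintegrableZ s kt) (RintegrableZ s^-1 m1).
have -> : heat t f x - f x = \int[lam]_y (f y * heat_kernel t x y - f x * heat_kernel t x y).
  rewrite RintegralB ?RintegralZ_heat_kernel//; first exact: RintegrableM_heat_kernel fM.
  exact: RintegrableZ.
apply: (@le_trans _ _ (\int[lam]_y (L * (s * heat_kernel t x y +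
    s^-1 * (sqnorm (y - x) ^+ 1 * heat_kernel t x y))))).
  apply: normr_Rintegral_le; last 2 first.
  - exact: RintegrableZ.
  - move=> y; have := heat_kernel_ge0 x y t0; move: (heat_kernel t x y) => p p0.
    rewrite -mulrBl normrM (ger0_norm p0) expr1.
    rewrite [leRHS](_ : _ = L * (s + s^-1 * sqnorm (y - x)) * p); last by ring.
    rewrite ler_wpM2r// (le_trans (fL _ _))// ler_wpM2l// -sqr_enorm.
    move: (enorm _) (enorm_ge0 (y - x)) => a a0.
    by rewrite -(ler_pM2l s0) mulrDr mulVKf ?gt_eqF//; nra.
  - apply: RintegrableB; [exact: RintegrableM_heat_kernel fM|exact: RintegrableZ].
rewrite RintegralZl// ler_wpM2l// RintegralD//; [|exact: RintegrableZ..].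
rewrite RintegralZ_heat_kernel// (RintegralZl s^-1 measurableT m1) mulrDl mul1r lerD2l.
have := Rintegral_moment lam 1 x t0; rewrite expr1 => m1_le.
by rewrite mulrC ler_pdivrMr// -mulrA -expr2 -tE.
Qed.

End HeatSemigroup.

Section GaussianMeasure.
Variables (R : realType) (n : nat) (lam : lebesgueRd R n) (t : R).
Local Notation E := (Rd R n).
Hypothesis t_gt0 : 0 < t.
Implicit Type A : set E.

Let gauss_ge0 (x : E) : (0 <= (gauss_density t x)%:E)%E.
Proof. by rewrite lee_fin gauss_density_ge0. Qed.

Let m_gauss : measurable_fun setT (EFin \o (gauss_density t : E -> R)).
Proof. by apply/measurable_EFinP; exact: measurable_gauss_density. Qed.

Lemma gauss_fin_num A : measurable A -> gauss lam t A \is a fin_num.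
Proof.
move=> mA; rewrite ge0_fin_numE; last exact: integral_ge0.
apply: le_lt_trans (ltry (1 : R)); rewrite -(gauss_mass lam t_gt0).
exact: ge0_subset_integral.
Qed.

Lemma gauss_lt1 A : measurable A -> (0 < lam (~` A))%E -> fine (gauss lam t A) < 1.
Proof.
move=> mA AC0; have gauss_split : (gauss lam t A + gauss lam t (~` A) = 1)%E.
  rewrite -(gauss_mass lam t_gt0) -[in RHS](setUv A) /gauss ge0_integral_setU//.
  - exact: measurableC.
  - by rewrite setUv.
  - exact/disj_setPCl.
have gaussC_gt0 : (0 < gauss lam t (~` A))%E.
  rewrite lt0e integral_ge0// andbT; apply/eqP => gaussC0.
  have mAC := measurableC mA.
  have : (\int[lam]_(x in ~` A) `|(gauss_density t x)%:E| = 0)%E.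
    by rewrite -gaussC0; apply: eq_integral => x _; rewrite gee0_abs.
  move=> /(ae_eq_integral_abs lam mAC (measurable_funTS m_gauss))[N [mN N0 AN]].
  have : lam (~` A) = 0%E.
    apply: (subset_measure0 mAC mN _ N0); apply: subset_trans AN => x Ax /= /(_ Ax) [] /eqP.
    by rewrite gt_eqF// gauss_density_gt0.
  by move=> AC_eq0; rewrite AC_eq0 ltxx in AC0.
by rewrite -lte_fin fineK ?gauss_fin_num// -gauss_split lteDl// gauss_fin_num.
Qed.

End GaussianMeasure.

(** * Discrete potentials and the logarithmic truncation *)

Section RealInequalities.
Variable R : realType.
Implicit Types c m t x y : R.

Lemma dist_max_le c x y : `|Num.max c x - Num.max c y| <= `|x - y|.
Proof.
rewrite /Num.max; case: ltP => cx; case: ltP => cy; rewrite ler_norml; apply/andP;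
  split; case: (ger0P (x - y)) => xy; lra.
Qed.

Lemma dist_min_le c x y : `|Num.min x c - Num.min y c| <= `|x - y|.
Proof.
rewrite /Num.min; case: ltP => cx; case: ltP => cy; rewrite ler_norml; apply/andP;
  split; case: (ger0P (x - y)) => xy; lra.
Qed.

Lemma ln_le_subr1 x : 0 < x -> ln x <= x - 1.
Proof. by move=> x0; rewrite -{1}[x](subrKC 1) le_ln1Dx// ltrBrDl subrr. Qed.

Lemma dist_ln_le m x y : 0 < m -> m <= x -> m <= y -> `|ln x - ln y| <= `|x - y| / m.
Proof.
move=> m0; wlog xy : x y / x <= y.
  move=> dist_le mx my; have [xy|/ltW yx] := leP x y; first exact: dist_le.
  by rewrite distrC [`|x - y|]distrC; exact: dist_le.
move=> mx my; have x0 := lt_le_trans m0 mx; have y0 := lt_le_trans m0 my.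
have lnxy : ln x <= ln y by rewrite ler_ln ?posrE.
rewrite distrC [`|x - y|]distrC !ger0_norm ?subr_ge0// -ln_div ?posrE//.
apply: (le_trans (ln_le_subr1 (divr_gt0 y0 x0))).
rewrite (_ : y / x - 1 = (y - x) / x); last by field; rewrite gt_eqF.
by rewrite ler_wpM2l ?subr_ge0// lef_pV2 ?posrE.
Qed.

Lemma entropy_subgradient c t t' : 0 < c -> 0 < t -> 0 < t' ->
  ln (t / c) * (t' - t) <= (t' * ln (t' / c) - t' + c) - (t * ln (t / c) - t + c).
Proof.
move=> c0 t0 t'0; rewrite !ln_div ?posrE//.
have : t' * (ln t - ln t') <= t' * (t / t' - 1).
  by rewrite ler_pM2l// -ln_div ?posrE// ln_le_subr1// divr_gt0.
rewrite (_ : t' * (t / t' - 1) = t - t'); last by field; rewrite gt_eqF.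
by lra.
Qed.

Lemma sum_inv_sqrt_le (i : nat) :
  \sum_(j < i) (Num.sqrt (j.+1%:R : R))^-1 <= 2 * Num.sqrt i%:R.
Proof.
elim: i => [|i ih]; first by rewrite big_ord0 sqrtr0 mulr0.
rewrite big_ord_recr /=; move: ih; set a : R := Num.sqrt i%:R; set d := Num.sqrt i.+1%:R.
have d0 : 0 < d by rewrite sqrtr_gt0 ltr0n.
have a0 : 0 <= a by exact: sqrtr_ge0.
have ad : a <= d by rewrite ler_wsqrtr// ler_nat.
have sqr_diff : d ^+ 2 - a ^+ 2 = 1.
  by rewrite !sqr_sqrtr ?ler0n// -natr1; ring.
suff : d^-1 <= 2 * (d - a) by lra.
by rewrite -div1r ler_pdivrMr//; nra.
Qed.

Lemma grid_approx (d y : R) : 0 < d -> d <= y -> exists i : nat, y <= i.+1%:R * d <= 2 * y.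
Proof.
move=> d0 dy; exists (Num.truncn (y / d)).
have yd : 0 <= y / d by rewrite divr_ge0 ?ltW// (lt_le_trans d0 dy).
apply/andP; split; first by rewrite -ler_pdivrMr// ltW// truncnS_gt.
rewrite -natr1 mulrDl mul1r (_ : 2 * y = y + y); last by ring.
by rewrite lerD// -ler_pdivlMr// truncn_le.
Qed.

Lemma near_right0_mul_le (A e : R) : 0 < e -> \forall d \near 0^'+, A * d <= e.
Proof.
move=> e0; have A0 : 0 < `|A| + 1 by rewrite ltr_pwDr.
near=> d; have d0 : 0 < d by near: d; exact: nbhs_right_gt.
have d_le : d <= e / (`|A| + 1) by near: d; apply: nbhs_right_le; exact: divr_gt0.
apply: (@le_trans _ _ ((`|A| + 1) * d)); last by rewrite mulrC -ler_pdivlMr.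
by rewrite ler_wpM2r ?(ltW d0)// (le_trans (ler_norm A))// lerDl.
Unshelve. all: by end_near.
Qed.

Lemma near_right0_mul_sqrt_le (A e : R) : 0 < e -> \forall d \near 0^'+, A * Num.sqrt d <= e.
Proof.
move=> e0; have e20 : 0 < e ^+ 2 by rewrite exprn_gt0.
have [A0|A0] := ltP A 0.
  by apply: nearW => d; rewrite (le_trans _ (ltW e0))// nmulr_rle0// sqrtr_ge0.
near=> d; have d0 : 0 < d by near: d; exact: nbhs_right_gt.
rewrite -ler_sqr ?nnegrE ?(ltW e0) ?mulr_ge0 ?sqrtr_ge0// exprMn sqr_sqrtr ?(ltW d0)//.
by near: d; exact: near_right0_mul_le.
Unshelve. all: by end_near.
Qed.

End RealInequalities.

Section LogTruncation.
Variables (R : realType) (b : R).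
Hypotheses (b_gt0 : 0 < b) (b_lt1 : b < 1).
Implicit Types s m : R.

Local Notation L := (ln b^-1).

Definition log_clamp s : R := Num.max (b ^+ 2) (Num.min s b).
(* [log_trunc] is convex with derivative [log_ramp], a logarithmic ramp from 0 at
   [b ^+ 2] to 1 at [b]. *)
Definition log_ramp s : R := ln (log_clamp s / b ^+ 2) / L.
Definition log_trunc s : R :=
  (log_clamp s * ln (log_clamp s / b ^+ 2) - log_clamp s + b ^+ 2) / L + (Num.max s b - b).

Let b2_gt0 : 0 < b ^+ 2. Proof. by rewrite exprn_gt0. Qed.

Let b2_lt_b : b ^+ 2 < b. Proof. by rewrite expr2 gtr_pMr. Qed.

Lemma ln_inv_gt0 : 0 < L.
Proof. by rewrite ln_gt0// invf_gt1. Qed.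

Let L_gt0 := ln_inv_gt0.

Lemma log_clamp_ge s : b ^+ 2 <= log_clamp s. Proof. by rewrite le_max lexx. Qed.

Lemma log_clamp_le s : log_clamp s <= b.
Proof. by rewrite ge_max (ltW b2_lt_b) ge_min lexx orbT. Qed.

Lemma log_clamp_gt0 s : 0 < log_clamp s. Proof. exact: lt_le_trans (log_clamp_ge s). Qed.

Lemma log_clamp_ge_min m s : m <= b -> m <= s -> m <= log_clamp s.
Proof. by move=> mb ms; rewrite le_max le_min ms mb orbT. Qed.

Lemma log_clamp_low s : s <= b ^+ 2 -> log_clamp s = b ^+ 2.
Proof. by move=> sb; rewrite /log_clamp min_l ?max_l// (le_trans sb (ltW b2_lt_b)). Qed.

Lemma log_clamp_high s : b <= s -> log_clamp s = b.
Proof. by move=> bs; rewrite /log_clamp min_r ?max_r// ltW. Qed.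

Lemma log_clamp_id s : b ^+ 2 <= s <= b -> log_clamp s = s.
Proof. by move=> /andP[bs sb]; rewrite /log_clamp min_l ?max_r. Qed.

Lemma log_clamp_dist s s' : `|log_clamp s' - log_clamp s| <= `|s' - s|.
Proof. exact: le_trans (dist_max_le _ _ _) (dist_min_le _ _ _). Qed.

Lemma log_ramp_ge0 s : 0 <= log_ramp s.
Proof.
by rewrite divr_ge0 ?(ltW L_gt0)// ln_ge0// ler_pdivlMr// mul1r log_clamp_ge.
Qed.

Lemma log_ramp_le1 s : log_ramp s <= 1.
Proof.
rewrite ler_pdivrMr// mul1r ler_ln ?posrE ?invr_gt0 ?divr_gt0 ?log_clamp_gt0//.
by rewrite ler_pdivrMr// expr2 mulrA mulVf ?gt_eqF// mul1r log_clamp_le.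
Qed.

Lemma log_ramp_eq0 s : s <= b ^+ 2 -> log_ramp s = 0.
Proof. by move=> sb; rewrite /log_ramp log_clamp_low// divff ?gt_eqF// ln1 mul0r. Qed.

Lemma log_ramp_eq1 s : b <= s -> log_ramp s = 1.
Proof.
move=> bs; rewrite /log_ramp log_clamp_high// (_ : b / b ^+ 2 = b^-1) ?divff ?gt_eqF//.
by field; rewrite gt_eqF.
Qed.

Lemma log_ramp_dist_clamp m s s' : 0 < m -> m <= log_clamp s -> m <= log_clamp s' ->
  `|log_ramp s' - log_ramp s| <= `|s' - s| / (L * m).
Proof.
move=> m0 ms ms'.
rewrite -mulrBl normrM (gtr0_norm (_ : 0 < L^-1)) ?invr_gt0//.
rewrite !ln_div ?posrE ?log_clamp_gt0//.
rewrite (_ : _ - _ - _ = ln (log_clamp s') - ln (log_clamp s)); last by ring.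
rewrite invfM mulrA mulrAC ler_wpM2r ?invr_ge0 ?(ltW L_gt0)//.
apply: (le_trans (dist_ln_le m0 ms' ms)).
by rewrite ler_wpM2r ?invr_ge0 ?(ltW m0)// log_clamp_dist.
Qed.

Lemma log_ramp_lipschitz s s' : `|log_ramp s' - log_ramp s| <= `|s' - s| / (L * b ^+ 2).
Proof. by apply: log_ramp_dist_clamp => //; exact: log_clamp_ge. Qed.

Lemma log_ramp_dist m s s' : 0 < m -> m <= s -> m <= s' ->
  `|log_ramp s' - log_ramp s| <= `|s' - s| / (L * m).
Proof.
move=> m0 ms ms'; have [bm|/ltW mb] := leP b m.
  rewrite !log_ramp_eq1 ?(le_trans bm)// subrr normr0 divr_ge0//.
  by rewrite mulr_ge0// ltW.
by apply: log_ramp_dist_clamp => //; exact: log_clamp_ge_min.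
Qed.

Lemma log_trunc_subgradient s s' : log_ramp s * (s' - s) <= log_trunc s' - log_trunc s.
Proof.
set t := log_clamp s; set t' := log_clamp s'.
have clamp_part : log_ramp s * (t' - t) <=
    (t' * ln (t' / b ^+ 2) - t' + b ^+ 2) / L - (t * ln (t / b ^+ 2) - t + b ^+ 2) / L.
  rewrite -mulrBl /log_ramp mulrAC ler_wpM2r ?invr_ge0 ?(ltW L_gt0)//.
  by apply: entropy_subgradient => //; exact: log_clamp_gt0.
have excess_ge : s' - t' <= Num.max s' b - b.
  rewrite /t'; have [s'b|/ltW bs'] := leP s' b; last by rewrite log_clamp_high.
  by rewrite subrr subr_le0; exact: log_clamp_ge_min.
have excess_part :
    log_ramp s * ((s' - t') - (s - t)) <= (Num.max s' b - b) - (Num.max s b - b).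
  have g0 := log_ramp_ge0 s; have g1 := log_ramp_le1 s.
  have max_ge : 0 <= Num.max s' b - b by rewrite subr_ge0 le_max lexx orbT.
  have [sb2|/ltW b2s] := leP s (b ^+ 2).
    by rewrite log_ramp_eq0// mul0r (max_r (le_trans sb2 (ltW b2_lt_b))) subrr subr0.
  have [bs|/ltW sb] := leP b s.
    by rewrite log_ramp_eq1// mul1r /t log_clamp_high//; lra.
  by rewrite /t log_clamp_id ?b2s//; nra.
by rewrite /log_trunc -/t -/t'; lra.
Qed.

Lemma log_trunc_le_gradient s s' : log_trunc s' - log_trunc s <= log_ramp s' * (s' - s).
Proof. by have := log_trunc_subgradient s' s; rewrite -opprB mulrN; lra. Qed.

Lemma log_trunc0 : log_trunc 0 = 0.
Proof.
rewrite /log_trunc log_clamp_low ?(ltW b2_gt0)// max_r ?(ltW b_gt0)//.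
by rewrite divff ?gt_eqF// ln1; field; rewrite gt_eqF.
Qed.

Lemma log_trunc_ge0 s : 0 <= log_trunc s.
Proof.
have := log_trunc_subgradient 0 s.
by rewrite log_ramp_eq0 ?(ltW b2_gt0)// log_trunc0 mul0r subr0.
Qed.

Lemma log_trunc_le_id s : 0 <= s -> log_trunc s <= s.
Proof.
move=> s0; have := log_trunc_le_gradient 0 s; rewrite log_trunc0 !subr0 => trunc_le.
by apply: (le_trans trunc_le); rewrite ler_piMl// log_ramp_le1.
Qed.

Lemma log_trunc_ge_sub s : s - b <= log_trunc s.
Proof.
have := log_trunc_subgradient b s; have := log_trunc_ge0 b.
by rewrite log_ramp_eq1// mul1r; lra.
Qed.

Lemma log_trunc_eq0 s : 0 <= s <= b ^+ 2 -> log_trunc s = 0.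
Proof.
move=> /andP[s0 sb]; apply/eqP; rewrite eq_le log_trunc_ge0 andbT.
by have := log_trunc_le_gradient 0 s; rewrite log_ramp_eq0// log_trunc0 mul0r subr0.
Qed.

Lemma measurable_log_clamp : measurable_fun setT log_clamp.
Proof.
apply: measurable_maxr; first exact: measurable_cst.
by apply: measurable_minr; [exact: measurable_id|exact: measurable_cst].
Qed.

Lemma measurable_log_trunc : measurable_fun setT log_trunc.
Proof.
have m_ln : measurable_fun setT (fun s => ln (log_clamp s / b ^+ 2)).
  apply: measurableT_comp; first exact: measurable_ln.
  by apply: measurable_funM; [exact: measurable_log_clamp|exact: measurable_cst].
apply: measurable_funD; last first.
  apply: measurable_funB; last exact: measurable_cst.
  by apply: measurable_maxr; [exact: measurable_id|exact: measurable_cst].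
apply: measurable_funM; last exact: measurable_cst.
apply: measurable_funD; last exact: measurable_cst.
apply: measurable_funB; last exact: measurable_log_clamp.
by apply: measurable_funM => //; exact: measurable_log_clamp.
Qed.

End LogTruncation.

Section HeatPotential.
Variables (R : realType) (n : nat).
Local Notation V := 'rV[R]_(n.+1).
Local Notation E := (Rd R n).
Local Notation bmeas := (@bounded_measurable _ E R).
Variable lam : lebesgueRd R n.
Local Notation heat := (heat lam).
Variables (d C : R) (g : V -> R).
Hypotheses (d_gt0 : 0 < d) (gC : bmeas g C).
Implicit Types (x y : V) (i j k : nat) (t : R).

(* Riemann sum, with mesh [d], of the time integral of [heat t g]. *)
Definition heat_potential i x : R := d * \sum_(j < i) heat (j.+1%:R * d) g x.

Let time_gt0 j : 0 < j.+1%:R * d. Proof. by rewrite mulr_gt0// ltr0n. Qed.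

Let C_ge0 : 0 <= C. Proof. exact: bounded_measurable_ge0 gC 0. Qed.

Let heat_time_bmeas j := bounded_measurable_heat lam (time_gt0 j) gC.

Lemma time_succ j : j.+1%:R * d = j%:R * d + d.
Proof. by rewrite -natr1 mulrDl mul1r. Qed.

Lemma bounded_measurable_heat_potential i : bmeas (heat_potential i) (i%:R * d * C).
Proof.
have size_ord : size (index_enum 'I_i) = i by rewrite [index_enum _]unlock -enumT size_enum_ord.
have := bounded_measurableZ d
  (bounded_measurable_sum (index_enum _) (fun j : 'I_i => heat_time_bmeas j)).
by rewrite (gtr0_norm d_gt0) size_ord mulrCA mulrA.
Qed.

Lemma heat_potential_elipschitz i :
  elipschitz (4 * C * gauss_shift_cst R n * Num.sqrt (i%:R * d)) (heat_potential i).
Proof.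
move=> x y; rewrite -mulrBr -sumrB normrM (gtr0_norm d_gt0).
have q0 : 0 < Num.sqrt d by rewrite sqrtr_gt0.
have dE : d = Num.sqrt d ^+ 2 by rewrite sqr_sqrtr// ltW.
set K := 2 * C * gauss_shift_cst R n * enorm (y - x).
have K0 : 0 <= K by rewrite !mulr_ge0 ?gauss_shift_cst_ge0 ?enorm_ge0.
apply: (@le_trans _ _ (d * \sum_(j < i) K / Num.sqrt d * (Num.sqrt j.+1%:R)^-1)).
  rewrite ler_pM2l//; apply: (le_trans (ler_norm_sum _ _ _)); apply: ler_sum => j _.
  apply: (le_trans (elipschitz_heat lam (time_gt0 j) gC x y)).
  by rewrite sqrtrM ?ler0n// invfM /K le_eqVlt; apply/orP; left; apply/eqP; ring.
rewrite -mulr_sumr sqrtrM ?ler0n//.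
rewrite [leLHS](_ : _ = K * Num.sqrt d * \sum_(j < i) (Num.sqrt j.+1%:R)^-1); last first.
  by rewrite {1}dE; field; rewrite gt_eqF.
rewrite [leRHS](_ : _ = K * Num.sqrt d * (2 * Num.sqrt i%:R)); last by rewrite /K; ring.
by rewrite ler_wpM2l ?sum_inv_sqrt_le// mulr_ge0// ltW.
Qed.

Lemma heat_heat_potential t i x : 0 < t ->
  heat t (heat_potential i) x = d * \sum_(j < i) heat (t + j.+1%:R * d) g x.
Proof.
move=> t0; have sum_bmeas :=
  bounded_measurable_sum (index_enum _) (fun j : 'I_i => heat_time_bmeas j).
rewrite (heatZ lam d x t0 sum_bmeas) (heat_sum lam _ x t0 (fun j : 'I_i => heat_time_bmeas j)).
by congr (_ * _); apply: eq_bigr => j _; rewrite (heat_semigroup lam x t0 (time_gt0 j) gC).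
Qed.

Lemma heat_potentialD i k x : heat_potential (i.+1 + k) x =
  heat_potential i.+1 x + heat (i.+1%:R * d) (heat_potential k) x.
Proof.
rewrite heat_heat_potential// /heat_potential big_split_ord /= mulrDr; congr (_ + _ * _).
by apply: eq_bigr => j _; rewrite -addnS natrD mulrDl.
Qed.

Lemma heat_potential_poisson i x : (0 < i)%N ->
  heat d (heat_potential i) x - heat_potential i x =
  d * heat d (fun y => heat (i%:R * d) g y - g y) x.
Proof.
case: i => // i _; have heat_id := heat_time_bmeas i.
rewrite (heatB lam x d_gt0 heat_id gC).
rewrite (heat_semigroup lam x d_gt0 (time_gt0 i) gC) -[d + _]addrC -time_succ.
have := heat_potentialD 0 i.+1 x; rewrite mul1r => splitD.
rewrite (_ : heat d (heat_potential i.+1) x =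
    heat_potential (1 + i.+1) x - heat_potential 1 x); last by rewrite splitD; ring.
rewrite /heat_potential add1n big_ord_recr big_ord1 /= mul1r.
by move: (\sum_(j < i.+1) _) (heat _ _ _) (heat _ _ _) => S a c; ring.
Qed.

End HeatPotential.

Section PotentialRegularity.
Variables (R : realType) (n : nat).
Local Notation V := 'rV[R]_(n.+1).
Local Notation E := (Rd R n).
Local Notation bmeas := (@bounded_measurable _ E R).
Local Notation gauss_shift_cst := (gauss_shift_cst R n).
Variable lam : lebesgueRd R n.
Local Notation heat := (heat lam).
Implicit Types (x y : V) (i j : nat) (t s A : R).

Lemma heat_diff_le t A (f : V -> R) M x y : 0 < t -> 1 <= A ->
  A * enorm (y - x) <= Num.sqrt t -> bmeas f M -> (forall z, 0 <= f z) ->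
  `|heat t f y - heat t f x| <= gauss_shift_cst * (enorm (y - x) / Num.sqrt t) *
     (A * heat t f x + expR (- (A ^+ 2 / 16)) * M).
Proof.
move=> t0 A1 Ayx fM f0; have t80 : 0 < 8 * t by rewrite mulr_gt0.
have f_tx := RintegrableM_heat_kernel lam x t0 fM.
have f_ty := RintegrableM_heat_kernel lam y t0 fM.
have f_8tx := RintegrableM_heat_kernel lam x t80 fM.
set K := gauss_shift_cst * _; set e := expR _; have e0 : 0 <= e := expR_ge0 _.
have K0 : 0 <= K by rewrite mulr_ge0 ?gauss_shift_cst_ge0 ?divr_ge0 ?enorm_ge0 ?sqrtr_ge0.
apply: (@le_trans _ _ (K * (A * heat t f x + e * heat (8 * t) f x))); last first.
  apply: ler_wpM2l => //; rewrite lerD2l ler_wpM2l//.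
  by rewrite (le_trans (ler_norm _))//; exact: normr_heat_le fM.
have i_t := RintegrableZ A f_tx; have i_8t := RintegrableZ e f_8tx.
have i_sum := RintegrableD i_t i_8t.
rewrite -(RintegralZl A measurableT f_tx) -(RintegralZl e measurableT f_8tx).
rewrite -(RintegralD measurableT i_t i_8t) -(RintegralZl K measurableT i_sum).
rewrite -(RintegralB measurableT f_ty f_tx); apply: normr_Rintegral_le.
- exact: RintegrableB.
- exact: RintegrableZ.
move=> z; have := gauss_density_diff (z - x) t0 A1 Ayx.
rewrite (_ : z - x - (y - x) = z - y) -/K -/e; last by rewrite opprB addrA subrK.
move=> diff_le; rewrite -mulrBr normrM (ger0_norm (f0 z)).
apply: (le_trans (ler_wpM2l (f0 z) diff_le)).
by rewrite le_eqVlt; apply/orP; left; apply/eqP; rewrite /heat_kernel; ring.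
Qed.

Definition discrete_potential d Cv Cw (v w : V -> R) :=
  [/\ bmeas v Cv, forall x, 0 <= v x, bmeas w Cw &
      forall x, heat d v x - v x = d * heat d w x].

Section Constants.
Variables Cv Cw : R.

Definition potential_lip : R := (8 * Cw + 2 * Cv) * gauss_shift_cst + 1.
Definition potential_log_cst : R := gauss_shift_cst * (1 + 5 * Cw + Cv).

Lemma potential_lip_ge1 : 0 <= Cv -> 0 <= Cw -> 1 <= potential_lip.
Proof. by move=> v0 w0; rewrite lerDr mulr_ge0 ?gauss_shift_cst_ge0 ?addr_ge0 ?mulr_ge0. Qed.

End Constants.

Variables (d Cv Cw : R) (v w : V -> R).
Hypotheses (d_gt0 : 0 < d) (pot : discrete_potential d Cv Cw v w).
Local Notation lip := (potential_lip Cv Cw).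
Local Notation log_cst := (potential_log_cst Cv Cw).

Let v_bmeas : bmeas v Cv. Proof. by case: pot. Qed.
Let v_ge0 x : 0 <= v x. Proof. by case: pot. Qed.
Let w_bmeas : bmeas w Cw. Proof. by case: pot. Qed.
Let Cv_ge0 : 0 <= Cv. Proof. exact: bounded_measurable_ge0 v_bmeas 0. Qed.
Let Cw_ge0 : 0 <= Cw. Proof. exact: bounded_measurable_ge0 w_bmeas 0. Qed.
Let time_gt0 j : 0 < j.+1%:R * d. Proof. by rewrite mulr_gt0// ltr0n. Qed.

Lemma potential_iter i x : heat (i.+1%:R * d) v x = v x + heat_potential lam d w i.+1 x.
Proof.
have [_ _ _ poisson] := pot; rewrite /heat_potential; elim: i => [|i ih].
  by rewrite big_ord1 !mul1r -poisson; ring.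
rewrite big_ord_recr /= mulrDr addrA -ih (time_succ d i.+1).
rewrite -(heat_semigroup lam x (time_gt0 i) d_gt0 v_bmeas).
rewrite -(heat_semigroup lam x (time_gt0 i) d_gt0 w_bmeas).
have heat_w := bounded_measurable_heat lam d_gt0 w_bmeas.
have -> : heat d v = fun y => v y + d * heat d w y by apply/funext => y; rewrite -poisson; ring.
rewrite (heatD lam x (time_gt0 i) v_bmeas (bounded_measurableZ d heat_w)).
by rewrite (heatZ lam d x (time_gt0 i) heat_w).
Qed.

Lemma potential_diff i x y : v y - v x =
  (heat (i.+1%:R * d) v y - heat (i.+1%:R * d) v x) -
  (heat_potential lam d w i.+1 y - heat_potential lam d w i.+1 x).
Proof. by rewrite !potential_iter opprD addrACA addrK. Qed.

Lemma potential_diff_le i A x y : 1 <= A ->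
  A * enorm (y - x) <= Num.sqrt (i.+1%:R * d) ->
  `|v y - v x| <=
    gauss_shift_cst * (enorm (y - x) / Num.sqrt (i.+1%:R * d)) *
    (A * (v x + i.+1%:R * d * Cw) + expR (- (A ^+ 2 / 16)) * Cv) +
    4 * Cw * gauss_shift_cst * Num.sqrt (i.+1%:R * d) * enorm (y - x).
Proof.
move=> A1 Ayx; rewrite (potential_diff i) (le_trans (ler_normB _ _))//.
apply: lerD; last exact: heat_potential_elipschitz w_bmeas _ _ _.
apply: (le_trans (heat_diff_le (time_gt0 i) A1 Ayx v_bmeas v_ge0)).
apply: ler_wpM2l.
  by rewrite mulr_ge0 ?gauss_shift_cst_ge0 ?divr_ge0 ?enorm_ge0 ?sqrtr_ge0.
rewrite lerD2r ler_wpM2l ?(le_trans ler01)// potential_iter lerD2l (le_trans (ler_norm _))//.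
exact: (bounded_measurable_heat_potential lam d_gt0 w_bmeas i.+1).2.
Qed.

Lemma potential_elipschitz : d <= 1 -> elipschitz lip v.
Proof.
move=> d1 x y; have [i /andP[t1]] := grid_approx d_gt0 d1; rewrite mulr1.
set t := i.+1%:R * d => t2; have t0 : 0 < t := time_gt0 i.
have q1 : 1 <= Num.sqrt t by rewrite -{1}sqrtr1 ler_wsqrtr.
have q2 : Num.sqrt t <= 2.
  by rewrite -(@ler_sqr R) ?nnegrE ?sqrtr_ge0// sqr_sqrtr ?(ltW t0)//; lra.
have e0 := enorm_ge0 (y - x); have C0 := gauss_shift_cst_ge0 R n.
rewrite (potential_diff i) (le_trans (ler_normB _ _))//.
apply: (@le_trans _ _ (2 * Cv * gauss_shift_cst * enorm (y - x) +
    4 * Cw * gauss_shift_cst * 2 * enorm (y - x))); last first.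
  by rewrite -mulrDl ler_wpM2r// /potential_lip; lra.
apply: lerD.
  apply: (le_trans (elipschitz_heat lam t0 v_bmeas x y)); rewrite ler_wpM2r//.
  by rewrite ler_pdivrMr ?(lt_le_trans ltr01)// ler_peMr// !mulr_ge0.
apply: (le_trans (heat_potential_elipschitz lam d_gt0 w_bmeas i.+1 x y)).
by rewrite ler_wpM2r// ler_wpM2l// !mulr_ge0.
Qed.

Lemma potential_diff_le_scale i A x y : let t := i.+1%:R * d in
  v x <= t -> 1 <= A -> expR (- (A ^+ 2 / 16)) <= t -> A * enorm (y - x) <= Num.sqrt t ->
  `|v y - v x| <= log_cst * enorm (y - x) * Num.sqrt t * A.
Proof.
move=> t vt A1 At Ayx; have t0 : 0 < t := time_gt0 i.
have st0 : 0 < Num.sqrt t by rewrite sqrtr_gt0.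
have C0 := gauss_shift_cst_ge0 R n; have e0 := enorm_ge0 (y - x).
apply: (le_trans (potential_diff_le A1 Ayx)); rewrite -/t.
set st := Num.sqrt t in st0 *; have tE : t = st ^+ 2 by rewrite sqr_sqrtr// ltW.
have scaled_le : A * (v x + t * Cw) + expR (- (A ^+ 2 / 16)) * Cv <=
    t * (A * (1 + Cw) + Cv).
  rewrite [leRHS](_ : _ = A * (t + t * Cw) + t * Cv); last by ring.
  by rewrite lerD ?ler_wpM2r// ler_wpM2l ?(le_trans ler01 A1)// lerD2r.
apply: (@le_trans _ _ (gauss_shift_cst * (enorm (y - x) / st) * (t * (A * (1 + Cw) + Cv)) +
    4 * Cw * gauss_shift_cst * st * enorm (y - x))).
  by rewrite lerD2r ler_wpM2l// mulr_ge0// divr_ge0// ltW.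
rewrite tE /potential_log_cst.
rewrite [leLHS](_ : _ = gauss_shift_cst * enorm (y - x) * st *
  (A * (1 + Cw) + Cv + 4 * Cw)); last by field; rewrite gt_eqF.
rewrite [leRHS](_ : _ = gauss_shift_cst * enorm (y - x) * st *
  ((1 + 5 * Cw + Cv) * A)); last by ring.
rewrite ler_wpM2l ?mulr_ge0 ?(ltW st0)//.
by have := ler_wpM2l Cv_ge0 A1; have := ler_wpM2l Cw_ge0 A1; lra.
Qed.

(* A quadratic log-Lipschitz bound for positive functions with bounded Laplacian:
   run the heat flow for a time [t ~ y], with [A ^+ 2 = 16 * ln t^-1]. *)
Lemma potential_log_lipschitz x x' (y : R) : v x <= y -> d <= y -> y <= 4^-1 ->
  16 * ln y^-1 * sqnorm (x' - x) <= y ->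
  (v x' - v x) ^+ 2 <= 32 * log_cst ^+ 2 * sqnorm (x' - x) * (y * ln y^-1).
Proof.
move=> vy dy y4 xy; have y0 : 0 < y := lt_le_trans d_gt0 dy.
have [i /andP[yt ty]] := grid_approx d_gt0 dy.
set t := i.+1%:R * d in yt ty; have t0 : 0 < t := time_gt0 i.
have ln_t_ge : 2^-1 <= ln t^-1.
  by have := ln_le_subr1 t0; rewrite lnV ?posrE//; lra.
have ln_t_le : ln t^-1 <= ln y^-1 by rewrite ler_ln ?posrE ?invr_gt0// lef_pV2 ?posrE.
pose A := 4 * Num.sqrt (ln t^-1).
have sqrA : A ^+ 2 = 16 * ln t^-1 by rewrite exprMn sqr_sqrtr; lra.
have A1 : 1 <= A by rewrite -(@ler_sqr R) ?nnegrE ?mulr_ge0 ?sqrtr_ge0// sqrA; lra.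
have expA : expR (- (A ^+ 2 / 16)) = t.
  by rewrite sqrA mulrAC divff// mul1r lnV ?posrE// opprK lnK ?posrE.
have Axy : A * enorm (x' - x) <= Num.sqrt t.
  rewrite -(@ler_sqr R) ?nnegrE ?mulr_ge0 ?sqrtr_ge0 ?enorm_ge0//.
  rewrite sqr_sqrtr ?(ltW t0)// exprMn sqr_enorm sqrA; apply: le_trans yt.
  by apply: le_trans xy; rewrite ler_wpM2r ?sqnorm_ge0// ler_pM2l.
have diff_le : `|v x' - v x| <= log_cst * enorm (x' - x) * Num.sqrt t * A.
  by apply: potential_diff_le_scale; rewrite ?expA// (le_trans vy).
rewrite -[leLHS]real_normK ?num_real//.
apply: (@le_trans _ _ ((log_cst * enorm (x' - x) * Num.sqrt t * A) ^+ 2)).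
  by rewrite lerXn2r ?nnegrE// (le_trans (normr_ge0 _) diff_le).
rewrite [leLHS](_ : _ = log_cst ^+ 2 * enorm (x' - x) ^+ 2 * Num.sqrt t ^+ 2 * A ^+ 2);
  last by ring.
rewrite sqr_enorm sqr_sqrtr ?(ltW t0)// sqrA.
have -> : 32 * log_cst ^+ 2 * sqnorm (x' - x) * (y * ln y^-1) =
  16 * log_cst ^+ 2 * sqnorm (x' - x) * (2 * y * ln y^-1) by ring.
rewrite [leLHS](_ : _ = 16 * log_cst ^+ 2 * sqnorm (x' - x) * (t * ln t^-1)); last by ring.
apply: ler_wpM2l; first by rewrite mulr_ge0 ?sqnorm_ge0// mulr_ge0// sqr_ge0.
by apply: ler_pM => //; [exact: ltW|lra].
Qed.

End PotentialRegularity.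

Section KernelPotential.
Variables (R : realType) (n : nat).
Local Notation V := 'rV[R]_(n.+1).
Local Notation E := (Rd R n).
Local Notation bmeas := (@bounded_measurable _ E R).
Variables (lam : lebesgueRd R n) (d t : R).
Hypotheses (d_gt0 : 0 < d) (t_gt0 : 0 < t).
Implicit Types (x y : V) (i j : nat).

Definition kernel_potential i x y : R := d * \sum_(j < i) heat_kernel (t + j.+1%:R * d) x y.

Let time_ge j : t <= t + j%:R * d. Proof. by rewrite lerDl mulr_ge0// ltW. Qed.

Let time_gt0 j : 0 < t + j%:R * d. Proof. exact: lt_le_trans (time_ge j). Qed.

Lemma kernel_potential_ge0 i x y : 0 <= kernel_potential i x y.
Proof.
rewrite mulr_ge0 ?(ltW d_gt0)//; apply: sumr_ge0 => j _.
exact: heat_kernel_ge0 (time_gt0 j.+1).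
Qed.

Lemma mulr_sumr_le_const i (K : R) (f : 'I_i -> R) : (forall k, f k <= K) ->
  d * \sum_(k < i) f k <= i%:R * d * K.
Proof.
move=> fK; rewrite (mulrC i%:R) -mulrA ler_pM2l// mulr_natl.
rewrite -[leRHS](_ : \sum_(j < i) K = _); last by rewrite sumr_const card_ord.
exact: ler_sum.
Qed.

Lemma bounded_measurable_kernel_potential i x :
  bmeas (kernel_potential i x) (i%:R * d * gauss_cst n t).
Proof.
split=> [|y].
  apply: measurable_funM => //; apply: measurable_sum => j.
  exact: measurable_heat_kernel (time_gt0 j.+1).
rewrite ger0_norm ?kernel_potential_ge0//; apply: mulr_sumr_le_const => j.
apply: (le_trans (heat_kernel_le_cst _ _ (time_gt0 j.+1))).
exact: gauss_cst_le t_gt0 (time_ge j.+1).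
Qed.

Lemma kernel_potential_elipschitz i x :
  elipschitz (i%:R * d * (2 * gauss_shift_cst R n * gauss_cst n t / Num.sqrt t))
    (kernel_potential i x).
Proof.
move=> y z; rewrite -mulrBr -sumrB normrM (gtr0_norm d_gt0) -mulrA.
apply: (@le_trans _ _ (d * \sum_(j < i)
    `|heat_kernel (t + j.+1%:R * d) x z - heat_kernel (t + j.+1%:R * d) x y|)).
  by rewrite ler_pM2l// ler_norm_sum.
apply: mulr_sumr_le_const => j.
apply: (le_trans (heat_kernel_elipschitz x (time_gt0 j.+1) y z)).
rewrite ler_wpM2r ?enorm_ge0//; apply: ler_pM.
- by rewrite !mulr_ge0 ?gauss_shift_cst_ge0 ?gauss_cst_ge0.
- by rewrite invr_ge0 sqrtr_ge0.
- by rewrite ler_wpM2l ?mulr_ge0 ?gauss_shift_cst_ge0//; exact: gauss_cst_le (time_ge _).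
- by rewrite lef_pV2 ?posrE ?sqrtr_gt0// ler_wsqrtr.
Qed.

Lemma heat_potential_kernelE (g : V -> R) C i x : bmeas g C ->
  heat lam t (heat_potential lam d g i) x = \int[lam]_y (kernel_potential i x y * g y).
Proof.
move=> gC; have kernel_i (j : 'I_i) := RintegrableM_heat_kernel lam x (time_gt0 j.+1) gC.
rewrite (heat_heat_potential lam d_gt0 gC i x t_gt0) -Rintegral_sum// -RintegralZl//.
- apply: eq_Rintegral => y _; rewrite /kernel_potential -[RHS]mulrA mulr_suml.
  by congr (_ * _); apply: eq_bigr => j _; rewrite mulrC.
- exact: Rintegrable_sum.
Qed.

End KernelPotential.

Section SmallTimeKernel.
Variables (R : realType) (n : nat).
Local Notation V := 'rV[R]_(n.+1).
Implicit Types (x y : V) (s t r d e A : R).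

Lemma heat_kernel_le_sphere s t r x y : 0 < s -> s <= t <= 2 * s -> 0 <= r ->
  r <= enorm (y - x) -> heat_kernel t x y <= doubling_cst R n * gauss_sphere n (2 * s) r.
Proof.
move=> s0 /andP[st ts] r0 far; have t0 : 0 < t := lt_le_trans s0 st.
rewrite /heat_kernel gauss_densityE /gauss_sphere mulrA -gauss_cst_scale//.
apply: ler_pM; [exact: gauss_cst_ge0|exact: expR_ge0|exact: gauss_cst_le|].
rewrite ler_expR mulNr lerN2; apply: ler_pM; first exact: sqr_ge0.
- by rewrite invr_ge0 !mulr_ge0// ltW.
- by rewrite -sqr_enorm ler_sqr ?nnegrE ?enorm_ge0.
- by rewrite lef_pV2 ?posrE ?mulr_gt0// ler_pM2l.
Qed.

Lemma near_right0_mul_gauss_sphere A r e : 0 <= A -> 0 < r -> 0 < e ->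
  \forall d \near 0^'+, A * gauss_sphere n d r <= e.
Proof.
move=> A0 r0 e0; have [C C0 sphere_le] := gauss_sphere_small n r0.
near=> d; have d0 : 0 < d by near: d; exact: nbhs_right_gt.
have d1 : d <= 1 by near: d; exact: nbhs_right_le.
apply: (@le_trans _ _ (A * C * d)); last by near: d; exact: near_right0_mul_le.
rewrite -mulrA ler_wpM2l// (le_trans (sphere_le d _)) ?d0// ler_wpM2l//.
by rewrite expr2 ler_piMr// ltW.
Unshelve. all: by end_near.
Qed.

Lemma gauss_cst_mul_small A e : 0 <= A -> 0 < e ->
  exists2 k, (0 < k)%N & gauss_cst n k%:R * A <= e.
Proof.
move=> A0 e0; have A1 : 0 < A + 1 by rewrite ltr_wpDl.
have [k k_le] := gauss_cst_small n (divr_gt0 e0 A1); exists k.+1 => //.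
apply: le_trans (ler_wpM2r A0 k_le) _.
by rewrite mulrAC ler_pdivrMr// ler_wpM2l ?(ltW e0)// lerDl.
Qed.

End SmallTimeKernel.

Section TruncatedPotential.
Variables (R : realType) (n : nat).
Local Notation V := 'rV[R]_(n.+1).
Local Notation E := (Rd R n).
Local Notation bmeas := (@bounded_measurable _ E R).
Variable lam : lebesgueRd R n.
Local Notation heat := (heat lam).
Implicit Types (x y : V) (v : V -> R).

Section Bregman.
Variable b : R.
Hypotheses (b_gt0 : 0 < b) (b_lt1 : b < 1).

Definition bregman v x y : R :=
  log_trunc b (v y) - log_trunc b (v x) - log_ramp b (v x) * (v y - v x).

Lemma bregman_ge0 v x y : 0 <= bregman v x y.
Proof. by rewrite subr_ge0 log_trunc_subgradient. Qed.

Lemma bregman_le v x y :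
  bregman v x y <= `|log_ramp b (v y) - log_ramp b (v x)| * `|v y - v x|.
Proof.
rewrite -normrM (le_trans _ (ler_norm _))// mulrBl /bregman lerD2r.
exact: log_trunc_le_gradient.
Qed.

Lemma bregman_le0 v x y : log_ramp b (v x) = log_ramp b (v y) -> bregman v x y <= 0.
Proof. by move=> rampE; apply: (le_trans (bregman_le v x y)); rewrite rampE subrr normr0 mul0r. Qed.

Lemma bregman_le_ramp m v x y : 0 < m -> m <= v x -> m <= v y ->
  bregman v x y <= (v y - v x) ^+ 2 / (ln b^-1 * m).
Proof.
move=> m0 mx my; apply: (le_trans (bregman_le v x y)).
rewrite -[X in X / _]real_normK ?num_real// expr2 mulrAC.
by rewrite ler_wpM2r// log_ramp_dist.
Qed.

Variables Cv Cw : R.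
Local Notation lip := (potential_lip n Cv Cw).
Local Notation log_cst := (potential_log_cst n Cv Cw).

(* Within squared distance [bregman_sqradius] the potential stays within
   [b ^+ 2 / 4] and the log-Lipschitz bound applies. *)
Definition bregman_sqradius : R :=
  Num.min ((b ^+ 2 / (4 * lip)) ^+ 2) (b ^+ 2 / (96 * ln b^-1)).
Definition bregman_near_cst : R := 192 * log_cst ^+ 2.
Definition bregman_far_cst : R := lip ^+ 2 / (ln b^-1 * b ^+ 2 * bregman_sqradius).
Definition mean_bregman_cst : R := moment_cst R n 1 * bregman_near_cst + 1.

Hypotheses (Cv_ge0 : 0 <= Cv) (Cw_ge0 : 0 <= Cw).

Let lip_gt0 : 0 < lip. Proof. exact: lt_le_trans (potential_lip_ge1 n Cv_ge0 Cw_ge0). Qed.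
Let ln_gt0 : 0 < ln b^-1. Proof. exact: ln_inv_gt0. Qed.
Let b2_gt0 : 0 < b ^+ 2. Proof. by rewrite exprn_gt0. Qed.

Lemma bregman_sqradius_gt0 : 0 < bregman_sqradius.
Proof. by rewrite lt_min exprn_gt0 divr_gt0 ?mulr_gt0. Qed.

Lemma bregman_near_cst_ge0 : 0 <= bregman_near_cst.
Proof. by apply: mulr_ge0 => //; exact: sqr_ge0. Qed.

Lemma bregman_far_cst_ge0 : 0 <= bregman_far_cst.
Proof. by rewrite divr_ge0 ?sqr_ge0// ltW// !mulr_gt0// bregman_sqradius_gt0. Qed.

Lemma mean_bregman_cst_ge0 : 0 <= mean_bregman_cst.
Proof. by rewrite addr_ge0// mulr_ge0 ?moment_cst_ge0 ?bregman_near_cst_ge0. Qed.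

End Bregman.

Variables (d Cv Cw : R) (v w : V -> R).
Hypotheses (d_gt0 : 0 < d) (d_le1 : d <= 1) (pot : discrete_potential lam d Cv Cw v w).
Variable b : R.
Hypotheses (b_gt0 : 0 < b) (b_le8 : b <= 8^-1).
Local Notation lip := (potential_lip n Cv Cw).
Local Notation log_cst := (potential_log_cst n Cv Cw).
Local Notation sqradius := (bregman_sqradius b Cv Cw).
Local Notation near_cst := (bregman_near_cst Cv Cw).
Local Notation far_cst := (bregman_far_cst b Cv Cw).

Let v_bmeas : bmeas v Cv. Proof. by case: pot. Qed.
Let v_ge0 x : 0 <= v x. Proof. by case: pot. Qed.
Let Cv_ge0 : 0 <= Cv. Proof. exact: bounded_measurable_ge0 v_bmeas 0. Qed.
Let Cw_ge0 : 0 <= Cw. Proof. by case: pot => _ _ wb _; exact: bounded_measurable_ge0 wb 0. Qed.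
Let lip_gt0 : 0 < lip. Proof. exact: lt_le_trans (potential_lip_ge1 n Cv_ge0 Cw_ge0). Qed.
Let v_lip : elipschitz lip v. Proof. exact: potential_elipschitz d_gt0 pot d_le1. Qed.
Let b_lt1 : b < 1. Proof. by apply: (le_lt_trans b_le8); lra. Qed.
Let ln_gt0 : 0 < ln b^-1. Proof. exact: ln_inv_gt0. Qed.
Let b2_gt0 : 0 < b ^+ 2. Proof. by rewrite exprn_gt0. Qed.

Lemma bregman_far x y :
  bregman b v x y <= lip ^+ 2 * sqnorm (y - x) / (ln b^-1 * b ^+ 2).
Proof.
apply: (le_trans (bregman_le b_gt0 b_lt1 v x y)).
apply: (@le_trans _ _ (`|v y - v x| ^+ 2 / (ln b^-1 * b ^+ 2))).
  by rewrite expr2 mulrAC ler_wpM2r// log_ramp_lipschitz.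
apply: ler_wpM2r; first by rewrite invr_ge0 mulr_ge0// ltW.
rewrite -sqr_enorm -exprMn lerXn2r ?nnegrE//.
by rewrite mulr_ge0 ?enorm_ge0// ltW.
Qed.

Lemma potential_near x y : sqnorm (y - x) <= sqradius -> `|v y - v x| <= b ^+ 2 / 4.
Proof.
rewrite le_min => /andP[+ _]; rewrite sqnorm_le_sqr; last first.
  by rewrite divr_ge0 ?mulr_ge0// ltW.
move=> yx; apply: (le_trans (v_lip x y)); rewrite mulrC -ler_pdivlMr//.
by apply: (le_trans yx); rewrite invfM mulrA.
Qed.

Lemma bregman_mid x y : d <= b ^+ 2 / 2 -> sqnorm (y - x) <= sqradius ->
  b ^+ 2 / 2 < v x < 2 * b -> bregman b v x y <= near_cst * sqnorm (y - x).
Proof.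
move=> db yx /andP[v_gt v_lt]; have b8 := b_le8.
have dist := potential_near yx; move: dist; rewrite ler_norml => /andP[dist _].
have vx0 : 0 < v x by apply: le_lt_trans v_gt; rewrite divr_ge0// ltW.
have ln_v_le : ln (v x)^-1 <= 3 * ln b^-1.
  rewrite mulr_natl -lnXn ?invr_gt0// ler_ln ?posrE ?exprn_gt0 ?invr_gt0//.
  rewrite exprVn lef_pV2 ?posrE ?exprn_gt0//.
  by apply: le_trans (ltW v_gt); rewrite exprS; have := b2_gt0; nra.
have q0 := sqnorm_ge0 (y - x).
have scale : 16 * ln (v x)^-1 * sqnorm (y - x) <= v x.
  apply: le_trans (ltW v_gt); have : sqnorm (y - x) <= b ^+ 2 / (96 * ln b^-1).
    by apply: (le_trans yx); rewrite ge_min lexx orbT.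
  rewrite ler_pdivlMr ?mulr_gt0// => radius_le.
  by have := ler_wpM2r q0 ln_v_le; lra.
have dv : d <= v x by rewrite (le_trans db)// ltW.
have v4 : v x <= 4^-1 by lra.
have half_gt0 : 0 < v x / 2 by rewrite divr_gt0.
have half_le : v x / 2 <= v x by lra.
have half_le' : v x / 2 <= v y by lra.
apply: (le_trans (bregman_le_ramp b_gt0 b_lt1 half_gt0 half_le half_le')).
rewrite ler_pdivrMr ?mulr_gt0//.
apply: (le_trans (potential_log_lipschitz d_gt0 pot (lexx (v x)) dv v4 scale)).
rewrite /bregman_near_cst.
rewrite [leLHS](_ : _ = 32 * log_cst ^+ 2 * sqnorm (y - x) * v x * ln (v x)^-1); last by ring.
rewrite [leRHS](_ : _ = 32 * log_cst ^+ 2 * sqnorm (y - x) * v x * (3 * ln b^-1)); last by field.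
apply: ler_wpM2l => //; apply: mulr_ge0; last exact: ltW.
by rewrite mulr_ge0// mulr_ge0// sqr_ge0.
Qed.

Lemma bregman_near x y : d <= b ^+ 2 / 2 -> sqnorm (y - x) <= sqradius ->
  bregman b v x y <= near_cst * sqnorm (y - x).
Proof.
move=> db yx.
have near_ge0 : 0 <= near_cst * sqnorm (y - x).
  by rewrite mulr_ge0 ?bregman_near_cst_ge0 ?sqnorm_ge0.
have b8 := b_le8; have b0 := b_gt0.
have dist := potential_near yx; move: dist; rewrite ler_norml => /andP[dist_lo dist_up].
have b2_le : b ^+ 2 <= b / 8 by rewrite expr2; nra.
have [v_le|v_gt] := leP (v x) (b ^+ 2 / 2).
  by apply: le_trans near_ge0; apply: bregman_le0 => //; rewrite !log_ramp_eq0//; lra.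
have [v_ge|v_lt] := leP (2 * b) (v x); last by apply: bregman_mid; rewrite ?v_gt.
by apply: le_trans near_ge0; apply: bregman_le0 => //; rewrite !log_ramp_eq1//; lra.
Qed.

Lemma bregman_le_moments x y : d <= b ^+ 2 / 2 ->
  bregman b v x y <= near_cst * sqnorm (y - x) + far_cst * sqnorm (y - x) ^+ 2.
Proof.
move=> db; have q0 := sqnorm_ge0 (y - x).
have r0 := bregman_sqradius_gt0 b_gt0 b_lt1 Cv_ge0 Cw_ge0.
have far0 := bregman_far_cst_ge0 b_gt0 b_lt1 Cv_ge0 Cw_ge0.
have [yx|/ltW yx] := leP (sqnorm (y - x)) sqradius.
  by rewrite (le_trans (bregman_near db yx))// lerDl mulr_ge0// sqr_ge0.
apply: (le_trans (bregman_far x y)).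
apply: (@le_trans _ _ (far_cst * sqnorm (y - x) ^+ 2)); last first.
  by rewrite lerDr mulr_ge0// bregman_near_cst_ge0.
rewrite [leLHS](_ : _ = far_cst * (sqradius * sqnorm (y - x))).
  by rewrite ler_wpM2l// expr2 ler_wpM2r.
by rewrite /bregman_far_cst; field; rewrite !gt_eqF.
Qed.

Definition mean_bregman x : R := \int[lam]_y (bregman b v x y * heat_kernel d x y).

Lemma bounded_measurable_log_trunc : bmeas (fun x => log_trunc b (v x)) Cv.
Proof.
split; first exact: (measurableT_comp (measurable_log_trunc b) v_bmeas.1).
move=> x; rewrite ger0_norm ?log_trunc_ge0// (le_trans (log_trunc_le_id b_gt0 b_lt1 (v_ge0 x)))//.
by rewrite (le_trans (ler_norm _))//; exact: v_bmeas.2.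
Qed.

Lemma bregman_heat_kernelE x : (fun y => bregman b v x y * heat_kernel d x y) =
  (fun y => (log_trunc b (v y) * heat_kernel d x y - log_trunc b (v x) * heat_kernel d x y)
    - log_ramp b (v x) * (v y * heat_kernel d x y - v x * heat_kernel d x y)).
Proof. by apply/funext => y; rewrite /bregman; ring. Qed.

Lemma Rintegrable_bregman x : Rintegrable lam (fun y => bregman b v x y * heat_kernel d x y).
Proof.
have kernel_i := Rintegrable_heat_kernel lam x d_gt0.
rewrite bregman_heat_kernelE; apply: RintegrableB; last apply: RintegrableZ;
  apply: RintegrableB; do 1?exact: RintegrableZ.
- exact: RintegrableM_heat_kernel bounded_measurable_log_trunc.
- exact: RintegrableM_heat_kernel v_bmeas.
Qed.

Lemma mean_bregmanE x : mean_bregman x =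
  heat d (fun y => log_trunc b (v y)) x - log_trunc b (v x) -
  log_ramp b (v x) * (d * heat d w x).
Proof.
have [_ _ _ poisson] := pot; rewrite -poisson /mean_bregman bregman_heat_kernelE.
have kernel_i := Rintegrable_heat_kernel lam x d_gt0.
have v_i := RintegrableM_heat_kernel lam x d_gt0 v_bmeas.
have trunc_i := RintegrableM_heat_kernel lam x d_gt0 bounded_measurable_log_trunc.
have trunc_x := RintegrableZ (log_trunc b (v x)) kernel_i.
have vx_i := RintegrableZ (v x) kernel_i.
have v_diff := RintegrableB v_i vx_i.
rewrite (RintegralB measurableT (RintegrableB trunc_i trunc_x)); last exact: RintegrableZ.
rewrite (RintegralB measurableT trunc_i trunc_x) (RintegralZl _ measurableT v_diff).
by rewrite (RintegralB measurableT v_i vx_i) !RintegralZ_heat_kernel.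
Qed.

Lemma mean_bregman_ge0 x : 0 <= mean_bregman x.
Proof. by apply: Rintegral_ge0 => y _; rewrite mulr_ge0 ?bregman_ge0 ?heat_kernel_ge0. Qed.

Lemma mean_bregman_le x : d <= b ^+ 2 / 2 -> moment_cst R n 2 * far_cst * d <= 1 ->
  mean_bregman x <= mean_bregman_cst Cv Cw * d.
Proof.
move=> db d_far.
have m1 := Rintegrable_moment lam 1 x d_gt0; have m2 := Rintegrable_moment lam 2 x d_gt0.
have near0 := bregman_near_cst_ge0 Cv Cw.
have far0 := bregman_far_cst_ge0 b_gt0 b_lt1 Cv_ge0 Cw_ge0.
apply: (@le_trans _ _ (\int[lam]_y (near_cst * (sqnorm (y - x) ^+ 1 * heat_kernel d x y) +
    far_cst * (sqnorm (y - x) ^+ 2 * heat_kernel d x y)))).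
  apply: le_Rintegral => //; first exact: Rintegrable_bregman.
    by apply: RintegrableD; exact: RintegrableZ.
  move=> y _; rewrite [near_cst * _]mulrA [far_cst * _]mulrA -mulrDl expr1 ler_wpM2r ?heat_kernel_ge0//.
  exact: bregman_le_moments.
rewrite RintegralD//; [|exact: RintegrableZ..].
rewrite (RintegralZl near_cst measurableT m1) (RintegralZl far_cst measurableT m2).
rewrite /mean_bregman_cst mulrDl mul1r; apply: lerD.
  rewrite [leRHS]mulrAC [leRHS]mulrC ler_wpM2l//.
  by have := Rintegral_moment lam 1 x d_gt0; rewrite [d ^+ 1]expr1.
apply: (@le_trans _ _ (moment_cst R n 2 * far_cst * d * d)); last first.
  by rewrite ler_piMl// ltW.
rewrite [leRHS](_ : _ = far_cst * (moment_cst R n 2 * d ^+ 2)); last by ring.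
by rewrite ler_wpM2l// Rintegral_moment.
Qed.

End TruncatedPotential.

(** * Superharmonic functions *)

Section Staircase.
Variable R : realType.
Implicit Types (p g s : R) (N : nat) (below : nat -> bool).

Lemma threshold_count N s below : (forall i, below i -> i%:R <= s) ->
    (forall i, ~~ below i -> s <= i%:R) -> 0 <= s ->
  \sum_(i < N) (below i)%:R <= s + 1 /\
  (s <= N%:R -> s <= \sum_(i < N) (below i)%:R).
Proof.
move=> below_le above_ge s0; elim: N => [|N [count_le count_ge]].
  by rewrite big_ord0; split; lra.
rewrite big_ord_recr /=; have [bN|aN] := boolP (below N); last first.
  by rewrite addr0; split => // _; exact/count_ge/above_ge.
have Ns := below_le _ bN.
have -> : \sum_(i < N) (below i)%:R = N%:R :> R.
  rewrite -[RHS](_ : \sum_(i < N) 1 = _); last by rewrite sumr_const card_ord.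
  apply: eq_bigr => i _; suff -> : below i by [].
  apply: contraT => /above_ge si; have : N%:R <= i%:R :> R := le_trans Ns si.
  by rewrite ler_nat leqNgt ltn_ord.
by rewrite natr1 -natr1; split => //; rewrite lerD2r.
Qed.

Lemma staircase_approx p g : 0 < p -> p < g -> exists (M : nat) (h : R),
  [/\ 0 < h, forall i, (i < M)%N -> p <= p + i%:R * h < g,
      forall s, 0 < s <= g -> `|s - \sum_(i < M) h * (p + i%:R * h <= s)%R%:R| <= 2 * p &
      forall s, s < p -> \sum_(i < M) h * (p + i%:R * h <= s)%R%:R = 0].
Proof.
move=> p0 pg; pose M := (Num.truncn ((g - p) / p)).+1.
have M0 : 0 < M%:R :> R by rewrite ltr0n.
pose h := (g - p) / M%:R; have h0 : 0 < h by rewrite divr_gt0// subr_gt0.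
have hp : h <= p.
  by rewrite ler_pdivrMr// mulrC -ler_pdivrMr// ltW// truncnS_gt.
have hM : h * M%:R = g - p by rewrite divfK// gt_eqF.
have below_level s : s < p -> \sum_(i < M) h * (p + i%:R * h <= s)%R%:R = 0.
  move=> sp; apply: big1 => i _; suff -> : (p + i%:R * h <= s) = false by rewrite mulr0.
  by apply/negbTE; rewrite -ltNge (lt_le_trans sp)// lerDl mulr_ge0// ltW.
exists M, h; split => //.
  move=> i iM; rewrite lerDl mulr_ge0 ?(ltW h0)//= mulrC.
  by have : h * i%:R < h * M%:R by [rewrite ltr_pM2l// ltr_nat]; rewrite hM; lra.
move=> s /andP[s0 sg]; have [sp|ps] := ltP s p.
  by rewrite below_level// subr0 gtr0_norm//; lra.
pose q := (s - p) / h; have q0 : 0 <= q by rewrite divr_ge0 ?subr_ge0// ltW.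
have levelE i : (p + i%:R * h <= s) = (i%:R <= q) by rewrite ler_pdivlMr// lerBrDl.
have above_q i : ~~ (i%:R <= q) -> q <= i%:R by rewrite -ltNge => /ltW.
have [count_le count_ge] := threshold_count M (fun i => id) above_q q0.
under eq_bigr do rewrite levelE; rewrite -mulr_sumr.
have qM : q <= M%:R by rewrite ler_pdivrMr// mulrC hM lerD2r.
have sE : s = p + q * h by rewrite divfK ?gt_eqF// subrKC.
move: count_le (count_ge qM); set C := \sum_(i < M) _ => C_le C_ge.
by rewrite sE ler_norml; apply/andP; split; nra.
Qed.

End Staircase.

Section KernelStaircase.
Variables (R : realType) (n : nat).
Local Notation V := 'rV[R]_(n.+1).
Implicit Types (x y : V) (t r l h : R) (M : nat).

Definition ball_staircase x M h (rad : nat -> R) y : R :=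
  \sum_(i < M) h * \1_(cball_e x (rad i)) y.

Lemma heat_kernel_superlevel t r l x : 0 < t -> 0 < r ->
  gauss_sphere n t r <= l -> l < gauss_cst n t ->
  exists2 s, 0 < s <= r & [set y | l <= heat_kernel t x y] = cball_e x s.
Proof.
move=> t0 r0 pl lg; have g0 := gauss_cst_gt0 n t0.
have l0 : 0 < l := lt_le_trans (gauss_sphere_gt0 n r t0) pl.
have q0 : 0 < 2 * t * ln (gauss_cst n t / l).
  by rewrite mulr_gt0 ?mulr_gt0// ln_gt0// ltr_pdivlMr// mul1r.
have level_le a : (l <= gauss_cst n t * expR a) = (ln l - ln (gauss_cst n t) <= a).
  have -> : gauss_cst n t * expR a = expR (ln (gauss_cst n t) + a) by rewrite expRD lnK ?posrE.
  by rewrite -{1}[l]lnK ?posrE// ler_expR lerBlDl.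
exists (Num.sqrt (2 * t * ln (gauss_cst n t / l))).
  rewrite sqrtr_gt0 q0 /= -[leRHS](ger0_norm (ltW r0)) -sqrtr_sqr ler_wsqrtr//.
  rewrite mulrC -ler_pdivlMr ?mulr_gt0//.
  rewrite -[leRHS]expRK -ler_expR expRK lnK ?posrE ?divr_gt0//.
  rewrite ler_pdivrMr// -[X in _ <= X * _]invrK -expRN mulrC ler_pdivlMr ?expR_gt0//.
apply/seteqP; split=> y; rewrite /cball_e /= sqr_sqrtr ?(ltW q0)//
  /heat_kernel gauss_densityE level_le ln_div ?posrE// mulNr lerNr ler_pdivrMr ?mulr_gt0//; lra.
Qed.

(* Superlevel sets of the Gaussian kernel are balls, so a layer-cake staircase
   turns the mean value inequality on balls into one for the kernel. *)
Lemma heat_kernel_staircase t r x : 0 < t -> 0 < r -> exists M h rad,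
  [/\ 0 < h, forall i, (i < M)%N -> 0 < rad i <= r,
      forall y, `|heat_kernel t x y - ball_staircase x M h rad y| <= 2 * gauss_sphere n t r &
      forall y, ~ cball_e x r y -> ball_staircase x M h rad y = 0].
Proof.
move=> t0 r0; set p := gauss_sphere n t r.
have p0 : 0 < p := gauss_sphere_gt0 n r t0.
have [M [h [h0 levels approx below]]] := staircase_approx p0 (gauss_sphere_lt_cst n t0 r0).
have /choice[rad radP] : forall i, exists s, (i < M)%N ->
    0 < s <= r /\ [set y | p + i%:R * h <= heat_kernel t x y] = cball_e x s.
  move=> i; have [iM|_] := boolP (i < M)%N; last by exists 0.
  have /andP[pl lg] := levels i iM.
  by have [s sr sE] := heat_kernel_superlevel x t0 r0 pl lg; exists s.
have stairE y : ball_staircase x M h rad y =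
    \sum_(i < M) h * (p + i%:R * h <= heat_kernel t x y)%R%:R.
  apply: eq_bigr => i _; have [_ <-] := radP i (ltn_ord i).
  by rewrite indicE mem_setE.
exists M, h, rad; split => //.
- by move=> i /radP[].
- by move=> y; rewrite stairE; apply: approx; rewrite heat_kernel_gt0 ?heat_kernel_le_cst.
- move=> y yB; rewrite stairE below// /p /gauss_sphere /heat_kernel gauss_densityE.
  rewrite ltr_pM2l ?gauss_cst_gt0// ltr_expR mulNr ltrN2 ltr_pM2r ?invr_gt0 ?mulr_gt0//.
  by rewrite ltNge; apply/negP => yr; exact: yB.
Qed.

End KernelStaircase.

Section Superharmonic.
Variables (R : realType) (n : nat).
Local Notation V := 'rV[R]_(n.+1).
Local Notation E := (Rd R n).
Local Notation bmeas := (@bounded_measurable _ E R).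
Variables (lam : lebesgueRd R n) (U : set V) (psi : V -> \bar R).
Hypotheses (oU : open U) (psi_int : lam.-integrable (U : set E) psi).
Implicit Types (x y : V) (t r h M : R) (F : V -> R).

(* The value is 0 where [psi] is infinite, and off [U]. *)
Definition real_ext : V -> R := fine \o (psi \_ U).
Local Notation psi_norm := (\int[lam]_y `|real_ext y|).

Let mU : measurable (U : set E). Proof. exact: measurable_open. Qed.

Lemma real_ext_out x : ~ U x -> real_ext x = 0.
Proof. by move=> Ux; rewrite /real_ext /= patchN// notin_setE. Qed.

Lemma real_ext_in x : U x -> real_ext x = fine (psi x).
Proof. by move=> Ux; rewrite /real_ext /= patchT// inE. Qed.

Lemma real_extK x : U x -> psi x \is a fin_num -> (real_ext x)%:E = psi x.
Proof. by move=> Ux fx; rewrite real_ext_in// fineK. Qed.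

Lemma Rintegrable_real_ext : Rintegrable lam real_ext.
Proof.
have psiU_i : lam.-integrable setT ((psi : E -> \bar R) \_ (U : set E)).
  exact/(integrable_mkcond (psi : E -> \bar R) mU).
apply: (le_integrable measurableT _ _ psiU_i).
  apply/measurable_EFinP; apply: (measurableT_comp (fine_measurable measurableT)).
  exact: measurable_int psiU_i.
by move=> x _ /=; rewrite /real_ext /=; case: ((psi \_ U) x) => [r| |] //=;
  rewrite normr0 leey.
Qed.

Lemma ae_fin_num_psi : {ae lam, forall x, U x -> psi x \is a fin_num}.
Proof. exact: (@integrable_ae _ E R lam U mU psi psi_int). Qed.

Hypotheses (lamU : (lam U < +oo)%E) (psi_sh : superharmonic_in lam U psi).

Let ext_i : Rintegrable lam real_ext. Proof. exact: Rintegrable_real_ext. Qed.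

Lemma sub_measure_lty (B : set V) : measurable (B : set E) -> B `<=` U -> (lam B < +oo)%E.
Proof. by move=> mB BU; apply: le_lt_trans lamU; apply: le_measure; rewrite ?inE. Qed.

Lemma ball_mean_le x r : U x -> psi x \is a fin_num -> 0 < r -> cball_e x r `<=` U ->
  \int[lam]_y (real_ext y * \1_(cball_e x r) y) <= real_ext x * fine (lam (cball_e x r)).
Proof.
move=> Ux fx r0 BU; have [_ _ /(_ x r Ux r0 BU)] := psi_sh.
set B := cball_e x r; have mB : measurable (B : set E) := measurable_cball x r.
have B_gt0 : 0 < fine (lam B).
  by rewrite fine_gt0// (lebesgue_cball_gt0 (lebesgueRdP lam) x r0) sub_measure_lty.
have -> : (\int[lam]_(y in (B : set E)) psi y = \int[lam]_(y in (B : set E)) (real_ext y)%:E)%E.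
  apply: ae_eq_integral => //.
  - exact: measurable_int (integrableS mU mB BU psi_int).
  - by apply/measurable_EFinP; apply: measurable_funTS; exact: Rintegrable_measurable ext_i.
  - apply: (ae_sub ae_fin_num_psi) => y fy By.
    by rewrite real_extK//; [exact: BU|exact/fy/BU].
rewrite (integral_EFin_indic mB ext_i) -(real_extK Ux fx) -EFinM lee_fin.
by rewrite ler_pdivrMl// mulrC.
Qed.

Section BallStaircase.
Variables (x : V) (M : nat) (h : R) (rad : nat -> R).
Hypotheses (h_ge0 : 0 <= h) (radU : forall i, (i < M)%N ->
  0 < rad i /\ cball_e x (rad i) `<=` U).
Local Notation stair := (ball_staircase x M h rad).

Let ball_i (i : 'I_M) : Rintegrable lam \1_(cball_e x (rad i)).
Proof.
have [_ BU] := radU (ltn_ord i); have mB := measurable_cball x (rad i).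
by apply: Rintegrable_indic => //; exact: sub_measure_lty.
Qed.

Lemma Rintegrable_ball_staircase : Rintegrable lam stair.
Proof. by apply: Rintegrable_sum => i; exact: RintegrableZ. Qed.

Lemma ball_staircase_mean_le : U x -> psi x \is a fin_num ->
  \int[lam]_y (real_ext y * stair y) <= real_ext x * \int[lam]_y stair y.
Proof.
move=> Ux fx; have extB_i (i : 'I_M) :=
  RintegrableM ext_i (bounded_measurable_indic R (measurable_cball x (rad i))).
have -> : \int[lam]_y (real_ext y * stair y) =
    \int[lam]_y (\sum_(i < M) h * (real_ext y * \1_(cball_e x (rad i)) y)).
  by apply: eq_Rintegral => y _; rewrite mulr_sumr; apply: eq_bigr => i _; rewrite mulrCA.
rewrite !Rintegral_sum; [|by move=> i; exact: RintegrableZ..].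
rewrite mulr_sumr; apply: ler_sum => i _.
rewrite (RintegralZl h measurableT (extB_i i)) (RintegralZl h measurableT (ball_i i)).
rewrite Rintegral_indic; last exact: measurable_cball.
rewrite mulrCA ler_wpM2l//; have [r0 BU] := radU (ltn_ord i).
exact: ball_mean_le.
Qed.

Lemma ball_staircase_mass t r e : 0 < t -> 0 < r -> 0 <= e -> cball_e x r `<=` U ->
  (forall y, `|heat_kernel t x y - stair y| <= e) ->
  (forall y, ~ cball_e x r y -> stair y = 0) ->
  `|1 - \int[lam]_y stair y| <= e * fine (lam U) + heat_tail n t r.
Proof.
move=> t0 r0 e0 BU approx stair_out.
have kernel_i := Rintegrable_heat_kernel lam x t0.
have tail_i := Rintegrable_tail_weight lam r x t0.
have mB := measurable_cball x r; have B_fin := sub_measure_lty mB BU.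
have B_i := Rintegrable_indic mB B_fin.
rewrite -{1}(Rintegral_heat_kernel lam x t0).
rewrite -(RintegralB measurableT kernel_i Rintegrable_ball_staircase).
apply: (@le_trans _ _ (\int[lam]_y (e * \1_(cball_e x r) y + tail_weight t r x y))).
  apply: normr_Rintegral_le.
  - exact: RintegrableB Rintegrable_ball_staircase.
  - by apply: RintegrableD => //; exact: RintegrableZ.
  move=> y; have w0 := tail_weight_ge0 r x y t0.
  rewrite indicE; have [yB|yB] := pselect (cball_e x r y).
    by rewrite mem_set// mulr1 (le_trans (approx y))// lerDl.
  rewrite memNset// mulr0 add0r stair_out// subr0 ger0_norm ?heat_kernel_ge0//.
  exact: heat_kernel_le_tail_weight.
rewrite RintegralD//; last exact: RintegrableZ.
rewrite (RintegralZl e measurableT B_i) Rintegral_indic//; apply: lerD; last first.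
  exact: Rintegral_tail_weight.
apply: ler_wpM2l => //; apply: fine_le; rewrite ?ge0_fin_numE//.
by apply: le_measure; rewrite ?inE.
Qed.

End BallStaircase.

Lemma heat_real_ext_le t r x : 0 < t -> 0 < r -> psi x \is a fin_num ->
  cball_e x r `<=` U ->
  heat lam t real_ext x - real_ext x <=
    2 * gauss_sphere n t r * (psi_norm + `|real_ext x| * fine (lam U)) +
    `|real_ext x| * heat_tail n t r.
Proof.
move=> t0 r0 fx BU; have Ux : U x := BU _ (cball_e_center x r).
have [M [h [rad [h0 rad_le approx stair_out]]]] := heat_kernel_staircase x t0 r0.
set e := 2 * gauss_sphere n t r in approx *.
have e0 : 0 <= e by rewrite mulr_ge0// ltW// gauss_sphere_gt0.
have radU i : (i < M)%N -> 0 < rad i /\ cball_e x (rad i) `<=` U.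
  move=> /rad_le /andP[ri0 ri]; split => //.
  by apply: subset_trans BU; apply: sub_cball; rewrite (ltW ri0).
set stair := ball_staircase x M h rad in approx stair_out *.
have stair_i : Rintegrable lam stair := Rintegrable_ball_staircase h radU.
have diff_bmeas : bmeas (fun y => heat_kernel t x y - stair y) e.
  split => //; apply: measurable_funB; first exact: measurable_heat_kernel.
  exact: Rintegrable_measurable stair_i.
have kernel_bmeas := bounded_measurable_heat_kernel x t0.
have ext_k := RintegrableM ext_i kernel_bmeas.
have ext_diff := RintegrableM ext_i diff_bmeas.
have split_kernel : heat lam t real_ext x =
    \int[lam]_y (real_ext y * (heat_kernel t x y - stair y)) +
    \int[lam]_y (real_ext y * stair y).
  have ext_stair : Rintegrable lam (fun y => real_ext y * stair y).
    have := RintegrableB ext_k ext_diff; congr (Rintegrable lam).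
    by apply/funext => y; ring.
  rewrite -(RintegralD measurableT ext_diff ext_stair).
  by apply: eq_Rintegral => y _; rewrite -mulrDr subrK.
have diff_le : \int[lam]_y (real_ext y * (heat_kernel t x y - stair y)) <= e * psi_norm.
  exact: le_trans (ler_norm _) (normr_RintegralM_le ext_i diff_bmeas).
have mean_le := ball_staircase_mean_le (ltW h0) radU Ux fx.
have mass_le : real_ext x * \int[lam]_y stair y - real_ext x <=
    `|real_ext x| * (e * fine (lam U) + heat_tail n t r).
  rewrite -{2}[real_ext x]mulr1 -mulrBr (le_trans (ler_norm _))// normrM ler_wpM2l// distrC.
  exact: ball_staircase_mass.
rewrite split_kernel; move: diff_le mean_le mass_le; rewrite -/stair.
move: (\int[lam]_y _) (\int[lam]_y _) (\int[lam]_y _) (\int[lam]_y _) => a1 a2 a3 a4; lra.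
Qed.

Lemma heat_superharmonic_le t r M F : 0 < t -> 0 < r -> bmeas F M ->
  (forall x, 0 <= F x) -> (forall x, F x != 0 -> cball_e x r `<=` U) ->
  \int[lam]_x (real_ext x * (heat lam t F x - F x)) <=
  M * (psi_norm * (4 * gauss_sphere n t r * fine (lam U) + heat_tail n t r)).
Proof.
move=> t0 r0 FM F0 FU; rewrite (heat_defect_adjoint t0 ext_i FM).
set p := gauss_sphere n t r; set LU := fine (lam U); set tail := heat_tail n t r.
have p0 : 0 <= p := ltW (gauss_sphere_gt0 n r t0).
have LU0 : 0 <= LU by exact: fine_ge0.
have tail0 : 0 <= tail := heat_tail_ge0 n t r.
have norm0 : 0 <= psi_norm by apply: Rintegral_ge0.
have norm_i := Rintegrable_norm ext_i; have U_i := Rintegrable_indic mU lamU.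
pose majorant x := 2 * p * psi_norm * \1_U x + (2 * p * LU + tail) * `|real_ext x|.
have majorant_i : Rintegrable lam majorant by apply: RintegrableD; exact: RintegrableZ.
have -> : M * (psi_norm * (4 * p * LU + tail)) = \int[lam]_x (M * majorant x).
  rewrite (RintegralZl M measurableT majorant_i).
  rewrite (RintegralD measurableT (RintegrableZ _ U_i) (RintegrableZ _ norm_i)).
  rewrite (RintegralZl _ measurableT U_i) (RintegralZl _ measurableT norm_i) Rintegral_indic//.
  by move: psi_norm => N; rewrite -/LU; ring.
apply: ae_le_Rintegral; last 2 first.
- exact: RintegrableZ.
- apply: (ae_sub ae_fin_num_psi) => x fx.
  have indic_coef0 : 0 <= 2 * p * psi_norm by rewrite mulr_ge0// mulr_ge0.
  have norm_coef0 : 0 <= 2 * p * LU + tail by rewrite addr_ge0// mulr_ge0// mulr_ge0.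
  have maj0 : 0 <= majorant x by apply: addr_ge0; apply: mulr_ge0.
  have M0 : 0 <= M := bounded_measurable_ge0 FM x.
  have [Fx|Fx] := eqVneq (F x) 0; first by rewrite Fx mul0r mulr_ge0.
  have BU := FU _ Fx; have Ux : U x := BU _ (cball_e_center x r).
  apply: (@le_trans _ _ (F x * majorant x)); last first.
    by rewrite ler_wpM2r// (le_trans (ler_norm _))//; exact: FM.2.
  apply: ler_wpM2l => //; apply: (le_trans (heat_real_ext_le t0 r0 (fx Ux) BU)).
  rewrite -/p -/LU -/tail /majorant indicE mem_set// mulr1.
  by move: psi_norm `|_| => N a; lra.
- have heat_i := Rintegrable_heat t0 ext_i.
  have diff_i := RintegrableB heat_i ext_i.
  by under eq_fun do rewrite mulrC; exact: RintegrableM diff_i FM.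
Qed.

End Superharmonic.

Section L1Continuity.
Variables (R : realType) (n : nat).
Local Notation V := 'rV[R]_(n.+1).
Local Notation E := (Rd R n).
Local Notation bmeas := (@bounded_measurable _ E R).
Variable lam : lebesgueRd R n.
Local Notation heat := (heat lam).
Local Notation Rintegrable := (Rintegrable lam).
Implicit Types (x y : V) (t r c e M : R) (f g : V -> R) (O : set V).

Lemma cvg0_harmonic (C : R) (u : nat -> R) :
  (\forall k \near \oo, 0 <= u k <= C * k.+1%:R^-1) -> u @ \oo --> (0 : R).
Proof.
move=> uC; apply: (@squeeze_cvgr _ _ _ _ (fun=> 0) (fun k => C * harmonic k) u) => //.
  exact: cvg_cst.
rewrite -[X in _ --> X](mulr0 C); apply: cvgMl_tmp; exact: cvg_harmonic.
Qed.

Lemma heat_L1D t f g x : 0 < t -> Rintegrable f -> Rintegrable g ->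
  heat t (fun y => f y + g y) x = heat t f x + heat t g x.
Proof.
move=> t0 fi gi; have k_bmeas := bounded_measurable_heat_kernel x t0.
rewrite -(RintegralD measurableT (RintegrableM fi k_bmeas) (RintegrableM gi k_bmeas)).
by apply: eq_Rintegral => y _; rewrite mulrDl.
Qed.

Lemma heat_L1Z t c f x : 0 < t -> Rintegrable f ->
  heat t (fun y => c * f y) x = c * heat t f x.
Proof.
move=> t0 fi; have k_bmeas := bounded_measurable_heat_kernel x t0.
rewrite -(RintegralZl c measurableT (RintegrableM fi k_bmeas)).
by apply: eq_Rintegral => y _; rewrite -mulrA.
Qed.

Lemma heat_L1_contraction t f : 0 < t -> Rintegrable f ->
  \int[lam]_x `|heat t f x| <= \int[lam]_x `|f x|.
Proof.
move=> t0 fi; have nfi := Rintegrable_norm fi.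
rewrite -(Rintegral_heat t0 nfi); apply: le_Rintegral => //.
- exact/Rintegrable_norm/Rintegrable_heat.
- exact: Rintegrable_heat.
move=> x _; have k_bmeas := bounded_measurable_heat_kernel x t0.
apply: normr_Rintegral_le; [exact: RintegrableM k_bmeas..|].
by move=> y; rewrite normrM (ger0_norm (heat_kernel_ge0 _ _ t0)).
Qed.

Lemma normr_heat_le_L1 t f x : 0 < t -> Rintegrable f ->
  `|heat t f x| <= gauss_cst n t * \int[lam]_y `|f y|.
Proof.
by move=> t0 fi; exact: normr_RintegralM_le fi (bounded_measurable_heat_kernel x t0).
Qed.

Definition heat_L1_dist t g : R := \int[lam]_x `|heat t g x - g x|.

Lemma heat_defect_le t g M (F : V -> R) : 0 < t -> Rintegrable g -> bmeas F M ->
  `|\int[lam]_x (g x * (heat t F x - F x))| <= M * heat_L1_dist t g.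
Proof.
move=> t0 gi FM; rewrite (heat_defect_adjoint t0 gi FM).
under eq_Rintegral do rewrite mulrC.
exact: normr_RintegralM_le (RintegrableB (Rintegrable_heat t0 gi) gi) FM.
Qed.

Lemma opp_Rintegral_le (q g : V -> R) C d s : 0 < d -> 0 < s ->
  Rintegrable q -> Rintegrable g -> bmeas g C ->
  - (\int[lam]_x (q x * g x)) <= \int[lam]_x (q x * heat d (fun y => heat s g y - g y) x) +
    gauss_cst n s * \int[lam]_x `|g x| * \int[lam]_x `|q x| + C * heat_L1_dist d q.
Proof.
move=> d0 s0 qi gi gC; have sC := bounded_measurable_heat lam s0 gC.
have dsC := bounded_measurable_heat lam d0 sC; have dC := bounded_measurable_heat lam d0 gC.
have s_small : bmeas (heat s g) (gauss_cst n s * \int[lam]_x `|g x|).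
  by split=> [|x]; [exact: sC.1|exact: normr_heat_le_L1].
have ds_small := normr_RintegralM_le qi (bounded_measurable_heat lam d0 s_small).
have defect_small := heat_defect_le d0 qi gC.
have qds_i := RintegrableM qi dsC; have qd_i := RintegrableM qi dC.
have qg_i := RintegrableM qi gC.
have -> : \int[lam]_x (q x * heat d (fun y => heat s g y - g y) x) =
    \int[lam]_x (q x * heat d (heat s g) x) - \int[lam]_x (q x * heat d g x).
  rewrite -(RintegralB measurableT qds_i qd_i); apply: eq_Rintegral => x _.
  by rewrite (heatB lam x d0 sC gC) mulrBr.
have diffE : \int[lam]_x (q x * (heat d g x - g x)) =
    \int[lam]_x (q x * heat d g x) - \int[lam]_x (q x * g x).
  by rewrite -(RintegralB measurableT qd_i qg_i); apply: eq_Rintegral => x _; rewrite mulrBr.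
move: ds_small defect_small; rewrite diffE !ler_norml => /andP[+ _] /andP[_].
move: (\int[lam]_x (q x * heat d (heat s g) x)) => a.
move: (\int[lam]_x (q x * heat d g x)) (\int[lam]_x (q x * g x)) (heat_L1_dist _ _).
move=> b c D; move: (_ * \int[lam]_x `|q x|) (C * D) => K M; lra.
Qed.

Let dist_i t g : 0 < t -> Rintegrable g -> Rintegrable (fun x => `|heat t g x - g x|).
Proof. by move=> t0 gi; apply/Rintegrable_norm/RintegrableB => //; exact: Rintegrable_heat. Qed.

Lemma heat_L1_distD t f g : 0 < t -> Rintegrable f -> Rintegrable g ->
  heat_L1_dist t (fun x => f x + g x) <= heat_L1_dist t f + heat_L1_dist t g.
Proof.
move=> t0 fi gi; rewrite -RintegralD//; [|exact: dist_i..].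
apply: le_Rintegral => //; first exact/dist_i/RintegrableD.
  by apply: RintegrableD; exact: dist_i.
by move=> x _; rewrite heat_L1D// opprD addrACA ler_normD.
Qed.

Lemma heat_L1_distZ t c f : 0 < t -> Rintegrable f ->
  heat_L1_dist t (fun x => c * f x) = `|c| * heat_L1_dist t f.
Proof.
move=> t0 fi; rewrite -RintegralZl//; last exact: dist_i.
by apply: eq_Rintegral => x _; rewrite heat_L1Z// -mulrBr normrM.
Qed.

Lemma heat_L1_dist_le t f : 0 < t -> Rintegrable f ->
  heat_L1_dist t f <= 2 * \int[lam]_x `|f x|.
Proof.
move=> t0 fi; have hfi := Rintegrable_heat t0 fi.
rewrite mulr_natl mulr2n; apply: le_trans (lerD (heat_L1_contraction t0 fi) (lexx _)).
rewrite -RintegralD//; [|exact: Rintegrable_norm..].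
apply: le_Rintegral => //; first exact: dist_i.
  by apply: RintegrableD; exact: Rintegrable_norm.
by move=> x _; exact: ler_normB.
Qed.

Definition heat_L1_continuous g := forall e, 0 < e ->
  exists2 th, 0 < th & forall t, 0 < t <= th -> heat_L1_dist t g <= e.

Lemma heat_L1_continuousD f g : Rintegrable f -> Rintegrable g ->
  heat_L1_continuous f -> heat_L1_continuous g -> heat_L1_continuous (fun x => f x + g x).
Proof.
move=> fi gi fc gc e e0; have e20 : 0 < e / 2 by lra.
have [th1 th10 f_le] := fc _ e20; have [th2 th20 g_le] := gc _ e20.
exists (Num.min th1 th2); first by rewrite lt_min th10.
move=> t /andP[t0]; rewrite le_min => /andP[t1 t2].
rewrite [leRHS]splitr (le_trans (heat_L1_distD t0 fi gi))// lerD//.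
  by apply: f_le; rewrite t0.
by apply: g_le; rewrite t0.
Qed.

Lemma heat_L1_continuousZ c f : Rintegrable f ->
  heat_L1_continuous f -> heat_L1_continuous (fun x => c * f x).
Proof.
move=> fi fc e e0; have c0 : 0 < `|c| + 1 by rewrite ltr_pwDr.
have [th th0 f_le] := fc _ (divr_gt0 e0 c0); exists th => // t t_th.
have t0 : 0 < t by case/andP: t_th.
rewrite heat_L1_distZ//; apply: (le_trans (ler_wpM2l (normr_ge0 c) (f_le _ t_th))).
by rewrite mulrCA ler_piMr ?(ltW e0)// ler_pdivrMr// mul1r lerDl.
Qed.

Lemma heat_L1_continuous_sum (I : Type) (s : seq I) (F : I -> V -> R) :
  (forall i, Rintegrable (F i)) -> (forall i, heat_L1_continuous (F i)) ->
  heat_L1_continuous (fun x => \sum_(i <- s) F i x).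
Proof.
move=> Fi Fc; elim: s => [|i s ih].
  move=> e e0; exists 1 => // t /andP[t0 _]; rewrite ltW//; apply: le_lt_trans e0.
  have zero_i : Rintegrable (fun=> 0) by exact: integrable0.
  have -> : (fun x => \sum_(i <- [::]) F i x) = fun=> 0 * (0 : R).
    by apply/funext => x; rewrite big_nil mul0r.
  by rewrite heat_L1_distZ// normr0 mul0r.
rewrite (_ : (fun _ => _) = fun x => F i x + \sum_(j <- s) F j x); last first.
  by apply/funext => x; rewrite big_cons.
by apply: heat_L1_continuousD => //; exact: Rintegrable_sum.
Qed.

Lemma heat_L1_continuous_closed g : Rintegrable g ->
  (forall e, 0 < e -> exists g', [/\ Rintegrable g', heat_L1_continuous g' &
     \int[lam]_x `|g x - g' x| <= e]) -> heat_L1_continuous g.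
Proof.
move=> gi approx e e0; have e40 : 0 < e / 4 by lra.
have [g' [g'i g'c gg'_le]] := approx _ e40.
have [th th0 g'_le] := g'c (e / 2) (divr_gt0 e0 (ltr0n R 2)).
exists th => // t t_th; have t0 : 0 < t by case/andP: t_th.
have diff_i := RintegrableB gi g'i.
rewrite (_ : g = fun x => g' x + (g x - g' x)); last by apply/funext => x; rewrite subrKC.
apply: (le_trans (heat_L1_distD t0 g'i diff_i)); have := g'_le t t_th.
by have := heat_L1_dist_le t0 diff_i; lra.
Qed.

Section OpenSet.
Variable O : set V.
Hypotheses (oO : open O) (lamO : (lam O < +oo)%E).

Let mO : measurable (O : set E). Proof. exact: measurable_open. Qed.
Let indic_i : Rintegrable \1_O. Proof. exact: Rintegrable_indic. Qed.
Let indic_bmeas : bmeas \1_O 1. Proof. exact: bounded_measurable_indic. Qed.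

Lemma heat_indic_defect_le t r x : 0 < t -> 0 < r -> cball_e x r `<=` O ->
  1 - heat t \1_O x <= heat_tail n t r.
Proof.
move=> t0 r0 BO; apply: le_trans (Rintegral_tail_weight lam r x t0).
have kernel_i := Rintegrable_heat_kernel lam x t0.
have indic_k := RintegrableM_heat_kernel lam x t0 indic_bmeas.
rewrite -{1}(Rintegral_heat_kernel lam x t0) -(RintegralB measurableT kernel_i indic_k).
apply: le_Rintegral => //; [exact: RintegrableB|exact: Rintegrable_tail_weight|].
move=> y _; rewrite indicE; have [yO|yO] := pselect (O y).
  by rewrite mem_set// mul1r subrr tail_weight_ge0.
by rewrite memNset// mul0r subr0; apply: heat_kernel_le_tail_weight => // /BO.
Qed.

Lemma cvg_heat_indic_defect (t_ : nat -> R) x : (forall k, 0 < t_ k <= k.+1%:R^-1) ->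
  (fun k => \1_O x * (1 - heat (t_ k) \1_O x)) @ \oo --> (0 : R).
Proof.
move=> t_le; have t0 k : 0 < t_ k by have /andP[] := t_le k.
have [Ox|Ox] := pselect (O x); last first.
  under eq_fun do rewrite indicE memNset// mul0r.
  exact: cvg_cst.
have [r r0 BO] := open_cball oO Ox.
apply: (@cvg0_harmonic (heat_tail n 1 r)); apply: nearW => k.
rewrite indicE mem_set// mul1r subr_ge0; have /andP[_ ->] := heat_indic_ge0_le1 lam x (t0 k) mO.
rewrite /= (le_trans (heat_indic_defect_le (t0 k) r0 BO))// heat_tailZ.
rewrite ler_wpM2l ?heat_tail_ge0//; have /andP[_ tk] := t_le k; apply: le_trans tk.
have k1 : k.+1%:R^-1 <= 1 :> R by rewrite invf_le1 ?ltr0n// ler1n.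
by rewrite expr2 ler_piMl ?(ltW (t0 k))//; have /andP[_ /le_trans] := t_le k; apply.
Qed.

Lemma heat_indic_defect_small e : 0 < e -> exists2 th, 0 < th & forall t, 0 < t <= th ->
  \int[lam]_x (\1_O x * (1 - heat t \1_O x)) <= e.
Proof.
move=> e0; apply: contrapT => no_th.
have /choice[t_ t_P] : forall k : nat, exists t, 0 < t <= k.+1%:R^-1 /\
    e < \int[lam]_x (\1_O x * (1 - heat t \1_O x)).
  move=> k; apply: contrapT => no_t; apply: no_th.
  exists k.+1%:R^-1; first by rewrite invr_gt0 ltr0n.
  by move=> t tk; rewrite leNgt; apply/negP => ?; apply: no_t; exists t.
have t_le k := (t_P k).1; have t0 k : 0 < t_ k by have /andP[] := t_le k.
have : (fun k => \int[lam]_x (\1_O x * (1 - heat (t_ k) \1_O x))) @ \oo -->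
    \int[lam]_x (0 : R).
  apply: (@dominated_Rintegral _ E R lam _ (fun=> 0) \1_O) => //.
  - move=> k; apply: measurable_funM => //; apply: measurable_funB => //.
    exact: measurable_heat indic_bmeas.1.
  - move=> k x; have /andP[h0 h1] := heat_indic_ge0_le1 lam x (t0 k) mO.
    by rewrite ger0_norm ?ler_piMr ?mulr_ge0 ?subr_ge0// gerBl.
  - by move=> x; exact: cvg_heat_indic_defect.
rewrite Rintegral_cst// mul0r => /cvgrPdist_lt /(_ e e0)[K _ /(_ K (leqnn K))] /=.
rewrite sub0r normrN ltNge => /negP; apply.
by rewrite (le_trans (ltW (t_P K).2))// ler_norm.
Qed.

Let indic_dist (A : set V) x (a : R) : 0 <= a <= 1 ->
  `|a - \1_A x| = \1_A x + a - 2 * (\1_A x * a).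
Proof.
move=> /andP[a0 a1]; rewrite indicE; case: (_ \in _) => /=.
  by rewrite ler0_norm ?subr_le0//; ring.
by rewrite ger0_norm ?subr_ge0//; ring.
Qed.

Lemma heat_L1_dist_indicE t : 0 < t ->
  heat_L1_dist t \1_O = 2 * \int[lam]_x (\1_O x * (1 - heat t \1_O x)).
Proof.
move=> t0; have heat_i := Rintegrable_heat t0 indic_i.
have prod_i := RintegrableM indic_i (bounded_measurable_heat lam t0 indic_bmeas).
rewrite /heat_L1_dist; under eq_Rintegral.
  by move=> x _; rewrite indic_dist; [over|exact: heat_indic_ge0_le1].
under [in RHS]eq_Rintegral do rewrite mulrBr mulr1.
rewrite (RintegralB measurableT indic_i prod_i).
rewrite (RintegralB measurableT (RintegrableD indic_i heat_i) (RintegrableZ 2 prod_i)).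
rewrite (RintegralD measurableT indic_i heat_i) (RintegralZl 2 measurableT prod_i).
by rewrite Rintegral_heat//; ring.
Qed.

Lemma heat_L1_continuous_indic : heat_L1_continuous \1_O.
Proof.
move=> e e0; have [th th0 defect_le] := heat_indic_defect_small (divr_gt0 e0 (ltr0n R 2)).
exists th => // t t_th; have t0 : 0 < t by case/andP: t_th.
by rewrite heat_L1_dist_indicE//; have := defect_le t t_th; lra.
Qed.

End OpenSet.
End L1Continuity.

Section Quantize.
Variable R : realType.
Implicit Types (t : R) (K : nat).

(* [t] rounded away from 0 to a multiple of [1 / K], and truncated at [K]. *)
Definition quantize K t : R := K%:R^-1 * (\sum_(i < K ^ 2) (i%:R / K%:R < t)%R%:R -
  \sum_(i < K ^ 2) (t <= - (i%:R / K%:R))%R%:R).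

Lemma quantize_gt0 K t : (0 < K)%N -> 0 < t ->
  0 <= quantize K t <= t + 1 /\ (t <= K%:R -> t <= quantize K t <= t + K%:R^-1).
Proof.
rewrite -(ltr0n R) => K0 t0; have Kt0 : 0 <= K%:R * t by rewrite mulr_ge0// ltW.
have below_le i : i%:R / K%:R < t -> i%:R <= K%:R * t.
  by rewrite ltr_pdivrMr// mulrC => /ltW.
have above_ge i : ~~ (i%:R / K%:R < t) -> K%:R * t <= i%:R.
  by rewrite -leNgt ler_pdivlMr// mulrC.
have [count_le count_ge] := threshold_count (K ^ 2) below_le above_ge Kt0.
have none_le : \sum_(i < K ^ 2) (t <= - (i%:R / K%:R))%R%:R = 0 :> R.
  by apply: big1 => i _; rewrite leNgt (le_lt_trans _ t0)// oppr_le0 divr_ge0// ltW.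
rewrite /quantize none_le subr0; move: count_le count_ge; set C := \sum_(i < _) _ => count_le count_ge.
have C0 : 0 <= C by apply: sumr_ge0 => i _; rewrite ler0n.
have quant_le : K%:R^-1 * C <= t + K%:R^-1.
  by rewrite ler_pdivrMl// mulrDr mulfV ?gt_eqF.
split.
  rewrite mulr_ge0 ?invr_ge0 ?(ltW K0)//= (le_trans quant_le)// lerD2l.
  by rewrite invf_le1// ler1n -(ltr0n R).
move=> tK; rewrite quant_le andbT ler_pdivlMl// count_ge// natrX expr2.
by rewrite ler_wpM2l// ltW.
Qed.

Lemma quantize_le0 K t : (0 < K)%N -> t <= 0 ->
  t - 1 <= quantize K t <= 0 /\ (- K%:R <= t -> t - K%:R^-1 <= quantize K t <= t).
Proof.
rewrite -(ltr0n R) => K0 t0; have Kt0 : 0 <= - (K%:R * t) by rewrite oppr_ge0 pmulr_rle0.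
have below_le i : t <= - (i%:R / K%:R) -> i%:R <= - (K%:R * t).
  by rewrite lerNr ler_pdivrMr// mulNr [t * _]mulrC.
have above_ge i : ~~ (t <= - (i%:R / K%:R)) -> - (K%:R * t) <= i%:R.
  by rewrite -ltNge ltrNl ltr_pdivlMr// mulNr [t * _]mulrC => /ltW.
have [count_le count_ge] := threshold_count (K ^ 2) below_le above_ge Kt0.
have none_lt : \sum_(i < K ^ 2) (i%:R / K%:R < t)%R%:R = 0 :> R.
  by apply: big1 => i _; rewrite ltNge (le_trans t0)// divr_ge0// ltW.
rewrite /quantize none_lt sub0r; move: count_le count_ge; set C := \sum_(i < _) _ => count_le count_ge.
have C0 : 0 <= C by apply: sumr_ge0 => i _; rewrite ler0n.
have quant_ge : t - K%:R^-1 <= K%:R^-1 * - C.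
  by rewrite ler_pdivlMl// mulrBr mulfV ?gt_eqF//; lra.
split.
  rewrite pmulr_rle0 ?invr_gt0// oppr_le0 C0 andbT (le_trans _ quant_ge)// lerD2l lerN2.
  by rewrite invf_le1// ler1n -(ltr0n R).
move=> tK; rewrite quant_ge ler_pdivrMl// lerNl count_ge// natrX expr2 -mulrN.
by rewrite ler_wpM2l ?(ltW K0)// lerNl.
Qed.

Lemma normr_quantize_le K t : (0 < K)%N -> `|quantize K t| <= `|t| + 1.
Proof.
move=> K0; have [t0|t0] := ltP 0 t.
  by have [/andP[q0 qt] _] := quantize_gt0 K0 t0; rewrite !ger0_norm// ltW.
have [/andP[qt q0] _] := quantize_le0 K0 t0.
by rewrite !ler0_norm// lerNl opprD opprK.
Qed.

Lemma quantize_dist_le K t : (0 < K)%N -> `|t| <= K%:R -> `|quantize K t - t| <= K%:R^-1.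
Proof.
move=> K0; rewrite ler_norml ler_distl => /andP[Kt tK].
have inv0 : 0 <= K%:R^-1 :> R by rewrite invr_ge0.
have [t0|t0] := ltP 0 t.
  have [_ /(_ tK)/andP[tq ->]] := quantize_gt0 K0 t0.
  by rewrite andbT (le_trans _ tq)// gerBl.
have [_ /(_ Kt)/andP[-> qt]] := quantize_le0 K0 t0.
by rewrite (le_trans qt)// lerDl.
Qed.

End Quantize.

Section LowerSemicontinuous.
Variables (R : realType) (n : nat).
Local Notation V := 'rV[R]_(n.+1).
Local Notation E := (Rd R n).
Variables (lam : lebesgueRd R n) (U : set V) (psi : V -> \bar R).
Hypotheses (oU : open U) (lamU : (lam U < +oo)%E).
Hypothesis psi_int : lam.-integrable (U : set E) psi.
Hypothesis psi_lsc : forall x, U x -> forall a : R, (a%:E < psi x)%E ->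
  exists2 W, nbhs x W & forall y, W y -> (a%:E < psi y)%E.
Local Notation real_ext := (real_ext U psi).
Local Notation Rintegrable := (Rintegrable lam).
Local Notation heat_L1_continuous := (heat_L1_continuous lam).
Implicit Types (x : V) (a : R) (k : nat).

Let superlevel a : set V := U `&` [set x | (a%:E < psi x)%E].

Let open_superlevel a : open (superlevel a).
Proof.
rewrite openE => x [Ux ax]; have [W Wx Wa] := psi_lsc Ux ax.
by apply: filterI; [exact: oU|apply: filterS Wx].
Qed.

Let superlevel_lty a : (lam (superlevel a) < +oo)%E.
Proof.
have mS := measurable_open (@open_superlevel a).
by apply: (sub_measure_lty oU lamU mS); exact: subIsetl.
Qed.

Let superlevel_i a : Rintegrable \1_(superlevel a).
Proof.
by apply: Rintegrable_indic; [exact: (measurable_open (@open_superlevel a))|exact: superlevel_lty].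
Qed.

Let U_i : Rintegrable \1_U.
Proof. by apply: Rintegrable_indic => //; exact: measurable_open. Qed.

Let superlevel_complement a x : R := \1_U x + (-1) * \1_(superlevel a) x.

Let superlevel_complement_i a : Rintegrable (superlevel_complement a).
Proof. by apply: RintegrableD => //; exact: RintegrableZ. Qed.

Let superlevel_cont a : heat_L1_continuous \1_(superlevel a).
Proof. exact: heat_L1_continuous_indic. Qed.

Let superlevel_complement_cont a : heat_L1_continuous (superlevel_complement a).
Proof.
apply: heat_L1_continuousD => //; first exact: RintegrableZ.
  exact: heat_L1_continuous_indic.
exact: heat_L1_continuousZ.
Qed.

(* [quantize k.+1 (psi x)] written with superlevel sets. *)
Let quantized k x : R := k.+1%:R^-1 *
  (\sum_(i < k.+1 ^ 2) \1_(superlevel (i%:R / k.+1%:R)) x +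
   (-1) * \sum_(i < k.+1 ^ 2) superlevel_complement (- (i%:R / k.+1%:R)) x).

Let quantized_i k : Rintegrable (quantized k).
Proof.
by apply: RintegrableZ; apply: RintegrableD; last apply: RintegrableZ; exact: Rintegrable_sum.
Qed.

Let quantized_cont k : heat_L1_continuous (quantized k).
Proof.
have sum_i := Rintegrable_sum (index_enum _)
  (fun i : 'I_(k.+1 ^ 2) => superlevel_i (i%:R / k.+1%:R)).
have csum_i := Rintegrable_sum (index_enum _)
  (fun i : 'I_(k.+1 ^ 2) => superlevel_complement_i (- (i%:R / k.+1%:R))).
apply: heat_L1_continuousZ; first by apply: RintegrableD => //; exact: RintegrableZ.
apply: heat_L1_continuousD => //; first exact: RintegrableZ.
  exact: heat_L1_continuous_sum.
by apply: heat_L1_continuousZ => //; exact: heat_L1_continuous_sum.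
Qed.

Let quantized_out k x : ~ U x -> quantized k x = 0.
Proof.
move=> Ux; rewrite /quantized !big1 ?mulr0 ?addr0 ?mulr0// => i _.
  by rewrite /superlevel_complement !indicE !memNset ?mulr0 ?addr0// => -[].
by rewrite indicE memNset// => -[].
Qed.

Let quantizedE k x : U x -> psi x \is a fin_num ->
  quantized k x = quantize k.+1 (real_ext x).
Proof.
move=> Ux fx; have memE a : (x \in superlevel a) = (a < real_ext x).
  rewrite -lte_fin (real_extK Ux fx).
  by apply/idP/idP; rewrite inE; [case|move=> ax; split].
rewrite /quantized mulN1r; congr (_ * (_ - _)); apply: eq_bigr => i _.
  by rewrite indicE memE.
rewrite /superlevel_complement !indicE mem_set// memE mulN1r leNgt.
by case: (_ < _); rewrite ?subrr ?subr0.
Qed.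

Lemma cvg_quantized_L1 :
  (fun k => \int[lam]_x `|real_ext x - quantized k x|) @ \oo --> (0 : R).
Proof.
have ext_i := Rintegrable_real_ext oU psi_int.
have -> : (0 : R) = \int[lam]_x (0 : R) by rewrite Rintegral_cst// mul0r.
apply: (@ae_dominated_Rintegral _ _ _ lam _ _ (fun x => 2 * `|real_ext x| + 1 * \1_U x)) => //.
- move=> k; apply: (Rintegrable_measurable (mu := lam)).
  exact/Rintegrable_norm/RintegrableB.
- by apply: RintegrableD; apply: RintegrableZ => //; exact: Rintegrable_norm.
- apply: (ae_sub (ae_fin_num_psi oU psi_int)) => x fx k; rewrite normr_id.
  have [Ux|Ux] := pselect (U x); last first.
    by rewrite quantized_out// real_ext_out// subr0 normr0 addr_ge0 ?mulr_ge0.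
  rewrite quantizedE//; last exact: fx.
  rewrite indicE mem_set// mulr1 (le_trans (ler_normB _ _))//.
  by have := normr_quantize_le (real_ext x) (ltn0Sn k); lra.
- apply: (ae_sub (ae_fin_num_psi oU psi_int)) => x fx.
  have [Ux|Ux] := pselect (U x); last first.
    under eq_fun do rewrite quantized_out// real_ext_out// subr0 normr0.
    exact: cvg_cst.
  apply: (@cvg0_harmonic _ 1); exists (Num.truncn `|real_ext x|) => // k /= ext_k.
  rewrite normr_ge0 /= mul1r distrC quantizedE//; last exact: fx.
  apply: quantize_dist_le => //; apply/ltW/(lt_le_trans (truncnS_gt _)).
  by rewrite ler_nat.
Qed.

Lemma heat_L1_continuous_real_ext : heat_L1_continuous real_ext.
Proof.
have ext_i := Rintegrable_real_ext oU psi_int.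
apply: heat_L1_continuous_closed => // e e0.
have /cvgrPdist_lt /(_ e e0)[k _ /(_ k (leqnn k))] /= := cvg_quantized_L1.
rewrite sub0r normrN => /ltW dist_le; exists (quantized k); split => //.
exact: le_trans (ler_norm _) dist_le.
Qed.

End LowerSemicontinuous.

Section HeatTelescope.
Variables (R : realType) (n : nat).
Local Notation V := 'rV[R]_(n.+1).
Local Notation E := (Rd R n).
Local Notation bmeas := (@bounded_measurable _ E R).
Variable lam : lebesgueRd R n.
Local Notation heat := (heat lam).
Implicit Types (x : V) (f g q : V -> R) (d t b e K : R) (i j : nat).

Lemma heat_telescope d f b i x : 0 < d -> bmeas f b ->
  \sum_(j < i) heat (j.+1%:R * d) (fun y => heat d f y - f y) x =
  heat (i.+1%:R * d) f x - heat (1%:R * d) f x.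
Proof.
move=> d0 fb; have time_gt0 j : 0 < j.+1%:R * d by rewrite mulr_gt0// ltr0n.
rewrite -(telescope_sumr (fun j => heat (j.+1%:R * d) f x) (leq0n i)) big_mkord.
apply: eq_bigr => j _.
rewrite (heatB lam x (time_gt0 j) (bounded_measurable_heat lam d0 fb) fb).
by rewrite (heat_semigroup lam x (time_gt0 j) d0 fb) -time_succ.
Qed.

Lemma bounded_measurable_heat_diff s t f b : 0 < s -> 0 < t -> bmeas f b ->
  (forall x, 0 <= f x) -> bmeas (fun x => heat s f x - heat t f x) b.
Proof.
move=> s0 t0 fb f0; split; first by apply: measurable_funB; apply: measurable_heat; exact: fb.1.
move=> x; have hs0 := heat_ge0 lam x s0 f0; have ht0 := heat_ge0 lam x t0 f0.
have := le_trans (ler_norm _) (normr_heat_le lam x s0 fb).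
have := le_trans (ler_norm _) (normr_heat_le lam x t0 fb).
move: (heat s f x) (heat t f x) hs0 ht0 => a c a0 c0 cb ab.
by rewrite ler_norml; apply/andP; split; lra.
Qed.

(* Averaging over the times [d, 2d, ...] up to [th] telescopes [heat d f - f]. *)
Lemma averaged_heat_defect_le q d th e K f b : Rintegrable lam q -> 0 < d <= th / 2 ->
  (forall t, 0 < t <= th -> heat_L1_dist lam t q <= e) ->
  bmeas f b -> (forall x, 0 <= f x) -> bmeas (fun x => heat d f x - f x) (K * d) ->
  \int[lam]_x (q x * (heat d f x - f x)) <=
    (e * K + 2 * b * \int[lam]_x `|q x| / th) * d.
Proof.
move=> qi /andP[d0 d_th] q_cont fb f0 gb; set g := fun x => heat d f x - f x in gb *.
have th0 : 0 < th by lra.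
have time_gt0 j : 0 < j.+1%:R * d by rewrite mulr_gt0// ltr0n.
have [i /andP[th2_le le_th]] := grid_approx d0 d_th.
set J : R := i.+1%:R in th2_le le_th *; have J0 : 0 < J by rewrite ltr0n.
have {}le_th : J * d <= th by apply: (le_trans le_th); rewrite mulrC divfK.
have N0 : 0 <= \int[lam]_x `|q x| by apply: Rintegral_ge0.
have Kd0 : 0 <= K * d := bounded_measurable_ge0 gb 0.
have diff_b := bounded_measurable_heat_diff (time_gt0 i.+1) (time_gt0 0%N) fb f0.
have jump_i (j : 'I_i.+1) :=
  RintegrableM qi (bounded_measurable_heatB lam (time_gt0 j) gb).
have averaged : J * \int[lam]_x (q x * g x) =
    \int[lam]_x (q x * (heat (i.+2%:R * d) f x - heat (1%:R * d) f x)) -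
    \sum_(j < i.+1) \int[lam]_x (q x * (heat (j.+1%:R * d) g x - g x)).
  rewrite -(Rintegral_sum (index_enum _) jump_i).
  rewrite -(RintegralZl J measurableT (RintegrableM qi gb)).
  rewrite -(RintegralB measurableT (RintegrableM qi diff_b) (Rintegrable_sum _ jump_i)).
  apply: eq_Rintegral => x _; rewrite -mulr_sumr -mulrBr sumrB (heat_telescope _ _ d0 fb).
  by rewrite opprB addrCA subrr addr0 sumr_const card_ord -mulr_natl mulrCA.
have jumps_le : `|\sum_(j < i.+1) \int[lam]_x (q x * (heat (j.+1%:R * d) g x - g x))| <=
    J * (e * (K * d)).
  rewrite (le_trans (ler_norm_sum _ _ _))// mulr_natl -[i.+1 in leRHS]card_ord -sumr_const.
  apply: ler_sum => j _; apply: (le_trans (heat_defect_le (time_gt0 j) qi gb)).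
  rewrite mulrC ler_wpM2r// q_cont// time_gt0 (le_trans _ le_th)// ler_pM2r//.
  by rewrite ler_nat.
have ends_le := normr_RintegralM_le qi diff_b.
have bN_le : b * \int[lam]_x `|q x| <= J * (2 * b * \int[lam]_x `|q x| / th * d).
  have -> : J * (2 * b * \int[lam]_x `|q x| / th * d) =
    b * \int[lam]_x `|q x| * (J * d * (2 / th)).
    by move: (\int[lam]_x _) => N; field; rewrite gt_eqF.
  rewrite ler_peMr ?mulr_ge0 ?(bounded_measurable_ge0 fb 0)//.
  by rewrite mulrA ler_pdivlMr//; lra.
rewrite -(ler_pM2l J0) averaged; move: jumps_le ends_le; rewrite !ler_norml.
move=> /andP[jumps_le _] /andP[_ ends_le]; move: jumps_le ends_le bN_le.
by move: (\int[lam]_x _) (\sum_(j < i.+1) _) (\int[lam]_x `|q x|) => a S N; lra.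
Qed.

End HeatTelescope.

Section SuperharmonicPotential.
Variables (R : realType) (n : nat).
Local Notation V := 'rV[R]_(n.+1).
Local Notation E := (Rd R n).
Local Notation bmeas := (@bounded_measurable _ E R).
Variables (lam : lebesgueRd R n) (U : set V) (psi : V -> \bar R).
Hypotheses (oU : open U) (lamU : (lam U < +oo)%E).
Hypothesis psi_int : lam.-integrable (U : set E) psi.
Hypothesis psi_sh : superharmonic_in lam U psi.
Local Notation heat := (heat lam).
Local Notation real_ext := (real_ext U psi).
Local Notation psi_norm := (\int[lam]_x `|real_ext x|).

Let ext_i : Rintegrable lam real_ext. Proof. exact: Rintegrable_real_ext. Qed.

Section Truncation.
Variables (d Cv Cw b : R) (v w : V -> R).
Hypotheses (d_gt0 : 0 < d) (d_le1 : d <= 1) (pot : discrete_potential lam d Cv Cw v w).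
Hypotheses (b_gt0 : 0 < b) (b_le8 : b <= 8^-1).
Local Notation lip := (potential_lip n Cv Cw).
Local Notation trunc := (fun x : V => log_trunc b (v x)).
Local Notation rest := (fun x : V => v x - log_trunc b (v x)).
Local Notation radius := (b ^+ 2 / (2 * lip)).

Let b_lt1 : b < 1. Proof. by apply: (le_lt_trans b_le8); lra. Qed.
Let v_bmeas : bmeas v Cv. Proof. by case: pot. Qed.
Let w_bmeas : bmeas w Cw. Proof. by case: pot. Qed.
Let Cv_ge0 : 0 <= Cv. Proof. exact: bounded_measurable_ge0 v_bmeas 0. Qed.
Let Cw_ge0 : 0 <= Cw. Proof. exact: bounded_measurable_ge0 w_bmeas 0. Qed.
Let lip_gt0 : 0 < lip. Proof. exact: lt_le_trans (potential_lip_ge1 n Cv_ge0 Cw_ge0). Qed.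
Let trunc_bmeas : bmeas trunc Cv.
Proof. exact: (bounded_measurable_log_trunc pot b_gt0 b_le8). Qed.

Lemma trunc_support : (forall x, ~ U x -> v x <= b ^+ 2 / 2) ->
  forall x, trunc x != 0 -> cball_e x radius `<=` U.
Proof.
have [_ v0 _ _] := pot; move=> vU x trunc_x y.
have r0 : 0 <= radius by rewrite divr_ge0 ?sqr_ge0// mulr_ge0// ltW.
rewrite cball_eE// => xy; apply: contrapT => /vU vy.
have vx : b ^+ 2 < v x.
  by rewrite ltNge; apply: contraNN trunc_x => vx; rewrite log_trunc_eq0// v0.
have v_le : v x <= v y + lip * enorm (y - x).
  by have := potential_elipschitz d_gt0 pot d_le1 x y; rewrite ler_norml => /andP[+ _]; lra.
have : lip * enorm (y - x) <= lip * radius by rewrite ler_wpM2l// ltW.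
rewrite (_ : lip * radius = b ^+ 2 / 2); last by field; rewrite gt_eqF.
by apply/negP; rewrite -ltNge; lra.
Qed.

Lemma trunc_part_le : (forall x, ~ U x -> v x <= b ^+ 2 / 2) ->
  \int[lam]_x (real_ext x * (heat d trunc x - trunc x)) <=
  Cv * (psi_norm * (4 * gauss_sphere n d radius * fine (lam U) + heat_tail n d radius)).
Proof.
move=> vU; apply: (heat_superharmonic_le oU psi_int lamU psi_sh d_gt0 _ trunc_bmeas).
- by rewrite divr_gt0 ?exprn_gt0// mulr_gt0.
- by move=> x; exact: log_trunc_ge0.
- exact: trunc_support.
Qed.

Lemma rest_ge0 x : 0 <= rest x.
Proof. by have [_ v0 _ _] := pot; rewrite subr_ge0 log_trunc_le_id. Qed.

Lemma bounded_measurable_rest : bmeas rest b.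
Proof.
split; first by apply: measurable_funB; [exact: v_bmeas.1|exact: trunc_bmeas.1].
by move=> x; rewrite ger0_norm ?rest_ge0//; have := log_trunc_ge_sub b_gt0 b_lt1 (v x); lra.
Qed.

Lemma heat_rest_defectE x : heat d rest x - rest x =
  (1 - log_ramp b (v x)) * (d * heat d w x) - mean_bregman lam d v b x.
Proof.
have [_ _ _ poisson] := pot.
rewrite (mean_bregmanE d_gt0 pot b_gt0 b_le8) (heatB lam x d_gt0 v_bmeas trunc_bmeas).
have := poisson x; move: (heat d v x) (heat d w x) (heat d _ x) (log_ramp _ _) => a c p g.
by move=> <-; ring.
Qed.

Lemma bounded_measurable_rest_defect : d <= b ^+ 2 / 2 ->
  moment_cst R n 2 * bregman_far_cst n b Cv Cw * d <= 1 ->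
  bmeas (fun x => heat d rest x - rest x) ((Cw + mean_bregman_cst n Cv Cw) * d).
Proof.
move=> db d_far; split; first exact: (bounded_measurable_heatB lam d_gt0 bounded_measurable_rest).1.
move=> x; rewrite heat_rest_defectE (le_trans (ler_normB _ _))// [leRHS]mulrDl.
apply: lerD.
  rewrite normrM ger0_norm ?subr_ge0 ?log_ramp_le1// normrM (gtr0_norm d_gt0).
  apply: (@le_trans _ _ (d * `|heat d w x|)).
    by rewrite ler_piMl ?mulr_ge0// ?(ltW d_gt0)// gerBl log_ramp_ge0.
  by rewrite mulrC ler_wpM2r ?(ltW d_gt0)//; exact: normr_heat_le w_bmeas.
rewrite ger0_norm; first exact: (mean_bregman_le d_gt0 d_le1 pot b_gt0 b_le8).
exact: (mean_bregman_ge0 lam v d_gt0 b_gt0 b_le8).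
Qed.

Lemma trunc_rest_split : d * \int[lam]_x (real_ext x * heat d w x) =
  \int[lam]_x (real_ext x * (heat d trunc x - trunc x)) +
  \int[lam]_x (real_ext x * (heat d rest x - rest x)).
Proof.
have [_ _ _ poisson] := pot.
have w_i := RintegrableM ext_i (bounded_measurable_heat lam d_gt0 w_bmeas).
have trunc_i := RintegrableM ext_i (bounded_measurable_heatB lam d_gt0 trunc_bmeas).
have rest_i := RintegrableM ext_i (bounded_measurable_heatB lam d_gt0 bounded_measurable_rest).
rewrite -(RintegralZl d measurableT w_i) -(RintegralD measurableT trunc_i rest_i).
apply: eq_Rintegral => x _; rewrite -mulrDr (heatB lam x d_gt0 v_bmeas trunc_bmeas) mulrCA.
rewrite -poisson; congr (_ * _).
by move: (heat d v x) (heat d _ x) => a c; ring.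
Qed.

End Truncation.

Lemma trunc_bound_small (Cv radius e : R) : 0 <= Cv -> 0 < radius -> 0 < e ->
  \forall d \near 0^'+,
    Cv * (psi_norm * (4 * gauss_sphere n d radius * fine (lam U) + heat_tail n d radius)) <=
    e * d.
Proof.
move=> v0 r0 e0; have [C C0 sphere_le] := gauss_sphere_small n r0.
have N0 : 0 <= psi_norm by apply: Rintegral_ge0.
have LU0 : 0 <= fine (lam U) by exact: fine_ge0.
pose Q := Cv * (psi_norm * (4 * C * fine (lam U) + heat_tail n 1 radius)).
near=> d; have d0 : 0 < d by near: d; exact: nbhs_right_gt.
have d1 : d <= 1 by near: d; exact: nbhs_right_le.
have Qd : Q * d <= e by near: d; exact: near_right0_mul_le.
apply: (@le_trans _ _ (Q * d * d)); last by rewrite ler_wpM2r// ltW.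
rewrite [leRHS](_ : _ = Cv * (psi_norm *
  (4 * (C * d ^+ 2) * fine (lam U) + heat_tail n 1 radius * d ^+ 2))); last first.
  by rewrite /Q; move: psi_norm (fine _) (heat_tail _ _ _) => N L T; ring.
rewrite ler_wpM2l// ler_wpM2l// -heat_tailZ lerD2r ler_wpM2r// ler_wpM2l//.
by apply: sphere_le; rewrite d0.
Unshelve. all: by end_near.
Qed.

Lemma superharmonic_potential_le (Cv Cw e : R) : 0 <= Cv -> 0 <= Cw -> 0 < e ->
  exists2 c : R, 0 < c & \forall d \near 0^'+, forall v w : V -> R,
    discrete_potential lam d Cv Cw v w -> (forall x, ~ U x -> v x <= c / 2) ->
    \int[lam]_x (real_ext x * heat d w x) <= e.
Proof.
move=> v0 w0 e0; have [_ psi_lsc _] := psi_sh.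
pose K := Cw + mean_bregman_cst n Cv Cw.
have K0 : 0 <= K by rewrite addr_ge0 ?mean_bregman_cst_ge0.
have eK0 : 0 < e / (4 * (K + 1)) by rewrite divr_gt0// mulr_gt0// ltr_wpDl.
have eK_le : e / (4 * (K + 1)) * K <= e / 4.
  rewrite invfM mulrA -mulrA ler_piMr ?divr_ge0 ?(ltW e0)// mulrC.
  by rewrite ler_pdivrMr ?ltr_wpDl// mul1r lerDl.
have [th th0 cont] := heat_L1_continuous_real_ext oU lamU psi_int psi_lsc eK0.
have N0 : 0 <= psi_norm by apply: Rintegral_ge0.
pose b := Num.min 8^-1 (e * th / (8 * (psi_norm + 1))).
have N1 : 0 < 8 * (psi_norm + 1) by rewrite mulr_gt0// ltr_wpDl.
have b0 : 0 < b by rewrite lt_min invr_gt0 ltr0n divr_gt0// mulr_gt0.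
have b8 : b <= 8^-1 by rewrite ge_min lexx.
have bN_le : 2 * b * psi_norm / th <= e / 4.
  have : b <= e * th / (8 * (psi_norm + 1)) by rewrite ge_min lexx orbT.
  rewrite ler_pdivlMr// ler_pdivrMr//; move: psi_norm N0 {N1} => N N0.
  by move: b b0 {b8} => b b0; nra.
have radius0 : 0 < b ^+ 2 / (2 * potential_lip n Cv Cw).
  by rewrite divr_gt0 ?exprn_gt0// mulr_gt0// (lt_le_trans ltr01)// potential_lip_ge1.
have e40 : 0 < e / 4 by rewrite divr_gt0.
exists (b ^+ 2); first by rewrite exprn_gt0.
near=> d => v w pot vU; have d0 : 0 < d by near: d; exact: nbhs_right_gt.
have d1 : d <= 1 by near: d; exact: nbhs_right_le.
have db : d <= b ^+ 2 / 2 by near: d; apply: nbhs_right_le; rewrite divr_gt0// exprn_gt0.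
have d_th : d <= th / 2 by near: d; apply: nbhs_right_le; rewrite divr_gt0.
have d_far : moment_cst R n 2 * bregman_far_cst n b Cv Cw * d <= 1.
  by near: d; exact: near_right0_mul_le.
have trunc_le : \int[lam]_x (real_ext x * (heat d (fun y => log_trunc b (v y)) x -
    log_trunc b (v x))) <= e / 4 * d.
  apply: (le_trans (trunc_part_le d0 d1 pot b0 b8 vU)).
  by near: d; exact: trunc_bound_small.
have rest_b := bounded_measurable_rest_defect d0 d1 pot b0 b8 db d_far.
have d_th' : 0 < d <= th / 2 by rewrite d0.
have rest_le := averaged_heat_defect_le ext_i d_th' cont
  (bounded_measurable_rest pot b0 b8) (rest_ge0 pot b0 b8) rest_b.
rewrite -(ler_pM2l d0) (trunc_rest_split d0 pot b0 b8); apply: (le_trans (lerD trunc_le rest_le)).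
rewrite -mulrDl mulrC ler_wpM2l ?(ltW d0)//; move: bN_le eK_le; rewrite -/K.
by move: (_ * K) (_ / th) => a1 a2; lra.
Unshelve. all: by end_near.
Qed.

End SuperharmonicPotential.

(** * Exterior points of a Lipschitz domain *)

Section Exterior.
Variables (R : realType) (n : nat).
Local Notation V := 'rV[R]_(n.+1).
Implicit Types (x y z u : V) (U : set V) (e r s : R).

Definition base_coords z : 'rV[R]_n := \row_(j < n) z ord0 (widen_ord (leqnSn n) j).
Definition vertical : V := delta_mx ord0 ord_max.

Lemma base_coordsD_vertical u s : base_coords (u + s *: vertical) = base_coords u.
Proof.
apply/rowP => j; rewrite !mxE eqxx /= (_ : (widen_ord _ j == ord_max) = false) ?mulr0 ?addr0//.
by apply/negbTE; rewrite -val_eqE /= neq_ltn ltn_ord.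
Qed.

Lemma height_addD_vertical u s : (u + s *: vertical) ord0 ord_max = u ord0 ord_max + s.
Proof. by rewrite !mxE !eqxx mulr1. Qed.

Lemma sqnorm_base_coords_le u : sqnorm (base_coords u) <= sqnorm u.
Proof.
rewrite [leRHS]/sqnorm big_ord_recr /= /sqnorm.
rewrite (eq_bigr (fun j : 'I_n => u ord0 (widen_ord (leqnSn n) j) ^+ 2)).
  by rewrite lerDl sqr_ge0.
by move=> j _; rewrite mxE.
Qed.

Lemma enorm_vertical : enorm vertical = 1.
Proof.
rewrite /enorm /sqnorm (bigD1 ord_max)//= mxE !eqxx expr1n big1 ?addr0 ?sqrtr1// => i iM.
by rewrite mxE eqxx (negbTE iM) expr0n.
Qed.

Lemma enormZ s u : enorm (s *: u) = `|s| * enorm u.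
Proof. by rewrite /enorm sqnormZ sqrtrM ?sqr_ge0// sqrtr_sqr. Qed.

Lemma enorm_mulmx_orth x (Q : 'M[R]_(n.+1)) : Q *m Q^T = 1%:M -> enorm (x *m Q) = enorm x.
Proof.
move=> QQ; have sqnormE (z : V) : sqnorm z = (z *m z^T) ord0 ord0.
  by rewrite mxE; apply: eq_bigr => i _; rewrite mxE expr2.
by rewrite /enorm !sqnormE trmx_mul mulmxA -(mulmxA x) QQ mulmx1.
Qed.

Lemma below_lipschitz_graph (g : 'rV[R]_n -> R) (L : R) u s :
  (forall a b, (g a - g b) ^+ 2 <= L ^+ 2 * sqnorm (a - b)) -> 0 <= g 0 ->
  enorm u * (1 + `|L|) <= s ->
  (u - s *: vertical) ord0 ord_max <= g (base_coords (u - s *: vertical)).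
Proof.
move=> gL g0 us; rewrite -scaleNr height_addD_vertical base_coordsD_vertical.
have g_dist : `|g (base_coords u) - g 0| <= `|L| * enorm u.
  rewrite -ler_sqr ?nnegrE ?mulr_ge0 ?enorm_ge0// exprMn !real_normK ?num_real// sqr_enorm.
  apply: (le_trans (gL _ _)); rewrite subr0.
  by rewrite ler_wpM2l ?sqr_ge0 ?sqnorm_base_coords_le.
have height_le := le_trans (ler_norm _) (coord_le_enorm u ord_max).
by move: g_dist; rewrite ler_norml => /andP[g_ge _]; lra.
Qed.

Definition near_exterior U e r x :=
  exists2 x', enorm (x' - x) <= e & forall y, U y -> r <= enorm (y - x').

(* Moving down from [x] along the vertical axis of a chart, by [s], leaves a ball of
   radius [s / (1 + |L|)] below the graph. *)
Lemma boundary_near_exterior U x e : locally_lipschitz_boundary U -> 0 < e ->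
  closure U x -> ~ U x -> exists2 r, 0 < r & near_exterior U e r x.
Proof.
move=> lipU e0 Ucx Ux; have [rad [Q [g [rad0 QQ [L gL] chart]]]] := lipU x Ucx Ux.
pose s := Num.min e (rad / 4).
have s0 : 0 < s by rewrite lt_min e0/= divr_gt0.
have se : s <= e by rewrite ge_min lexx.
have s_rad : s <= rad / 4 by rewrite ge_min lexx orbT.
have QQ' : Q^T *m Q = 1%:M := mulmx1C QQ.
pose shift : V := - s *: (vertical *m Q^T).
have enorm_shift : enorm shift = s.
  rewrite enormZ normrN (gtr0_norm s0) enorm_mulmx_orth ?trmxK//.
  by rewrite enorm_vertical mulr1.
have L1 : 0 < 1 + `|L| by rewrite ltr_pwDl.
exists (s / (1 + `|L|)); first exact: divr_gt0.
exists (x + shift) => [|y Uy]; first by rewrite addrAC subrr add0r enorm_shift.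
rewrite leNgt; apply/negP => y_near; pose u := y - (x + shift).
have yE : y - x = u + shift by rewrite /u opprD addrA addrNK.
have u_le : enorm u * (1 + `|L|) <= s by rewrite -ler_pdivlMr// ltW.
have u_s : enorm u <= s.
  by apply: le_trans u_le; rewrite ler_peMr ?enorm_ge0// lerDl.
have g0 : 0 <= g 0.
  rewrite leNgt; apply/negP => g0; apply: Ux; apply/(chart x) => /=.
    by rewrite subrr sqnorm0 exprn_gt0.
  rewrite subrr mul0mx mxE (_ : \row_j _ = 0)//.
  by apply/rowP => j; rewrite !mxE.
have y_rad : sqnorm (y - x) < rad ^+ 2.
  rewrite -sqr_enorm ltrXn2r ?nnegrE ?enorm_ge0 ?(ltW rad0)// yE.
  by apply: (le_lt_trans (enorm_triangle _ _)); rewrite enorm_shift; lra.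
have /= := (chart y y_rad).1 Uy; rewrite yE mulmxDl.
have -> : shift *m Q = - (s *: vertical) by rewrite /shift -scalemxAl -mulmxA QQ' mulmx1 scaleNr.
rewrite ltNge => /negP; apply; apply: below_lipschitz_graph gL g0 _.
by rewrite enorm_mulmx_orth.
Qed.

Lemma outside_near_exterior U x e : locally_lipschitz_boundary U -> 0 < e ->
  ~ U x -> exists2 r, 0 < r & near_exterior U e r x.
Proof.
move=> lipU e0 Ux; have [Ucx|Ucx] := pselect (closure U x).
  exact: boundary_near_exterior.
have oC : open (~` closure U) by apply: closed_openC; exact: closed_closure.
have [r r0 sub] := open_cball oC Ucx; exists r => //.
exists x => [|y Uy]; first by rewrite subrr enorm0 ltW.
rewrite leNgt; apply/negP => /ltW; rewrite -cball_eE ?(ltW r0)// => /sub.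
by apply; exact: subset_closure.
Qed.

Lemma near_exterior_nbhs U x e r : 0 < e -> 0 < r -> near_exterior U (e / 2) r x ->
  \forall x1 \near x & r1 \near 0^'+, near_exterior U e r1 x1.
Proof.
move=> e0 r0 [x' xx' far]; have e20 : 0 < e / 2 by rewrite divr_gt0.
exists (cball_e x (e / 2), [set r1 | r1 <= r]).
  by split => /=; [exact: cball_e_nbhs|exact: nbhs_right_le].
move=> [x1 r1] /= [x1x r1r]; exists x' => [|y Uy]; last exact: le_trans r1r (far y Uy).
rewrite [leRHS]splitr -(subrKA x) (le_trans (enorm_triangle _ _))// lerD//.
by rewrite enormBC; move: x1x; rewrite cball_eE// ltW.
Qed.

Lemma compact_cube (k : R) : compact (cube k : set V).
Proof.
rewrite (_ : cube k = [set v : V | forall i, `[- k, k]%classic (v ord0 i)]).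
  by apply: (@rV_compact R _ (fun=> `[- k, k]%classic)) => i; exact: segment_compact.
by apply/seteqP; split => v vk i; have := vk i; rewrite /= !mxE in_itv.
Qed.

Lemma far_from_cube k x y : cube k y -> ~ cube (k + 1) x -> 1 <= enorm (y - x).
Proof.
move=> yk xk; have [i xi] : exists i, ~ (- (k + 1) <= x ord0 i <= k + 1).
  apply: contrapT => /forallNP in_cube; apply: xk => i; rewrite !mxE.
  by have /contrapT := in_cube i.
have := yk i; rewrite !mxE => /andP[y_ge y_le].
apply: le_trans (coord_le_enorm (y - x) i); rewrite !mxE leNgt ltr_norml.
by apply/negP => /andP[ge lt]; apply: xi; apply/andP; split; lra.
Qed.

Lemma uniform_near_exterior U k e : open U -> U `<=` cube k ->
  locally_lipschitz_boundary U -> 0 < e ->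
  exists2 r, 0 < r & forall x, ~ U x -> near_exterior U e r x.
Proof.
move=> oU Uk lipU e0; have e20 : 0 < e / 2 by rewrite divr_gt0.
pose A : set V := cube (k + 1) `&` ~` U.
have cA : compact A.
  by apply: compact_closedI; [exact: compact_cube|exact: open_closedC].
have near_A : \forall r \near 0^'+, A `<=` near_exterior U e r.
  move/compact_near_coveringP: cA; apply => x [_ Ux].
  have [r r0 ext] := outside_near_exterior lipU e20 Ux.
  exact: near_exterior_nbhs e0 r0 ext.
near (0 : R)^'+ => r.
have r0 : 0 < r by near: r; exact: nbhs_right_gt.
have r1 : r <= 1 by near: r; exact: nbhs_right_le.
have sub : A `<=` near_exterior U e r by near: r.
exists r => // x Ux; have [xk|xk] := pselect (cube (k + 1) x).
  exact: sub.
exists x => [|y Uy]; first by rewrite subrr enorm0 ltW.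
exact: le_trans r1 (far_from_cube (Uk y Uy) xk).
Unshelve. all: by end_near.
Qed.

End Exterior.

(** * Stopped Brownian motion *)

Section Filtration.
Context (R : realType) (dO : measure_display) (Omega : measurableType dO).
Variable F : R -> set (set Omega).
Hypothesis Ffil : filtration F.
Local Notation OF s := (g_sigma_algebraType (F s)).
Implicit Type s : R.

Lemma filtration_setT s : F s setT.
Proof. by have [/(_ s)[F0 FC _] _ _] := Ffil; have := FC _ F0; rewrite setD0. Qed.

Lemma filtration_measurable s (A : set Omega) : @measurable _ (OF s) A -> F s A.
Proof. by have [Fs _ _] := Ffil; apply: smallest_sub (Fs s) _ A. Qed.

Definition restrict_algebra s (w : Omega) : OF s := w.

Lemma measurable_restrict_algebra s : measurable_fun setT (restrict_algebra s).
Proof.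
have [_ _ Fm] := Ffil; move=> _ A mA; rewrite setTI.
exact: Fm (filtration_measurable mA).
Qed.

Lemma adapted_measurable_fun (d : measure_display) (T : measurableType d) s (X : Omega -> T) :
  @measurable_fun _ _ (OF s) T setT X -> measurable_fun setT X.
Proof.
have [_ _ Fm] := Ffil; move=> mX _ A mA.
by apply: (Fm s); apply: filtration_measurable; exact: (mX measurableT A mA).
Qed.

End Filtration.

Section BrownianIncrements.
Context (R : realType) (n : nat) (dO : measure_display) (Omega : measurableType dO).
Local Notation V := 'rV[R]_(n.+1).
Local Notation E := (Rd R n).
Variables (lam : {sigma_finite_measure set E -> \bar R}) (P : {measure set Omega -> \bar R}).
Variables (F : R -> set (set Omega)) (W : R -> Omega -> V).
Hypotheses (Ffil : filtration F) (BM : brownian_motion lam P F W).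
Hypotheses (Pfin : (P setT < +oo)%E) (Ppos : P setT != 0%E).
Local Notation OF s := (g_sigma_algebraType (F s)).
Implicit Types s t : R.

Let mass_gt0 : 0 < fine (P setT). Proof. by rewrite fine_gt0// Pfin lt0e Ppos measure_ge0. Qed.

Let massE : P setT = (fine (P setT))%:E. Proof. by rewrite fineK// ge0_fin_numE. Qed.

Lemma adapted_W t : 0 <= t -> @measurable_fun _ _ (OF t) E setT (W t).
Proof. by have [_ + _] := BM; exact. Qed.

Lemma measurable_W t : 0 <= t -> measurable_fun setT (W t : Omega -> E).
Proof. by move=> t0; exact: (adapted_measurable_fun Ffil (adapted_W t0)). Qed.

Lemma measurable_increment s t : 0 <= s -> s <= t ->
  measurable_fun setT ((fun w => W t w - W s w) : Omega -> E).
Proof.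
by move=> s0 st; apply: measurable_row_sub; apply: measurable_W => //; exact: le_trans st.
Qed.

Lemma increment_law s t (B : set E) : 0 <= s -> s < t -> measurable B ->
  P [set w | B (W t w - W s w)] = (P setT * gauss lam (t - s) B)%E.
Proof.
move=> s0 st mB; have [_ _ BMi] := BM.
by rewrite -(BMi s t setT B s0 st (filtration_setT Ffil s) mB) setTI.
Qed.

Lemma brownian_gauss_mass t : 0 < t -> gauss lam t setT = 1%E.
Proof.
move=> t0; apply: (@mule_fin_injl _ (fine (P setT))) => //.
have := increment_law (lexx 0) t0 measurableT; rewrite subr0 mule1 -massE => <-.
by congr (P _); apply/seteqP.
Qed.

Lemma ge0_integral_increment s t (g : E -> \bar R) : 0 <= s -> s < t ->
  measurable_fun setT g -> (forall z, 0 <= g z)%E ->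
  (\int[P]_w g (W t w - W s w)%R =
   P setT * \int[lam]_z (g z * (gauss_density (t - s) z)%:E))%E.
Proof.
move=> s0 st mg g0; have ts : 0 < t - s by rewrite subr_gt0.
have [m mE m_int] := image_measure P (measurable_increment s0 (ltW st)).
have mgauss := @measurable_gauss_density R n (t - s).
have m_density : has_density lam m (fun z => fine (P setT) * gauss_density (t - s) z).
  move=> B mB; rewrite mE (increment_law s0 st mB) massE /gauss.
  under [RHS]eq_integral do rewrite EFinM.
  rewrite ge0_integralZl//; first exact/measurable_EFinP/measurable_funTS.
  by move=> z _; rewrite lee_fin gauss_density_ge0.
rewrite -(m_int _ mg g0) (ge0_integral_density _ _ _ m_density mg g0).
- rewrite massE -ge0_integralZl//.
  + by apply: eq_integral => z _; rewrite EFinM muleCA.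
  + by apply: emeasurable_funM => //; exact/measurable_EFinP.
  + by move=> z _; rewrite mule_ge0// lee_fin gauss_density_ge0.
- by rewrite mE.
- exact: measurable_funM.
- by move=> z; rewrite mulr_ge0 ?gauss_density_ge0// ltW.
Qed.

Lemma ge0_integral_past_increment s t (f : OF s * E -> \bar R) : 0 <= s -> s < t ->
  measurable_fun setT f -> (forall p, 0 <= f p)%E ->
  (\int[P]_w f (w, W t w - W s w)%R =
   \int[P]_w \int[lam]_z (f (w, z) * (gauss_density (t - s) z)%:E))%E.
Proof.
move=> s0 st mf f0; have ts : 0 < t - s by rewrite subr_gt0.
have gauss0 (z : E) : (0 <= (gauss_density (t - s) z)%:E)%E.
  by rewrite lee_fin gauss_density_ge0.
have mfw (w : OF s) : measurable_fun setT (fun z => f (w, z)).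
  exact: (measurableT_comp mf (pair1_measurable w)).
apply: (mule_fin_injl mass_gt0); rewrite -massE.
pose incr : Omega -> E := fun w => W t w - W s w.
have mX : measurable_fun setT (restrict_algebra F s : Omega -> OF s).
  exact: measurable_restrict_algebra.
have mY : measurable_fun setT incr := measurable_increment s0 (ltW st).
have indep (A : set (OF s)) (B : set E) : measurable A -> measurable B ->
    (P setT * P (restrict_algebra F s @^-1` A `&` incr @^-1` B) =
     P (restrict_algebra F s @^-1` A) * P (incr @^-1` B))%E.
  move=> mA mB; rewrite (increment_law s0 st mB) muleCA; congr (_ * _)%E.
  have [_ _ increment_indep] := BM.
  exact: increment_indep s0 st (filtration_measurable Ffil mA) mB.
rewrite (ge0_integral_indep Pfin mX mY indep mf f0) {1}massE.
rewrite -ge0_integralZl//; first last.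
- by move=> w _; apply: integral_ge0 => z _; rewrite mule_ge0.
- apply: (adapted_measurable_fun Ffil (s := s)).
  apply: (measurable_fun_fubini_tonelli_F (m2 := lam)
    (fun p : OF s * E => (f p * (gauss_density (t - s) p.2)%:E)%E)).
    apply: emeasurable_funM => //; apply/measurable_EFinP.
    exact: (measurableT_comp (@measurable_gauss_density R n (t - s)) measurable_snd).
  by move=> p; rewrite mule_ge0.
apply: eq_integral => w _.
by rewrite -massE; exact: (ge0_integral_increment s0 st (mfw w) (fun z => f0 (w, z))).
Qed.

End BrownianIncrements.

Section Grid.
Variable R : realType.
Implicit Types (N i j k : nat) (a : nat -> R) (t d q c : R).

Lemma sum_blocks a (m K : nat) : (forall i j, (i <= j)%N -> a j <= a i) ->
  \sum_(k < m * K) a k <= m%:R * \sum_(i < K) a (m * i)%N.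
Proof.
move=> a_le; elim: K => [|K ih]; first by rewrite muln0 !big_ord0 mulr0.
rewrite mulnS addnC big_split_ord big_ord_recr /= mulrDr; apply: lerD => //.
rewrite -[leRHS](_ : \sum_(i < m) a (m * K)%N = _); last first.
  by rewrite sumr_const card_ord mulr_natl.
by apply: ler_sum => i _; apply: a_le; rewrite leq_addr.
Qed.

Lemma sum_geometric_decay a q c K : 0 <= q < 1 -> (forall i, 0 <= a i <= c) ->
  (forall i, a i.+2 <= q * a i.+1) -> \sum_(i < K) a i <= c + c / (1 - q).
Proof.
move=> /andP[q0 q1] a_le decay; have q10 : 0 < 1 - q by rewrite subr_gt0.
have c0 : 0 <= c by have /andP[/le_trans] := a_le 0%N; exact.
have sum_tail k : (1 - q) * \sum_(i < k) a i.+1 <= a 1%N - a k.+1.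
  elim: k => [|k ih]; first by rewrite big_ord0 mulr0 subrr.
  by rewrite big_ord_recr /= mulrDr; have := decay k; lra.
case: K => [|K]; first by rewrite big_ord0 addr_ge0// divr_ge0// ltW.
rewrite big_ord_recl lerD//; first by case/andP: (a_le 0%N).
rewrite ler_pdivlMr// mulrC; apply: (le_trans (sum_tail K)).
by have /andP[_ ?] := a_le 1%N; have /andP[? _] := a_le K.+1; lra.
Qed.

(* The left-hand side is [a] evaluated at the grid point following [t]. *)
Lemma step_sum a d t K : 0 < d ->
  exists2 j, a 0%N + \sum_(k < K) (a k.+1 - a k) * (k%:R * d < t)%R%:R = a j &
    [/\ (j <= K)%N, (j < K)%N -> t <= j%:R * d & (0 < j)%N -> j.-1%:R * d < t].
Proof.
move=> d0; elim: K => [|K [j sumE [jK tj jt]]]; first by exists 0%N; rewrite ?big_ord0 ?addr0.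
rewrite big_ord_recr /= addrA sumE; case: (ltP (K%:R * d) t) => Kt.
  exists K.+1; last by split => //; rewrite ltnn.
  suff -> : j = K by rewrite mulr1; ring.
  apply/eqP; rewrite eqn_leq jK leqNgt; apply/negP => /tj /(lt_le_trans Kt).
  by rewrite ltr_pM2r// ltr_nat ltnNge jK.
exists j; first by rewrite mulr0 addr0.
split => //; first exact: leqW.
by rewrite ltnS leq_eqVlt => /orP[/eqP->|].
Qed.

Lemma near_harmonic (Q : R -> Prop) :
  (\forall d \near 0^'+, Q d) -> \forall N \near \oo, Q (harmonic N).
Proof.
move=> Q0; have cvg0 : (@harmonic R) @ \oo --> 0 by exact: cvg_harmonic.
have Q_harmonic : \forall N \near \oo, 0 < harmonic N -> Q (harmonic N) := cvg0 _ Q0.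
by apply: filterS Q_harmonic => N; apply; exact: harmonic_gt0.
Qed.

Definition steps N : nat := (N.+1 * N.+1)%N.
Definition grid N k : R := k%:R * harmonic N.

Lemma natr_harmonic N : N.+1%:R * harmonic N = 1 :> R.
Proof. by rewrite mulfV// pnatr_eq0. Qed.

Lemma grid_ge0 N k : 0 <= grid N k.
Proof. by rewrite mulr_ge0// ltW// harmonic_gt0. Qed.

Lemma gridS N k : grid N k.+1 = grid N k + harmonic N.
Proof. by rewrite /grid -natr1 mulrDl mul1r. Qed.

Lemma grid1 N : grid N 1 = harmonic N.
Proof. by rewrite /grid mul1r. Qed.

Lemma gridM N k : grid N (k * N.+1) = k%:R.
Proof. by rewrite /grid natrM -mulrA natr_harmonic mulr1. Qed.

Lemma grid_lt N k : grid N k < grid N k.+1.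
Proof. by rewrite gridS ltrDl harmonic_gt0. Qed.

Lemma grid_le N i j : (i <= j)%N -> grid N i <= grid N j.
Proof. by move=> ij; rewrite ler_pM2r ?harmonic_gt0// ler_nat. Qed.

End Grid.

Section StoppedBrownianMotion.
Context (R : realType) (n : nat) (dO : measure_display) (Omega : measurableType dO).
Local Notation V := 'rV[R]_(n.+1).
Local Notation E := (Rd R n).
Local Notation bmeas := (@bounded_measurable _ E R).
Local Notation heat_kernel := (@heat_kernel R n).
Local Notation mesh := (@harmonic R).
Local Notation grid := (@grid R).
Variables (lam : lebesgueRd R n) (P : {measure set Omega -> \bar R}).
Variables (F : R -> set (set Omega)) (W : R -> Omega -> V).
Hypotheses (Ffil : filtration F) (BM : brownian_motion lam P F W).
Hypotheses (Pfin : (P setT < +oo)%E) (Ppos : P setT != 0%E).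
Local Notation OF s := (g_sigma_algebraType (F s)).
Local Notation mass := (fine (P setT)).
Implicit Types (s t r e M L : R) (w : Omega) (x y : V) (f g : V -> R) (N i k : nat).

Lemma markov_heat_kernel s t r x (X : Omega -> R) : 0 <= s -> s < t -> 0 < r ->
  @measurable_fun _ _ (OF s) R setT X -> (forall w, 0 <= X w) ->
  \int[P]_w (X w * heat_kernel r x (W t w)) =
  \int[P]_w (X w * heat_kernel (r + (t - s)) x (W s w)).
Proof.
move=> s0 st r0 mX X0; have ts : 0 < t - s by rewrite subr_gt0.
pose f (p : OF s * E) : \bar R := (X p.1 * heat_kernel r (x - W s p.1) (p.2 : V))%:E.
have mf : measurable_fun setT f.
  apply/measurable_EFinP; apply: measurable_funM.
    exact: (measurableT_comp mX measurable_fst).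
  apply: measurable_heat_kernel_comp; last exact: measurable_snd.
  apply: measurable_row_sub; first exact: measurable_cst.
  exact: (measurableT_comp (adapted_W BM s0) measurable_fst).
have f0 p : (0 <= f p)%E by rewrite lee_fin mulr_ge0// heat_kernel_ge0.
congr fine; transitivity (\int[P]_w f (w, (W t w - W s w)%R))%E.
  apply: eq_integral => w _; congr (_ * gauss_density _ _)%:E.
  by rewrite opprB addrA subrK.
rewrite (ge0_integral_past_increment Ffil BM Pfin Ppos s0 st mf f0).
apply: eq_integral => w _; set z := x - W s w.
have kernel_i := RintegrableM_heat_kernel lam 0 ts (bounded_measurable_heat_kernel z r0).
have -> : heat_kernel (r + (t - s)) x (W s w) = heat lam (t - s) (heat_kernel r z) 0.
  by rewrite heat_kernel_semigroup// /heat_kernel sub0r opprB.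
rewrite -RintegralZl// EFin_Rintegral; last exact: RintegrableZ.
by apply: eq_integral => y _; rewrite -EFinM /f /= -mulrA /heat_kernel subr0.
Qed.

Lemma Rintegrable_comp_W t g M : bmeas g M -> 0 <= t -> Rintegrable P (fun w => g (W t w)).
Proof.
move=> gM t0; apply: (bounded_Rintegrable Pfin (M := M)); split=> [|w]; last exact: gM.2.
exact: (measurableT_comp gM.1 (measurable_W Ffil BM t0)).
Qed.

Lemma path_near w t e : 0 <= t -> 0 < e ->
  \forall d \near 0^'+, forall s, 0 <= s -> `|s - t| <= d -> enorm (W s w - W t w) <= e.
Proof.
move=> t0 e0; have [/(_ w) W_cont _ _] := BM.
have t_in : t \in @Rplus R by rewrite inE /Rplus /= in_itv /= andbT.
have n0 : 0 < n.+1%:R :> R by rewrite ltr0n.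
have /subspace_continuousP/(_ t (set_mem t_in))/cvgrPdist_le/(_ _ (divr_gt0 e0 n0)) := W_cont.
rewrite /prop_near1 /within /= => /nbhs_ballP[r /= r0 rP].
near=> d => s s0 st; apply: (le_trans (enorm_le_norm _)).
rewrite mulrC -ler_pdivlMr// distrC; apply: rP.
  rewrite /ball /= distrC (le_lt_trans st)//; near: d; exact: nbhs_right_lt.
by rewrite /Rplus /= in_itv /= andbT.
Unshelve. all: by end_near.
Qed.

Variable tau : Omega -> probability R R.
Hypothesis rst : randomized_stopping_time F tau.

Let tau_fin w (A : set R) : measurable A -> tau w A \is a fin_num.
Proof. by move=> mA; rewrite ge0_fin_numE// (le_lt_trans (probability_le1 _ mA))// ltry. Qed.

Definition survival t w : R := 1 - fine (tau w `[0, t]%classic).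

Lemma survival_ge0 t w : 0 <= survival t w.
Proof.
by rewrite subr_ge0 -lee_fin fineK ?tau_fin//; exact: probability_le1.
Qed.

Lemma survival_le1 t w : survival t w <= 1.
Proof. by rewrite gerBl fine_ge0. Qed.

Lemma survival_nonincreasing s t w : s <= t -> survival t w <= survival s w.
Proof.
move=> st; rewrite lerD2l lerN2 fine_le ?tau_fin//.
apply: le_measure; rewrite ?inE// => x /=; rewrite !in_itv /= => /andP[-> xs].
exact: le_trans xs st.
Qed.

Lemma survivalE t w : 0 <= t -> survival t w = fine (tau w `]t, +oo[%classic).
Proof.
move=> t0; have [/(_ w) tau1 _] := rst.
have : tau w (@Rplus R) = (tau w `[0%R, t]%classic + tau w `]t, +oo[%classic)%E.
  rewrite -measureU//; last first.
    apply/seteqP; split=> [x [/=]|]//; rewrite !in_itv /= andbT => /andP[_ xt] tx.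
    by have := le_lt_trans xt tx; rewrite ltxx.
  congr (tau w _); apply/seteqP; split => [x|x] /=; rewrite /Rplus /= !in_itv /= ?andbT.
    by move=> x0; case: (leP x t) => xt; [left; rewrite x0|right].
  by case=> [/andP[]//|tx]; rewrite (le_trans t0)// ltW.
rewrite tau1 /survival -(fineK (tau_fin w (measurable_itv `[0, t]))).
rewrite -(fineK (tau_fin w (measurable_itv `]t, +oo[))) -EFinD => -[] /= ->.
by rewrite addrAC subrr add0r.
Qed.

Lemma adapted_survival t : 0 <= t -> @measurable_fun _ _ (OF t) R setT (survival t).
Proof.
move=> t0; have [_ /(_ t t0) mt] := rst.
apply: measurable_funB; first exact: measurable_cst.
exact: (measurableT_comp (fine_measurable measurableT)).
Qed.

Lemma bounded_measurable_survival t : 0 <= t -> bounded_measurable (survival t) 1.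
Proof.
move=> t0; split; first exact: (adapted_measurable_fun Ffil (adapted_survival t0)).
by move=> w; rewrite ger0_norm ?survival_ge0 ?survival_le1.
Qed.

Lemma Rintegrable_survival t : 0 <= t -> Rintegrable P (survival t).
Proof. by move=> t0; exact: bounded_Rintegrable Pfin (bounded_measurable_survival t0). Qed.

Definition mean_survival t : R := \int[P]_w survival t w.

Lemma mean_survival_nonincreasing s t : 0 <= s -> s <= t -> mean_survival t <= mean_survival s.
Proof.
move=> s0 st; apply: le_Rintegral => //.
- exact/Rintegrable_survival/(le_trans s0).
- exact: Rintegrable_survival.
- by move=> w _; exact: survival_nonincreasing.
Qed.

Lemma mean_survival_ge0 t : 0 <= mean_survival t.
Proof. by apply: Rintegral_ge0 => w _; exact: survival_ge0. Qed.

Lemma mean_survival_le_mass t : 0 <= t -> mean_survival t <= mass.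
Proof.
move=> t0; rewrite -[leRHS]mul1r -(Rintegral_cst P measurableT 1); apply: le_Rintegral => //.
- exact: Rintegrable_survival.
- exact: Rintegrable_cst.
- by move=> w _; exact: survival_le1.
Qed.

Lemma mean_survival_increment s t (A : set E) : 0 <= s -> s < t -> measurable A ->
  \int[P]_w (survival s w * \1_A (W t w - W s w)) =
  mean_survival s * fine (gauss lam (t - s) A).
Proof.
move=> s0 st mA; have ts : 0 < t - s by rewrite subr_gt0.
have mI : measurable_fun setT (\1_A : E -> R) by exact: measurable_indic.
pose f (p : OF s * E) : \bar R := (survival s p.1 * \1_A (p.2 : V))%:E.
have mf : measurable_fun setT f.
  apply/measurable_EFinP; apply: measurable_funM.
    exact: (measurableT_comp (adapted_survival s0) measurable_fst).
  exact: (measurableT_comp mI measurable_snd).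
have f0 p : (0 <= f p)%E by rewrite lee_fin mulr_ge0// survival_ge0.
rewrite -(RintegralZr _ measurableT (Rintegrable_survival s0)); congr fine.
transitivity (\int[P]_w f (w, (W t w - W s w)%R))%E; first by [].
rewrite (ge0_integral_past_increment Ffil BM Pfin Ppos s0 st mf f0).
apply: eq_integral => w _; rewrite EFinM fineK ?gauss_fin_num// -ge0_integralZl//; first last.
- by rewrite lee_fin survival_ge0.
- by move=> z _; rewrite lee_fin gauss_density_ge0.
- by apply/measurable_funTS/measurable_EFinP; exact: measurable_gauss_density.
rewrite [RHS]integral_mkcond; apply: eq_integral => z _; rewrite /f /= patchE indicE.
by case: (_ \in _); rewrite ?mulr1 ?mulr0 ?mul0e ?mule0.
Qed.

Variables (U : set V) (rad : R).
Hypotheses (exitU : before_exit U W tau) (Urad : U `<=` cube rad).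

Lemma survival_out t w : 0 < t -> ~ U (W t w) -> survival t w = 0.
Proof.
move=> t0 Ut; rewrite survivalE ?ltW//.
suff -> : tau w `]t, +oo[%classic = 0%E by [].
have m_exit : measurable [set s : R | (exit_time U W w < s%:E)%E].
  rewrite -[X in measurable X]setTI.
  exact: emeasurable_fun_o_infty.
apply/eqP; rewrite eq_le measure_ge0 andbT -(exitU w).
apply: le_measure; rewrite ?inE// => s /=; rewrite in_itv /= andbT => ts.
rewrite (@le_lt_trans _ _ t%:E)// ?lte_fin//.
by apply: ereal_inf_lbound; exists t.
Qed.

Lemma survival_le_increment s t w : 0 < s -> s < t ->
  survival t w <= survival s w * \1_(cube (2 * rad)) (W t w - W s w).
Proof.
move=> s0 st; have survival_st := survival_nonincreasing w (ltW st).
have [Us|/(survival_out s0) out] := pselect (U (W s w)); last by rewrite out mul0r -out.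
have [Ut|/(survival_out (lt_trans s0 st)) ->] := pselect (U (W t w)); last first.
  by rewrite mulr_ge0// survival_ge0.
rewrite indicE mem_set ?mulr1// => i; have := Urad Us i; have := Urad Ut i.
by rewrite !mxE => /andP[? ?] /andP[? ?]; apply/andP; split; lra.
Qed.

Lemma mean_survival_decay : exists2 q : R, 0 <= q < 1 &
  forall t, 0 < t -> mean_survival (t + 1) <= q * mean_survival t.
Proof.
have mC : measurable (cube (2 * rad) : set E) by exact: measurable_box.
exists (fine (gauss lam 1 (cube (2 * rad)))).
  rewrite fine_ge0/=; last by apply: integral_ge0 => x _; rewrite lee_fin gauss_density_ge0.
  apply: gauss_lt1 => //; pose c : V := const_mx (2 * rad + 2).
  apply: (lt_le_trans (lebesgue_cball_gt0 (lebesgueRdP lam) c ltr01)).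
  apply: le_measure; rewrite ?inE; [exact: measurable_cball|exact: measurableC|].
  move=> y; rewrite cball_eE// => yc /(_ ord0); rewrite !mxE => /andP[_ y_le].
  have := le_trans (coord_le_enorm _ ord0) yc; rewrite !mxE ler_norml => /andP[? _]; lra.
move=> t t0; have t1 : t < t + 1 by rewrite ltrDl.
have := mean_survival_increment (ltW t0) t1 mC; rewrite addrAC subrr add0r [leRHS]mulrC => <-.
have t10 : 0 <= t + 1 by rewrite ltW// addr_gt0.
apply: le_Rintegral => //; first exact: Rintegrable_survival.
- apply: (RintegrableM (Rintegrable_survival (ltW t0)) (M := 1)).
  split=> [|w]; last exact: (bounded_measurable_indic R mC).2.
  apply: (measurableT_comp (measurable_indic mC)).
  exact: (measurable_increment Ffil BM (ltW t0) (ltW t1)).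
- by move=> w _; exact: survival_le_increment.
Qed.

Lemma Rintegrable_survivalW g M s t : bmeas g M -> 0 <= s -> 0 <= t ->
  Rintegrable P (fun w => survival s w * g (W t w)).
Proof.
move=> gM s0 t0; apply: (RintegrableM (Rintegrable_survival s0) (M := M)).
split=> [|w]; last exact: gM.2.
exact: (measurableT_comp gM.1 (measurable_W Ffil BM t0)).
Qed.

Definition occupation_term N g k : R :=
  \int[P]_w (survival (grid N k) w * g (W (grid N k) w)).

(* Riemann sum for the mean of the time integral of [g (W t)] up to time [tau]. *)
Definition occupation N g : R := mesh N * \sum_(k < steps N) occupation_term N g k.

Lemma occupation_term_le N g M (a : R) k : bmeas g M ->
  (forall w, survival (grid N k) w != 0 -> g (W (grid N k) w) <= a) ->
  occupation_term N g k <= a * mean_survival (grid N k).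
Proof.
move=> gM ga; have k0 := grid_ge0 R N k; have surv_i := Rintegrable_survival k0.
rewrite -(RintegralZl a measurableT surv_i); apply: le_Rintegral => //.
- exact: Rintegrable_survivalW gM _ _.
- exact: RintegrableZ.
- move=> w _; rewrite mulrC; have [->|/ga ga_w] := eqVneq (survival (grid N k) w) 0.
    by rewrite !mulr0.
  by rewrite ler_wpM2r ?survival_ge0.
Qed.

Lemma mean_survival_sum_le : exists2 C : R, 0 <= C &
  forall N, mesh N * \sum_(k < steps N) mean_survival (grid N k) <= C.
Proof.
have [q q01 decay] := mean_survival_decay; have /andP[q0 q1] := q01.
exists (mass + mass / (1 - q)).
  by rewrite addr_ge0 ?divr_ge0 ?fine_ge0// subr_ge0 ltW.
move=> N; have m0 := harmonic_ge0 (R := R) N.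
have survival_grid_le i j : (i <= j)%N -> mean_survival (grid N j) <= mean_survival (grid N i).
  by move=> ij; apply: mean_survival_nonincreasing; [exact: grid_ge0|exact: grid_le].
apply: le_trans (ler_wpM2l m0 (sum_blocks N.+1 N.+1 survival_grid_le)) _.
rewrite mulrA [mesh N * _]mulrC natr_harmonic mul1r.
under eq_bigr do rewrite mulnC gridM.
apply: (@sum_geometric_decay _ (fun i => mean_survival i%:R)) => // i.
  by rewrite mean_survival_ge0 mean_survival_le_mass.
by rewrite -natr1; exact: decay.
Qed.

Definition occupation_mass : R := sval (cid2 mean_survival_sum_le).

Lemma occupation_mass_ge0 : 0 <= occupation_mass.
Proof. by rewrite /occupation_mass; case: cid2. Qed.

Lemma mean_survival_le_occupation_mass N :
  mesh N * \sum_(k < steps N) mean_survival (grid N k) <= occupation_mass.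
Proof. by rewrite /occupation_mass; case: cid2. Qed.

Lemma occupation_le N g M (a : R) : bmeas g M -> 0 <= a -> (forall x, g x <= a) ->
  occupation N g <= a * occupation_mass.
Proof.
move=> gM a0 ga; apply: le_trans (ler_wpM2l a0 (mean_survival_le_occupation_mass N)).
rewrite mulrCA ler_wpM2l ?harmonic_ge0// mulr_sumr; apply: ler_sum => k _.
exact: occupation_term_le gM _.
Qed.

Lemma occupation_ge0 N g : (forall x, 0 <= g x) -> 0 <= occupation N g.
Proof.
move=> g0; rewrite mulr_ge0 ?harmonic_ge0//; apply: sumr_ge0 => k _.
by apply: Rintegral_ge0 => w _; rewrite mulr_ge0// survival_ge0.
Qed.

(* Only at time 0 may the surviving path be outside [U]. *)
Lemma occupation_le_in N g M (a : R) : bmeas g M -> 0 <= a -> (forall x, U x -> g x <= a) ->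
  occupation N g <= a * occupation_mass + mesh N * (M * mass).
Proof.
move=> gM a0 ga; have M0 := bounded_measurable_ge0 gM 0.
have term_le k : occupation_term N g k <=
    a * mean_survival (grid N k) + (if k == 0%N then M * mass else 0).
  case: k => [|k] /=.
    apply: (@le_trans _ _ (M * mean_survival (grid N 0))).
      by apply: (occupation_term_le gM) => w _; exact: le_trans (ler_norm _) (gM.2 _).
    rewrite -[leLHS]add0r lerD ?mulr_ge0 ?mean_survival_ge0// ler_wpM2l//.
    by rewrite mean_survival_le_mass ?grid_ge0.
  rewrite addr0; apply: (occupation_term_le gM) => w /eqP sw; apply: ga.
  by apply: contrapT => /survival_out out; apply/sw/out; rewrite mulr_gt0 ?harmonic_gt0.
apply: (@le_trans _ _ (mesh N * \sum_(k < steps N) (a * mean_survival (grid N k) +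
    (if (k : nat) == 0%N then M * mass else 0)))).
  by rewrite ler_wpM2l ?harmonic_ge0//; apply: ler_sum => k _; exact: term_le.
rewrite big_split /= mulrDr lerD//.
  by rewrite -mulr_sumr mulrCA ler_wpM2l ?mean_survival_le_occupation_mass.
by rewrite ler_wpM2l ?harmonic_ge0// /steps mulSn addSn big_ord_recl /= big1 ?addr0.
Qed.

Definition rounded_path N g w t : R := g (W 0 w) +
  \sum_(k < steps N) (g (W (grid N k.+1) w) - g (W (grid N k) w)) * (grid N k < t)%R%:R.

Lemma rounded_pathP N g w t : exists2 j, rounded_path N g w t = g (W (grid N j) w) &
  [/\ (j <= steps N)%N, (j < steps N)%N -> t <= grid N j & (0 < j)%N -> grid N j.-1 < t].
Proof.
rewrite /rounded_path -[X in W X w](mul0r (mesh N)).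
exact: (step_sum (fun k => g (W (grid N k) w)) t (steps N) (harmonic_gt0 N)).
Qed.

Lemma rounded_path_near w t e : 0 < e -> \forall N \near \oo, forall g,
  exists2 s, rounded_path N g w t = g (W s w) & enorm (W s w - W (Num.max t 0) w) <= e.
Proof.
move=> e0; have [t0|t0] := leP t 0.
  apply: nearW => N g; have [j -> [_ _ jt]] := rounded_pathP N g w t.
  exists (grid N j) => //; suff -> : grid N j = 0 by rewrite subrr enorm0 ltW.
  case: j jt => [_|j /(_ erefl) /=]; first by rewrite /grid mul0r.
  by rewrite ltNge (le_trans t0 (grid_ge0 R N j)).
near=> N => g; have [j -> [jK tj jt]] := rounded_pathP N g w t.
exists (grid N j) => //.
suff : `|grid N j - t| <= mesh N.
  by apply: (near (near_harmonic (path_near w (ltW t0) e0)) N) => //; exact: grid_ge0.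
have t_le : t <= grid N j.
  move: jK; rewrite leq_eqVlt => /orP[/eqP->|]; last exact: tj.
  rewrite gridM -natr1 (@le_trans _ _ N%:R) ?lerDl//.
  by near: N; exact: nbhs_infty_ger.
have j0 : (0 < j)%N by case: j t_le {tj jt jK} => //; rewrite /grid mul0r leNgt t0.
rewrite ger0_norm ?subr_ge0//; have := jt j0.
by rewrite -[j in X in _ -> X](prednK j0) gridS lerBlDr addrC lerD2l => /ltW.
Unshelve. all: by end_near.
Qed.

Lemma rounded_path_cvg (f_ : nat -> V -> R) L w t : (forall N, elipschitz L (f_ N)) ->
  (rounded_path N (f_ N) w t - f_ N (W (Num.max t 0) w)) @[N --> \oo] --> 0.
Proof.
move=> fL; have L0 := elipschitz_ge0 (fL 0%N); have L1 : 0 < L + 1 by rewrite ltr_wpDl.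
apply/cvgrPdist_le => e e0.
apply: filterS (rounded_path_near w t (divr_gt0 e0 L1)) => N /(_ (f_ N))[s -> s_le].
rewrite sub0r normrN; apply: (le_trans (fL N _ _)); apply: (@le_trans _ _ (L * (e / (L + 1)))).
  by rewrite ler_wpM2l.
by rewrite mulrCA ler_piMr ?(ltW e0)// ler_pdivrMr// mul1r lerDl.
Qed.

Lemma gt_indicE (a : R) : (fun t => (a < t)%R%:R) = \1_(`]a, +oo[%classic) :> (R -> R).
Proof. by apply/funext => t; rewrite indicE mem_setE in_itv /= andbT. Qed.

Lemma bounded_measurable_rounded_path N g M w : bmeas g M ->
  bounded_measurable (rounded_path N g w) M.
Proof.
move=> gM; split=> [|t]; last by have [j -> _] := rounded_pathP N g w t; exact: gM.2.
apply: measurable_funD; first exact: measurable_cst.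
apply: measurable_sum => k; apply: measurable_funM; first exact: measurable_cst.
by rewrite gt_indicE; exact: measurable_indic.
Qed.

Lemma bounded_measurable_path g M L w : bmeas g M -> elipschitz L g ->
  bounded_measurable (fun t : R => g (W (Num.max t 0) w)) M.
Proof.
move=> gM gL; split=> [|t]; last exact: gM.2.
apply: (@measurable_fun_cvg _ _ _ _ (fun N => rounded_path N g w)).
  by move=> N; exact: (bounded_measurable_rounded_path N w gM).1.
move=> t _; have /cvg_sub0 := rounded_path_cvg w t (fun=> gL).
by apply; exact: cvg_cst.
Qed.

Let tau_lty w : (tau w setT < +oo)%E. Proof. by rewrite probability_setT ltry. Qed.

Let normr_tau_mean_le w (f : R -> R) M : bounded_measurable f M -> `|\int[tau w]_t f t| <= M.
Proof.
move=> fM; rewrite -[leRHS](Rintegral_probability_cst M (probability_setT (tau w))).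
apply: normr_Rintegral_le fM.2; first exact: (bounded_Rintegrable (tau_lty w) fM).
exact: (Rintegrable_cst M (tau_lty w)).
Qed.

Definition rounded_stopped N g w : R := \int[tau w]_t rounded_path N g w t.
Definition stopped g w : R := \int[tau w]_t g (W (Num.max t 0) w).

Lemma rounded_stoppedE N g w : rounded_stopped N g w = g (W 0 w) +
  \sum_(k < steps N) (g (W (grid N k.+1) w) - g (W (grid N k) w)) * survival (grid N k) w.
Proof.
have after_i k : Rintegrable (tau w) (fun t => (grid N k < t)%R%:R).
  by rewrite gt_indicE; apply: Rintegrable_indic => //; rewrite -ge0_fin_numE ?tau_fin.
have term_i k := RintegrableZ (g (W (grid N k.+1) w) - g (W (grid N k) w)) (after_i k).
rewrite /rounded_stopped RintegralD//; last 2 first.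
- exact: (Rintegrable_cst _ (tau_lty w)).
- by apply: Rintegrable_sum => k; exact: term_i.
rewrite (Rintegral_probability_cst _ (probability_setT (tau w))); congr (_ + _).
rewrite Rintegral_sum => [|k]; last exact: term_i.
apply: eq_bigr => k _; rewrite (RintegralZl _ measurableT (after_i k)); congr (_ * _).
by rewrite gt_indicE Rintegral_indic// survivalE// grid_ge0.
Qed.

Lemma bounded_measurable_rounded_stopped N g M : bmeas g M ->
  bounded_measurable (rounded_stopped N g) M.
Proof.
move=> gM; have measurable_gW t : 0 <= t -> measurable_fun setT (fun w => g (W t w)).
  by move=> t0; exact: (measurableT_comp gM.1 (measurable_W Ffil BM t0)).
split=> [|w]; last exact: normr_tau_mean_le (bounded_measurable_rounded_path N w gM).
rewrite (funext (rounded_stoppedE N g)).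
apply: measurable_funD; first exact: measurable_gW.
apply: measurable_sum => k; apply: measurable_funM.
  by apply: measurable_funB; apply: measurable_gW; exact: grid_ge0.
exact: (bounded_measurable_survival (grid_ge0 R N k)).1.
Qed.

Lemma rounded_stopped_cvg (f_ : nat -> V -> R) M L w : (forall N, bmeas (f_ N) M) ->
  (forall N, elipschitz L (f_ N)) ->
  (rounded_stopped N (f_ N) w - stopped (f_ N) w) @[N --> \oo] --> 0.
Proof.
move=> fM fL; have round_M N := bounded_measurable_rounded_path N w (fM N).
have path_M N := bounded_measurable_path w (fM N) (fL N).
have := bounded_cvg_Rintegral (tau_lty w)
  (fun N => bounded_measurableB (round_M N) (path_M N)) (fun t => rounded_path_cvg w t fL).
rewrite Rintegral_cst// mul0r; apply: cvg_trans; apply: near_eq_cvg; near=> N.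
by rewrite RintegralB//; exact: bounded_Rintegrable (tau_lty w) _.
Unshelve. all: by end_near.
Qed.

Lemma bounded_measurable_stopped g M L : bmeas g M -> elipschitz L g ->
  bounded_measurable (stopped g) M.
Proof.
move=> gM gL; split=> [|w]; last exact: normr_tau_mean_le (bounded_measurable_path w gM gL).
apply: (@measurable_fun_cvg _ _ _ _ (fun N => rounded_stopped N g)).
  by move=> N; exact: (bounded_measurable_rounded_stopped N gM).1.
move=> w _; have /cvg_sub0 := rounded_stopped_cvg w (fun=> gM) (fun=> gL).
by apply; exact: cvg_cst.
Qed.

Lemma mean_rounded_stoppedB N g M : bmeas g M ->
  \int[P]_w rounded_stopped N g w - \int[P]_w g (W 0 w) =
  \sum_(k < steps N) (\int[P]_w (survival (grid N k) w * g (W (grid N k.+1) w)) -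
    \int[P]_w (survival (grid N k) w * g (W (grid N k) w))).
Proof.
move=> gM; have next_i k := Rintegrable_survivalW gM (grid_ge0 R N k) (grid_ge0 R N k.+1).
have here_i k := Rintegrable_survivalW gM (grid_ge0 R N k) (grid_ge0 R N k).
have diff_i k := RintegrableB (next_i k) (here_i k).
have -> : \int[P]_w rounded_stopped N g w = \int[P]_w (g (W 0 w) + \sum_(k < steps N)
    (survival (grid N k) w * g (W (grid N k.+1) w) - survival (grid N k) w * g (W (grid N k) w))).
  apply: eq_Rintegral => w _; rewrite rounded_stoppedE; congr (_ + _).
  by apply: eq_bigr => k _; rewrite mulrC mulrBr.
rewrite RintegralD//; last 2 first.
- exact: Rintegrable_comp_W gM _.
- by apply: Rintegrable_sum => k; exact: diff_i.
rewrite addrAC subrr add0r Rintegral_sum => [|k]; last exact: diff_i.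
by apply: eq_bigr => k _; rewrite (RintegralB measurableT (next_i k) (here_i k)).
Qed.

Lemma mean_survival_kernel_potential N i th x s t : 0 < th -> 0 <= s -> 0 <= t ->
  \int[P]_w (survival s w * kernel_potential (mesh N) th i x (W t w)) =
  mesh N * \sum_(j < i) \int[P]_w (survival s w * heat_kernel (th + grid N j.+1) x (W t w)).
Proof.
move=> th0 s0 t0; have time_gt0 j : 0 < th + grid N j by rewrite ltr_wpDr// grid_ge0.
have kernel_i (j : 'I_i) :=
  Rintegrable_survivalW (bounded_measurable_heat_kernel x (time_gt0 j.+1)) s0 t0.
rewrite -Rintegral_sum// -RintegralZl//; last exact: Rintegrable_sum.
by apply: eq_Rintegral => w _; rewrite /kernel_potential mulrCA mulr_sumr.
Qed.

(* By the Markov property each step of the path shifts the terms of the kernel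
   potential by one, so that the sum over its terms telescopes. *)
Lemma mean_rounded_stopped_kernel_potential N i th x : 0 < th ->
  \int[P]_w rounded_stopped N (kernel_potential (mesh N) th i x) w -
    \int[P]_w kernel_potential (mesh N) th i x (W 0 w) =
  occupation N (heat_kernel (th + grid N i.+1) x) - occupation N (heat_kernel (th + grid N 1) x).
Proof.
move=> th0; have time_gt0 j : 0 < th + grid N j by rewrite ltr_wpDr// grid_ge0.
rewrite (mean_rounded_stoppedB N
  (bounded_measurable_kernel_potential (harmonic_gt0 N) th0 i x)).
rewrite /occupation -mulrBr -sumrB mulr_sumr; apply: eq_bigr => k _.
rewrite !mean_survival_kernel_potential ?grid_ge0// -mulrBr; congr (_ * _); rewrite -sumrB.
pose a j := occupation_term N (heat_kernel (th + grid N j.+1) x) k.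
have shift j : \int[P]_w (survival (grid N k) w *
    heat_kernel (th + grid N j.+1) x (W (grid N k.+1) w)) = a j.+1.
  have k0 := grid_ge0 R N k.
  rewrite (markov_heat_kernel x k0 (grid_lt R N k) (time_gt0 j.+1) (adapted_survival k0)).
    by rewrite [_ - _](_ : _ = mesh N) -?addrA -?gridS// gridS addrAC subrr add0r.
  exact: survival_ge0.
transitivity (\sum_(j < i) (a j.+1 - a j)); first by apply: eq_bigr => j _; rewrite shift.
by rewrite -(big_mkord xpredT (fun j => a j.+1 - a j)) telescope_sumr.
Qed.

Section TerminalLaw.
Variables (nu : {measure set E -> \bar R}) (m h : V -> R) (Cm Ch : R).
Hypotheses (mC : bmeas m Cm) (m_ge0 : forall x, 0 <= m x) (m_int : Rintegrable lam m)
  (start : forall B : set E, measurable B ->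
     P [set w | B (W 0 w)] = (\int[lam]_(x in B) (m x)%:E)%E).
Hypotheses (hC : bmeas h Ch) (h_ge0 : forall x, 0 <= h x) (h_int : Rintegrable lam h)
  (nu_h : has_density lam nu h) (nu_lty : (nu setT < +oo)%E) (term : terminal_law P W tau nu).

Lemma mean_initial g M : bmeas g M -> (forall x, 0 <= g x) ->
  \int[P]_w g (W 0 w) = \int[lam]_x (g x * m x).
Proof.
move=> gM g0; congr fine.
have [p pE p_int] := image_measure P (measurable_W Ffil BM (lexx 0)).
have p_m : has_density lam p m by move=> A mA; rewrite pE; exact: start.
have p_lty : (p setT < +oo)%E by rewrite pE.
have mg : measurable_fun setT (EFin \o (g : E -> R)) by apply/measurable_EFinP; exact: gM.1.
by rewrite -(ge0_Rintegral_density p_lty mC.1 m_ge0 p_m gM.1 g0) (p_int _ mg).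
Qed.

Lemma mean_stopped g M L : bmeas g M -> (forall x, 0 <= g x) -> elipschitz L g ->
  \int[P]_w stopped g w = \int[lam]_x (g x * h x).
Proof.
move=> gM g0 gL; congr fine.
rewrite -(ge0_Rintegral_density nu_lty hC.1 h_ge0 nu_h gM.1 g0) -(term gM.1 g0).
apply: eq_integral => w _.
have path_i := bounded_Rintegrable (tau_lty w) (bounded_measurable_path w gM gL).
rewrite (EFin_Rintegral path_i); have mR : measurable (@Rplus R) by exact: measurable_itv.
have [/(_ w) tau1 _] := rst.
have off0 : tau w (~` @Rplus R) = 0%E by rewrite probability_setC// tau1 subee.
rewrite (@negligible_integral _ _ _ (tau w) setT (~` @Rplus R))//; last exact: measurableC.
rewrite setTD setCK; apply: eq_integral => t; rewrite inE /Rplus /= in_itv /= andbT => t0.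
by rewrite max_l.
Qed.

Lemma mean_rounded_stopped_cvg (f_ : nat -> V -> R) M L : (forall N, bmeas (f_ N) M) ->
  (forall N x, 0 <= f_ N x) -> (forall N, elipschitz L (f_ N)) ->
  (\int[P]_w rounded_stopped N (f_ N) w - \int[lam]_x (f_ N x * h x)) @[N --> \oo] --> 0.
Proof.
move=> fM f0 fL; have round_M N := bounded_measurable_rounded_stopped N (fM N).
have stop_M N := bounded_measurable_stopped (fM N) (fL N).
have := bounded_cvg_Rintegral Pfin
  (fun N => bounded_measurableB (round_M N) (stop_M N)) (fun w => rounded_stopped_cvg w fM fL).
rewrite Rintegral_cst// mul0r; apply: cvg_trans; apply: near_eq_cvg; near=> N.
rewrite -(mean_stopped (fM N) (f0 N) (fL N)) RintegralB//.
- exact: bounded_Rintegrable Pfin (round_M N).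
- exact: bounded_Rintegrable Pfin (stop_M N).
Unshelve. all: by end_near.
Qed.

Definition defect x : R := m x - h x.
Definition defect_potential N S : V -> R := heat_potential lam (mesh N) defect (S * N.+1).

Lemma bounded_measurable_defect : bmeas defect (Cm + Ch).
Proof. exact: bounded_measurableB. Qed.

Let steps_time N S : (S * N.+1)%:R * mesh N = S%:R := gridM R N S.

Lemma bounded_measurable_defect_potential N S :
  bmeas (defect_potential N S) (S%:R * (Cm + Ch)).
Proof.
rewrite -(steps_time N S).
exact: bounded_measurable_heat_potential (harmonic_gt0 N) bounded_measurable_defect _.
Qed.

Lemma elipschitz_defect_potential N S :
  elipschitz (4 * (Cm + Ch) * gauss_shift_cst R n * Num.sqrt S%:R) (defect_potential N S).
Proof.
rewrite -(steps_time N S).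
exact: heat_potential_elipschitz (harmonic_gt0 N) bounded_measurable_defect _.
Qed.

Lemma defect_potential_near S th e : 0 < th -> 0 < e -> \forall N \near \oo, forall x,
  `|heat lam th (defect_potential N S) x - (occupation N (heat_kernel (th + grid N 1) x) -
     occupation N (heat_kernel (th + grid N (S * N.+1).+1) x))| <= e.
Proof.
move=> th0 e0; pose close N x := `|heat lam th (defect_potential N S) x -
  (occupation N (heat_kernel (th + grid N 1) x) -
   occupation N (heat_kernel (th + grid N (S * N.+1).+1) x))| <= e.
(* A worst [x] for each [N] makes the pointwise convergence uniform. *)
pose x_ N : V := xget 0 [set x | ~ close N x].
suff : \forall N \near \oo, close N (x_ N).
  apply: filterS => N close_N x; apply: contrapT => far.
  have : ~ close N (x_ N) by apply: (@xgetPex _ 0 [set x | ~ close N x]); exists x.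
  exact.
pose f_ N := kernel_potential (mesh N) th (S * N.+1) (x_ N).
have mesh0 N := harmonic_gt0 (R := R) N.
have fM N : bmeas (f_ N) (S%:R * gauss_cst n th).
  by rewrite -(steps_time N S); exact: bounded_measurable_kernel_potential.
have f0 N x : 0 <= f_ N x by exact: kernel_potential_ge0.
have fL N : elipschitz (S%:R * (2 * gauss_shift_cst R n * gauss_cst n th / Num.sqrt th)) (f_ N).
  by rewrite -(steps_time N S); exact: kernel_potential_elipschitz.
have /cvgrPdist_le/(_ e e0) := mean_rounded_stopped_cvg fM f0 fL.
apply: filterS => N; rewrite sub0r normrN /close.
rewrite (heat_potential_kernelE lam (mesh0 N) th0 _ (x_ N) bounded_measurable_defect).
have := mean_rounded_stopped_kernel_potential N (S * N.+1) (x_ N) th0.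
rewrite -/(f_ N) (mean_initial (fM N) (f0 N)) => telescope.
have -> : \int[lam]_y (f_ N y * defect y) =
    \int[lam]_y (f_ N y * m y) - \int[lam]_y (f_ N y * h y).
  rewrite -RintegralB//.
  - by apply: eq_Rintegral => y _; rewrite mulrBr.
  - by under eq_fun do rewrite mulrC; exact: RintegrableM m_int (fM N).
  - by under eq_fun do rewrite mulrC; exact: RintegrableM h_int (fM N).
move: telescope; move: (Rintegral P _ _) (Rintegral lam _ _) (Rintegral lam _ _).
move: (occupation N _) (occupation N _) => early late final terminal initial telescope.
by rewrite (_ : initial - terminal - (early - late) = final - terminal); lra.
Qed.

Lemma occupation_heat_kernel_ge0 N t x : 0 < t -> 0 <= occupation N (heat_kernel t x).
Proof. by move=> t0; apply: occupation_ge0 => y; exact: heat_kernel_ge0. Qed.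

Lemma occupation_heat_kernel_le N s t x : 0 < s -> s <= t ->
  occupation N (heat_kernel t x) <= gauss_cst n s * occupation_mass.
Proof.
move=> s0 st; have t0 := lt_le_trans s0 st.
apply: (occupation_le N (bounded_measurable_heat_kernel x t0)); first exact: gauss_cst_ge0.
by move=> y; apply: (le_trans (heat_kernel_le_cst _ _ t0)); exact: gauss_cst_le.
Qed.

Let time_gt0 th N k : 0 < th -> 0 < th + grid N k.
Proof. by move=> th0; rewrite ltr_wpDr// grid_ge0. Qed.

Lemma heat_defect_potential_ge S th e : (0 < S)%N -> 0 < th -> 0 < e ->
  \forall N \near \oo, forall x,
    - (gauss_cst n S%:R * occupation_mass) - e <= heat lam th (defect_potential N S) x.
Proof.
move=> S0 th0 e0; apply: filterS (defect_potential_near S th0 e0) => N close x.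
have := close x; rewrite ler_norml => /andP[+ _].
have := occupation_heat_kernel_ge0 N x (time_gt0 N 1 th0).
have S_le : S%:R <= th + grid N (S * N.+1).+1.
  by rewrite gridS gridM; have := harmonic_gt0 (R := R) N; lra.
have S0' : 0 < S%:R :> R by rewrite ltr0n.
have := occupation_heat_kernel_le N x S0' S_le.
by move: (occupation N _) (occupation N _) (heat _ _ _ _) (_ * occupation_mass) => *; lra.
Qed.

Lemma heat_defect_potential_le S th e : 0 < th -> 0 < e -> \forall N \near \oo, forall x,
  heat lam th (defect_potential N S) x <= gauss_cst n th * occupation_mass + e.
Proof.
move=> th0 e0; apply: filterS (defect_potential_near S th0 e0) => N close x.
have := close x; rewrite ler_norml => /andP[_].
have := occupation_heat_kernel_ge0 N x (time_gt0 N (S * N.+1).+1 th0).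
have th_le : th <= th + grid N 1 by rewrite lerDl grid_ge0.
have := occupation_heat_kernel_le N x th0 th_le.
by move: (occupation N _) (occupation N _) (heat _ _ _ _) (_ * occupation_mass) => *; lra.
Qed.

Definition defect_potential_cst : R := Cm + Ch + (gauss_cst n 1 * occupation_mass + 1).

Lemma defect_potential_cst_ge0 : 0 <= defect_potential_cst.
Proof.
rewrite addr_ge0 ?(bounded_measurable_ge0 bounded_measurable_defect 0)//.
by rewrite addr_ge0// mulr_ge0 ?gauss_cst_ge0 ?occupation_mass_ge0.
Qed.

Lemma defect_potential_le S : (0 < S)%N ->
  \forall N \near \oo, forall x, defect_potential N S x <= defect_potential_cst.
Proof.
case: S => // S _; apply: filterS (heat_defect_potential_le S ltr01 ltr01) => N heat_le x.
have mesh0 := harmonic_gt0 (R := R) N.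
rewrite /defect_potential mulSn (heat_potentialD lam mesh0 bounded_measurable_defect).
rewrite natr_harmonic lerD//.
have := (bounded_measurable_heat_potential lam mesh0 bounded_measurable_defect N.+1).2 x.
by rewrite natr_harmonic mul1r; exact: le_trans (ler_norm _).
Qed.

Lemma heat_defect_potential_far S th r e : 0 < th -> 0 < r -> 0 < e ->
  \forall N \near \oo, forall x, (forall y, U y -> r <= enorm (y - x)) ->
  heat lam th (defect_potential N S) x <=
    doubling_cst R n * gauss_sphere n (2 * th) r * occupation_mass + e.
Proof.
move=> th0 r0 e0; have e20 : 0 < e / 2 by rewrite divr_gt0.
have mesh_near := near_harmonic (nbhs_right_le th0).
have start_near := near_harmonic (near_right0_mul_le (gauss_cst n th * mass) e20).
apply: filterS3 (defect_potential_near S th0 e20) mesh_near start_near => N close mesh_le start_le.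
move=> x far; have tp := time_gt0 N 1 th0; have m0 := harmonic_ge0 (R := R) N.
have far_le : occupation N (heat_kernel (th + grid N 1) x) <=
    doubling_cst R n * gauss_sphere n (2 * th) r * occupation_mass + e / 2.
  apply: le_trans (occupation_le_in N (bounded_measurable_heat_kernel x tp)
    (a := doubling_cst R n * gauss_sphere n (2 * th) r) _ _) _.
  - by rewrite mulr_ge0 ?doubling_cst_ge0// ltW// gauss_sphere_gt0// mulr_gt0.
  - move=> y Uy; apply: heat_kernel_le_sphere (far y Uy) => //; last exact: ltW.
    by rewrite grid1 lerDl m0 mulr_natl mulr2n lerD2l.
  rewrite lerD2l mulrC; apply: le_trans start_le.
  by rewrite ler_wpM2r// ler_wpM2r ?fine_ge0// gauss_cst_le// lerDl grid_ge0.
have := close x; rewrite ler_norml => /andP[_].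
have := occupation_heat_kernel_ge0 N x (time_gt0 N (S * N.+1).+1 th0).
by move: (occupation N _) (occupation N _) (heat _ _ _ _) far_le => *; lra.
Qed.

Lemma exists_small_time L r e : 0 < r -> 0 < e -> exists th, [/\ 0 < th,
  L * ((1 + moment_cst R n 1) * Num.sqrt th) <= e &
  doubling_cst R n * gauss_sphere n (2 * th) r * occupation_mass <= e].
Proof.
move=> r0 e0; near (0 : R)^'+ => d; have d0 : 0 < d by near: d; exact: nbhs_right_gt.
exists (d / 2); split; first by rewrite divr_gt0.
- rewrite sqrtrM ?(ltW d0)// mulrCA [Num.sqrt d * _]mulrC !mulrA.
  by near: d; exact: near_right0_mul_sqrt_le.
- rewrite mulrAC [2 * _]mulrC divfK//; near: d; apply: near_right0_mul_gauss_sphere => //.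
  by rewrite mulr_ge0 ?doubling_cst_ge0 ?occupation_mass_ge0.
Unshelve. all: by end_near.
Qed.

Hypotheses (oU : open U) (lipU : locally_lipschitz_boundary U).

Lemma defect_potential_bounds c S : 0 < c -> (0 < S)%N ->
  gauss_cst n S%:R * occupation_mass <= c / 16 -> \forall N \near \oo,
  [/\ forall x, - (c / 4) <= defect_potential N S x,
      forall x, defect_potential N S x <= defect_potential_cst &
      forall x, ~ U x -> defect_potential N S x <= c / 4].
Proof.
move=> c0 S0 cS; have e0 : 0 < c / 16 by rewrite divr_gt0.
pose L := 4 * (Cm + Ch) * gauss_shift_cst R n * Num.sqrt S%:R.
have lip N : elipschitz L (defect_potential N S) := elipschitz_defect_potential N S.
have L0 : 0 <= L := elipschitz_ge0 (lip 0%N); have L1 : 0 < L + 1 by rewrite ltr_wpDl.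
have [r r0 ext] := uniform_near_exterior oU Urad lipU (divr_gt0 e0 L1).
have L_le : L * (c / 16 / (L + 1)) <= c / 16.
  by rewrite mulrCA ler_piMr ?(ltW e0)// ler_pdivrMr// mul1r lerDl.
have [th [th0 lip_th sphere_th]] := exists_small_time L r0 e0.
apply: filterS3 (heat_defect_potential_ge S0 th0 e0) (defect_potential_le S0)
  (heat_defect_potential_far S th0 r0 e0) => N heat_ge pot_le heat_far.
have heat_close x : `|heat lam th (defect_potential N S) x - defect_potential N S x| <= c / 16.
  exact: le_trans (heat_sub_le lam x th0 (bounded_measurable_defect_potential N S) (lip N)) lip_th.
split=> [x|//|x /ext[x' xx' /heat_far heat_x']].
  have := heat_close x; rewrite ler_norml => /andP[_]; have := heat_ge x.
  by move: (heat _ _ _ _) (defect_potential N S x) (_ * occupation_mass) cS => *; lra.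
have := heat_close x'; rewrite ler_norml => /andP[+ _].
have := le_trans (ler_norm _) (lip N x' x); rewrite enormBC.
have := le_trans (ler_wpM2l L0 xx') L_le; move: heat_x' sphere_th.
move: (heat _ _ _ _) (defect_potential N S x) (defect_potential N S x') (L * enorm _).
by move: (_ * occupation_mass) => *; lra.
Qed.

Lemma discrete_defect_potential c N S : 0 < c -> c <= 1 -> (0 < S)%N ->
  (forall x, - (c / 4) <= defect_potential N S x) ->
  (forall x, defect_potential N S x <= defect_potential_cst) ->
  discrete_potential lam (mesh N) (defect_potential_cst + 1) (Cm + Ch + (Cm + Ch))
    (fun x => defect_potential N S x + c / 4) (fun x => heat lam S%:R defect x - defect x).
Proof.
move=> c0 c1 S0 pot_ge pot_le; have mesh0 := harmonic_gt0 (R := R) N.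
have S0' : 0 < S%:R :> R by rewrite ltr0n.
have pot_bmeas := bounded_measurable_defect_potential N S.
have pot0 x : 0 <= defect_potential N S x + c / 4 by have := pot_ge x; lra.
split=> //.
- split=> [|x]; first by apply: measurable_funD => //; exact: pot_bmeas.1.
  rewrite ger0_norm//; have := pot_le x.
  by move: (defect_potential _ _ _) => *; lra.
- exact: bounded_measurable_heatB S0' bounded_measurable_defect.
- move=> x; rewrite (heatD lam x mesh0 pot_bmeas (bounded_measurable_cst _ (c / 4))) heat_cst//.
  rewrite opprD addrACA subrr addr0 -[X in heat lam X defect](gridM R N S).
  by apply: (heat_potential_poisson lam mesh0 bounded_measurable_defect); rewrite muln_gt0 S0.
Qed.

Variable psi : V -> \bar R.
Hypotheses (lamU : (lam U < +oo)%E) (psi_int : lam.-integrable (U : set E) psi).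
Hypothesis psi_sh : superharmonic_in lam U psi.

Lemma opp_superharmonic_defect_le e : 0 < e ->
  - (\int[lam]_x (real_ext U psi x * defect x)) <= (2 + (Cm + Ch)) * e.
Proof.
have C0 : 0 <= Cm + Ch := bounded_measurable_ge0 bounded_measurable_defect 0.
have ext_i := Rintegrable_real_ext oU psi_int.
have defect_i : Rintegrable lam defect := RintegrableB m_int h_int.
have mass0 := occupation_mass_ge0; move=> e0.
have [c0 c00 superharmonic_le] := superharmonic_potential_le oU lamU psi_int psi_sh
  (addr_ge0 defect_potential_cst_ge0 ler01) (addr_ge0 C0 C0) e0.
pose c := Num.min c0 1; have c_gt0 : 0 < c by rewrite lt_min c00 ltr01.
have [cc0 c1] : c <= c0 /\ c <= 1 by rewrite !ge_min !lexx orbT.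
pose D := \int[lam]_x `|defect x| * \int[lam]_x `|real_ext U psi x|.
have D0 : 0 <= D by rewrite mulr_ge0//; exact: Rintegral_ge0.
have min_gt0 : 0 < Num.min (c / 16) e by rewrite lt_min divr_gt0.
have [S S0] := gauss_cst_mul_small n (addr_ge0 mass0 D0) min_gt0.
have S0' : 0 < S%:R :> R by rewrite ltr0n.
have gS0 := gauss_cst_ge0 n S0'; rewrite le_min mulrDr => /andP[cS DS].
have {}cS := le_trans (ler_wpDr (mulr_ge0 gS0 D0) (lexx _)) cS.
have {}DS := le_trans (ler_wpDl (mulr_ge0 gS0 mass0) (lexx _)) DS.
have [_ psi_lsc _] := psi_sh.
have [t0 t00 L1_le] := heat_L1_continuous_real_ext oU lamU psi_int psi_lsc e0.
have L1_near : \forall d \near 0^'+, heat_L1_dist lam d (real_ext U psi) <= e.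
  near=> d; apply: L1_le; apply/andP; split; near: d; first exact: nbhs_right_gt.
  exact: nbhs_right_le.
have [N [[[pot_ge pot_le pot_out] superharmonic_N] L1_N]] := filter_ex (filterI
  (filterI (defect_potential_bounds c_gt0 S0 cS) (near_harmonic superharmonic_le))
  (near_harmonic L1_near)).
have heat_le : \int[lam]_x (real_ext U psi x *
    heat lam (mesh N) (fun y => heat lam S%:R defect y - defect y) x) <= e.
  apply: superharmonic_N (discrete_defect_potential c_gt0 c1 S0 pot_ge pot_le) _ => //.
  by move=> x /pot_out; move: (defect_potential _ _ _) => *; lra.
apply: le_trans (opp_Rintegral_le (harmonic_gt0 N) S0' ext_i defect_i bounded_measurable_defect) _.
rewrite -[_ * _ * \int[lam]_x `|real_ext U psi x|]mulrA -/D [leRHS]mulrDl.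
apply: lerD; last by rewrite ler_wpM2l.
by move: heat_le DS; move: (Rintegral _ _ _) (_ * D) => *; lra.
Unshelve. all: by end_near.
Qed.

Lemma superharmonic_defect_ge0 : 0 <= \int[lam]_x (real_ext U psi x * defect x).
Proof.
have K0 : 0 < 2 + (Cm + Ch).
  by rewrite ltr_wpDr// (bounded_measurable_ge0 bounded_measurable_defect 0).
rewrite -oppr_le0; apply/ler_addgt0Pr => e e0; rewrite add0r.
have -> : e = (2 + (Cm + Ch)) * (e / (2 + (Cm + Ch))) by rewrite mulrC divfK// gt_eqF.
by apply: opp_superharmonic_defect_le; exact: divr_gt0.
Qed.

End TerminalLaw.
End StoppedBrownianMotion.

(** * Weak duality *)

Section BoundedSets.
Variables (R : realType) (n : nat).
Local Notation V := 'rV[R]_(n.+1).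
Implicit Types (U : set V) (k : R).

Lemma bounded_set_sub_cube U : bounded_set U -> exists k, U `<=` cube k.
Proof.
move=> [M [_ U_le]]; exists (`|M| + 1) => x Ux i.
rewrite !mxE -ler_norml (le_trans (norm_coord_le x i))//.
by apply: U_le => //; rewrite (le_lt_trans (ler_norm M))// ltrDl.
Qed.

Lemma closure_sub_cube U k : U `<=` cube k -> closure U `<=` cube k.
Proof.
move=> Uk; have closed_cube : closed (cube k : set V).
  by apply: compact_closed; [exact: norm_hausdorff|exact: compact_cube].
by rewrite ((closure_id _).1 closed_cube); exact: closure_subset.
Qed.

End BoundedSets.

Section PatchedIntegrals.
Context (d : measure_display) (T : measurableType d) (R : realType).
Variables (mu : {measure set T -> \bar R}) (A : set T).
Hypothesis mA : measurable A.
Implicit Types (f g : T -> R) (M : R).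

Lemma integral_EFin_patch f :
  (\int[mu]_(x in A) (f x)%:E = \int[mu]_x ((f \_ A) x)%:E)%E.
Proof. by rewrite integral_mkcond restrict_EFin. Qed.

Lemma integral_EFin_patchM f g :
  (\int[mu]_(x in A) (f x * g x)%:E = \int[mu]_x ((f \_ A) x * g x)%:E)%E.
Proof.
rewrite integral_EFin_patch; apply: eq_integral => x _.
by rewrite !patchE; case: ifP => // _; rewrite mul0r.
Qed.

Lemma Rintegrable_patch f : mu.-integrable A (EFin \o f) -> Rintegrable mu (f \_ A).
Proof. by rewrite (integrable_mkcond _ mA) restrict_EFin. Qed.

Lemma Rintegrable_bounded_support f M : (mu A < +oo)%E -> bounded_measurable f M ->
  (forall x, ~ A x -> f x = 0) -> Rintegrable mu f.
Proof.
move=> muA [mf fM] f0; apply: (le_Rintegrable mf _ (RintegrableZ M (Rintegrable_indic mA muA))).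
move=> x; rewrite indicE; have [Ax|Ax] := pselect (A x); first by rewrite mem_set// mulr1.
by rewrite memNset// mulr0 f0// normr0.
Qed.

Lemma integral_le0 (f : T -> \bar R) :
  (forall x, A x -> f x <= 0)%E -> (\int[mu]_(x in A) f x <= 0)%E.
Proof.
move=> f0; rewrite integralE integral0_eq ?sub0e ?oppe_le0 ?integral_ge0// => x Ax.
by rewrite funeposE max_r ?f0.
Qed.

End PatchedIntegrals.

Section DualObjective.
Variables (R : realType) (n : nat).
Local Notation V := 'rV[R]_(n.+1).
Local Notation E := (Rd R n).
Local Notation bmeas := (@bounded_measurable _ E R).
Variables (lam : lebesgueRd R n) (U : set V) (psi : V -> \bar R).
Hypotheses (oU : open U) (psi_int : lam.-integrable (U : set E) psi).

Let mU : measurable (U : set E). Proof. exact: measurable_open. Qed.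

Lemma integral_density_real_ext (mu : {measure set E -> \bar R}) (m : V -> R) C :
  (mu setT < +oo)%E -> bmeas m C -> (forall x, 0 <= m x) -> has_density lam mu m ->
  (\int[mu]_(x in (U : set E)) psi x = (\int[lam]_x (real_ext U psi x * m x))%R%:E)%E.
Proof.
move=> mu_lty mC m0 mu_m; pose psiU := (psi : E -> \bar R) \_ (U : set E).
have m_psiU : measurable_fun setT psiU.
  exact: measurable_int ((integrable_mkcond (psi : E -> \bar R) mU).1 psi_int).
have ext_m := RintegrableM (Rintegrable_real_ext oU psi_int) mC.
rewrite (EFin_Rintegral ext_m); transitivity (\int[mu]_x psiU x)%E; first exact: integral_mkcond.
have density := ge0_integral_density mu_lty mC.1 m0 mu_m.
rewrite [LHS]integralE (density _ (measurable_funepos m_psiU))//.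
rewrite (density _ (measurable_funeneg m_psiU))//.
transitivity (\int[lam]_x (psiU x * (m x)%:E))%E.
  rewrite [RHS]integralE; congr (_ - _)%E; apply: eq_integral => x _.
    by rewrite !funeposE maxe_pMl// ?lee_fin// mul0e.
  by rewrite !funenegE maxe_pMl// ?lee_fin// mul0e mulNe.
apply: ae_eq_integral => //.
- by apply: emeasurable_funM => //; apply/measurable_EFinP; exact: mC.1.
- by apply/measurable_EFinP; exact: Rintegrable_measurable ext_m.
rewrite /ae_eq; apply: (ae_sub (ae_fin_num_psi oU psi_int)) => x psi_fin _.
rewrite EFinM; congr (_ * _)%E; rewrite /psiU; have [Ux|Ux] := pselect (U x).
  by rewrite real_extK ?psi_fin// patchT// inE.
by rewrite real_ext_out// patchN// notin_setE.
Qed.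

Variables (u f phi h : V -> R) (Cu Cf : R).
Hypotheses (uC : bmeas ((u : E -> R) \_ (U : set E)) Cu).
Hypotheses (fC : bmeas f Cf) (hC : bmeas h Cf) (h_int : Rintegrable lam h).
Hypotheses (h_ge0 : forall x, 0 <= h x) (h_le : forall x, U x -> h x <= f x)
  (h_out : forall x, ~ U x -> h x = 0).
Hypotheses (phi_int : lam.-integrable (U : set E) (fun x => (phi x)%:E))
  (phi_le0 : forall x, U x -> phi x <= 0)
  (phi_psi : forall x, U x -> ((phi x - u x)%:E <= psi x)%E).

Lemma dual_integrand_le x : (U x -> psi x \is a fin_num) ->
  ((phi : E -> R) \_ (U : set E)) x * f x <=
  ((u : E -> R) \_ (U : set E)) x * h x + real_ext U psi x * h x.
Proof.
move=> psi_fin; have [Ux|Ux] := pselect (U x); last first.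
  by rewrite patchN ?notin_setE// h_out// !mulr0 mul0r addr0.
rewrite !patchT ?inE//; apply: le_trans (ler_wnM2l (phi_le0 Ux) (h_le Ux)) _.
rewrite -mulrDl ler_wpM2r// -lerBlDl -lee_fin real_extK ?psi_fin//.
exact: phi_psi.
Qed.

Lemma dual_objective_le :
  \int[lam]_x (((phi : E -> R) \_ (U : set E)) x * f x) <=
  \int[lam]_x (((u : E -> R) \_ (U : set E)) x * h x) + \int[lam]_x (real_ext U psi x * h x).
Proof.
have ext_h := RintegrableM (Rintegrable_real_ext oU psi_int) hC.
have u_h : Rintegrable lam (fun x => ((u : E -> R) \_ (U : set E)) x * h x).
  by under eq_fun do rewrite mulrC; exact: RintegrableM h_int uC.
rewrite -(RintegralD measurableT u_h ext_h); apply: ae_le_Rintegral.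
- exact: RintegrableM (Rintegrable_patch mU phi_int) fC.
- exact: RintegrableD.
- exact: ae_sub (ae_fin_num_psi oU psi_int) dual_integrand_le.
Qed.

End DualObjective.

Section BrownianDuality.
Context (R : realType) (n : nat) (dO : measure_display) (Omega : measurableType dO).
Local Notation V := 'rV[R]_(n.+1).
Local Notation E := (Rd R n).
Local Notation bmeas := (@bounded_measurable _ E R).
Variables (U : set V) (u f m : V -> R) (Cu Cf Cm : R).
Hypotheses (oU : open U) (bU : bounded_set U) (lipU : locally_lipschitz_boundary U).
Hypotheses (u_ge0 : forall x, U x -> 0 <= u x) (u_le : forall x, U x -> u x <= Cu)
  (u_cont : forall x, U x -> {for x, continuous u}).
Hypotheses (mf : measurable_fun setT (f : E -> R)) (f_gt0 : forall x, 0 < f x)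
  (f_le : forall x, f x <= Cf).
Hypotheses (mC : bmeas m Cm) (m_ge0 : forall x, 0 <= m x)
  (m_supp : forall x, ~ closure U x -> m x = 0).

Let mU : measurable (U : set E). Proof. exact: measurable_open. Qed.

Let fC : bmeas f Cf. Proof. by split=> // x; rewrite ger0_norm// ltW. Qed.

Lemma bounded_measurable_patch_continuous : bmeas ((u : E -> R) \_ (U : set E)) `|Cu|.
Proof.
split=> [|x].
  apply/(measurable_restrict _ mU measurableT); rewrite setTI.
  exact: measurable_continuous_in.
rewrite patchE; case: ifPn => [/set_mem Ux|_]; last by rewrite normr0.
by rewrite ger0_norm ?u_ge0// (le_trans (u_le Ux))// ler_norm.
Qed.

Lemma density_belowP (lam nu : {measure set E -> \bar R}) : density_below lam nu f U ->
  exists h : V -> R, [/\ bmeas h Cf, forall x, 0 <= h x, forall x, U x -> h x <= f x,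
    forall x, ~ U x -> h x = 0 & has_density lam nu h].
Proof.
move=> [h [mh h_le nu_h]]; have h0 x : 0 <= h x by case: (h_le x).
have hU x : U x -> h x <= f x by move=> Ux; have [_] := h_le x; rewrite asboolT.
have h_out x : ~ U x -> h x = 0.
  by move=> Ux; have [_] := h_le x; rewrite asboolF// => hx; apply/le_anti; rewrite hx h0.
exists h; split=> //; split=> // x; rewrite ger0_norm//.
have [/hU hx|/h_out->] := pselect (U x); first exact: le_trans (f_le x).
exact: le_trans (ltW (f_gt0 x)) (f_le x).
Qed.

Lemma Rintegrable_closure_support (lam : {measure set E -> \bar R}) :
  is_lebesgue_d lam -> Rintegrable lam m.
Proof.
have [k Uk] := bounded_set_sub_cube bU; move=> lamE.
apply: (Rintegrable_bounded_support (A := cube k : set E) _ _ mC).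
- exact: measurable_box.
- exact: lebesgue_box_lty.
- by move=> x xk; apply: m_supp; apply: contra_not xk; exact: closure_sub_cube.
Qed.

Variables (mu : {measure set E -> \bar R}) (P : {measure set Omega -> \bar R}).
Variables (F : R -> set (set Omega)) (W : R -> Omega -> V).
Hypotheses (Ffil : filtration F)
  (start : forall B : set E, measurable B -> P [set w | B (W 0 w)] = mu B).

Lemma initial_mass : P setT = mu setT.
Proof. by rewrite -start. Qed.

Lemma weak_duality_pair_pos_mass (lam : lebesgueRd R n) (nu : {measure set E -> \bar R}) tau
    (phi : V -> R) (psi : V -> \bar R) :
  brownian_motion lam P F W -> has_density lam mu m -> P setT != 0%E ->
  randomized_stopping_time F tau -> before_exit U W tau -> density_below lam nu f U ->
  terminal_law P W tau nu -> dual_feasible lam u U phi psi ->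
  (\int[lam]_(y in (U : set E)) (phi y * f y)%:E - \int[mu]_(x in (U : set E)) psi x <=
   \int[nu]_(x in (U : set E)) (u x)%:E)%E.
Proof.
move=> BM mu_m Ppos rst exitU /density_belowP[h [hC h0 h_le h_out nu_h]] term.
move=> [phi_int psi_int phi_le0 phi_psi psi_sh].
have [k Uk] := bounded_set_sub_cube bU.
have lamU : (lam U < +oo)%E.
  apply: le_lt_trans (lebesgue_box_lty (lebesgueRdP lam) (const_mx (- k)) (const_mx k)).
  by apply: le_measure; rewrite ?inE//; exact: measurable_box.
have m_int := Rintegrable_closure_support (lebesgueRdP lam).
have h_int := Rintegrable_bounded_support mU lamU hC h_out.
have mu_lty : (mu setT < +oo)%E by rewrite mu_m// -EFin_Rintegral// ltry.
have nu_lty : (nu setT < +oo)%E by rewrite nu_h// -EFin_Rintegral// ltry.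
have Pfin : (P setT < +oo)%E by rewrite initial_mass.
have start_m (B : set E) : measurable B -> P [set w | B (W 0 w)] = (\int[lam]_(x in B) (m x)%:E)%E.
  by move=> mB; rewrite start// mu_m.
have := superharmonic_defect_ge0 Ffil BM Pfin Ppos rst exitU Uk mC m_ge0 m_int
  start_m hC h0 h_int nu_h nu_lty term oU lipU lamU psi_int psi_sh.
have ext_i := Rintegrable_real_ext oU psi_int.
have ext_m := RintegrableM ext_i mC; have ext_h := RintegrableM ext_i hC.
under eq_Rintegral do rewrite mulrBr; rewrite RintegralB// subr_ge0 => ext_le.
have u_patch := bounded_measurable_patch_continuous.
have patch_ge0 x : 0 <= ((u : E -> R) \_ (U : set E)) x.
  by rewrite patchE; case: ifPn => // /set_mem; exact: u_ge0.
have u_h : Rintegrable lam (fun x => ((u : E -> R) \_ (U : set E)) x * h x).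
  by under eq_fun do rewrite mulrC; exact: RintegrableM h_int u_patch.
have phi_f := RintegrableM (Rintegrable_patch mU phi_int) fC.
rewrite (integral_density_real_ext oU psi_int mu_lty mC m_ge0 mu_m).
rewrite integral_EFin_patchM [X in (_ <= X)%E]integral_EFin_patch -(EFin_Rintegral phi_f).
rewrite (ge0_Rintegral_density nu_lty hC.1 h0 nu_h u_patch.1 patch_ge0) -(EFin_Rintegral u_h).
rewrite -EFinB lee_fin lerBlDr.
apply: (le_trans (dual_objective_le oU psi_int u_patch fC hC h_int h0 h_le h_out phi_int
  phi_le0 phi_psi)).
by rewrite lerD2l.
Qed.

Lemma weak_duality_pair_null_mass (lam nu : {measure set E -> \bar R}) (phi : V -> R)
    (psi : V -> \bar R) :
  P setT = 0%E -> (forall x, U x -> phi x <= 0) ->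
  (\int[lam]_(y in (U : set E)) (phi y * f y)%:E - \int[mu]_(x in (U : set E)) psi x <=
   \int[nu]_(x in (U : set E)) (u x)%:E)%E.
Proof.
rewrite initial_mass => mu0 phi_le0.
have -> : (\int[mu]_(x in (U : set E)) psi x = 0)%E.
  rewrite -[RHS](@integral_measure_zero _ E R (U : set E) psi).
  apply: eq_measure_integral => A mA _; suff : mu A = 0%E by [].
  by apply/eqP; rewrite eq_le measure_ge0 andbT -mu0; apply: le_measure; rewrite ?inE.
rewrite sube0; apply: (@le_trans _ _ 0%E); last by apply: integral_ge0 => x /u_ge0.
by apply: integral_le0 => y Uy; rewrite lee_fin mulr_le0_ge0 ?phi_le0// ltW.
Qed.

Lemma brownian_lebesgueRd (lam : {measure set E -> \bar R}) :
  is_lebesgue_d lam -> brownian_motion lam P F W -> (P setT < +oo)%E -> P setT != 0%E ->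
  exists lam' : lebesgueRd R n, lam = lam' :> {measure set E -> \bar R}.
Proof.
move=> lamE BM Pfin Ppos; have lam_sf := lebesgue_sigma_finite lamE.
pose lam_sigma : {sigma_finite_measure set E -> \bar R} := HB.pack (Measure.sort lam)
  (isSigmaFinite.Build _ _ _ (Measure.sort lam) lam_sf)
  (isSFinite.Build _ _ _ (Measure.sort lam) (sfinite_measure_sigma_finite lam_sf)).
exists (@LebesgueRd _ _ lam_sigma lamE
  (brownian_gauss_mass (lam := lam_sigma) Ffil BM Pfin Ppos)).
exact: eq_measure.
Qed.

Lemma weak_duality_pair (lam nu : {measure set E -> \bar R}) tau (phi : V -> R)
    (psi : V -> \bar R) :
  is_lebesgue_d lam -> brownian_motion lam P F W -> has_density lam mu m ->
  randomized_stopping_time F tau -> before_exit U W tau -> density_below lam nu f U ->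
  terminal_law P W tau nu -> dual_feasible lam u U phi psi ->
  (\int[lam]_(y in (U : set E)) (phi y * f y)%:E - \int[mu]_(x in (U : set E)) psi x <=
   \int[nu]_(x in (U : set E)) (u x)%:E)%E.
Proof.
move=> lamE BM mu_m rst exitU dens term feas.
have [P0|Ppos] := eqVneq (P setT) 0%E.
  by apply: weak_duality_pair_null_mass => //; case: feas.
have Pfin : (P setT < +oo)%E.
  by rewrite initial_mass mu_m// -EFin_Rintegral ?ltry//; exact: Rintegrable_closure_support.
have [lam' lam_eq] := brownian_lebesgueRd lamE BM Pfin Ppos; subst lam.
exact: weak_duality_pair_pos_mass BM mu_m Ppos rst exitU dens term feas.
Qed.

End BrownianDuality.

Theorem theorem4p1 (R : realType) (n : nat)
  (lam : {measure set (Rd R n) -> \bar R})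
  (U : set 'rV[R]_(n.+1)) (u f : 'rV[R]_(n.+1) -> R)
  (mu : {measure set (Rd R n) -> \bar R}) :
  is_lebesgue_d lam ->
  (* U bounded open with locally Lipschitz boundary *)
  open U -> bounded_set U -> locally_lipschitz_boundary U ->
  (* u : closure U -> [0,oo) bounded, smooth, Delta u < 0 in U *)
  (forall x, closure U x -> 0 <= u x) ->
  (exists C : R, forall x, closure U x -> u x <= C) ->
  smooth_on_closure U u ->
  (forall x, U x -> laplacian u x < 0) ->
  (* f : R^d -> (0,oo) bounded measurable *)
  measurable_fun setT (f : Rd R n -> R) ->
  (forall x, 0 < f x) -> (exists C : R, forall x, f x <= C) ->
  (* mu has a bounded density supported in closure U *)
  (exists m : Rd R n -> R, [/\ measurable_fun setT m,
      exists C : R, forall x, 0 <= m x <= C,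
      forall x, ~ closure U x -> m x = 0 &
      forall A : set (Rd R n), measurable A ->
        mu A = (\int[lam]_(x in A) (m x)%:E)%E]) ->
  (mu U <= \int[lam]_(x in (U : set (Rd R n))) (f x)%:E)%E ->
  (* any filtered space carrying a Brownian motion started with law mu *)
  forall (dO : measure_display) (Omega : measurableType dO)
    (P : {measure set Omega -> \bar R}) (F : R -> set (set Omega))
    (W : R -> Omega -> 'rV[R]_(n.+1)),
  filtration F -> brownian_motion lam P F W ->
  (forall B : set (Rd R n), measurable B ->
     P [set w | B (W 0 w)] = mu B) ->
  (dual_value lam mu f u U <= primal_value lam P F W f u U)%E.
Proof.
move=> lamE oU bU lipU u_ge0 [Cu uC] [D [_ closure_D u_smooth]] _ mf f_gt0 [Cf fC].
move=> [m [mm [Cm mC] m_supp mu_m]] _ dO Omega P F W Ffil BM start.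
have U_closure x : U x -> closure U x by exact: subset_closure.
have u_cont x : U x -> {for x, continuous u} by move=> /U_closure/closure_D/(u_smooth [::])[].
have m_ge0 x : 0 <= m x by case/andP: (mC x).
have m_bounded : bounded_measurable m Cm.
  by split=> // x; rewrite ger0_norm//; case/andP: (mC x).
apply: ge_ereal_sup => _ [[phi psi] /= feasible <-].
apply: le_ereal_inf_tmp => _ [nu [tau [rst exitU dens term]] <-].
apply: (weak_duality_pair oU bU lipU (fun x Ux => u_ge0 x (U_closure x Ux))
  (fun x Ux => uC x (U_closure x Ux)) u_cont mf f_gt0 fC m_bounded m_ge0 m_supp Ffil start
  lamE BM mu_m rst exitU dens term feasible).
Qed.
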